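(* Let $(X,\mathsf d)$ be a complete and separable metric space, $\mathfrak m\in\mathcal M_+(X)$ a finite Borel measure, $q\in(1,\infty)$ and $p=q/(q-1)$. (1) If $\boldsymbol\rho$ is a Borel probability measure on $C([0,1];X)$, concentrated on curves of positive length, with finite $q$-energy and parametric barycenter $h\in L^\infty(X,\mathfrak m)$, then $\boldsymbol\pi=\mathsf i_\sharp\boldsymbol\rho$ has barycenter in $L^q(X,\mathfrak m)$ and $$c_q(\boldsymbol\pi)\le\Big(\int\mathcal E_q(\gamma)\,d\boldsymbol\rho(\gamma)\Big)^{1/q}\|h\|_{L^\infty(X,\mathfrak m)}^{1/p}.$$ (2) Conversely, if $\boldsymbol\pi$ is a Borel probability measure on $\mathscr C(X)$ with barycenter in $L^q(X,\mathfrak m)$, with $\boldsymbol\pi$-essentially bounded length $\ell(\gamma)$, and concentrated on a Souslin set $\Gamma\subset\mathscr C(X)$, then there exists a Borel probability measure $\boldsymbol\rho$ on $C([0,1];X)$ with finite $q$-energy and parametric barycenter in $L^\infty(X,\mathfrak m)$, concentrated on a Souslin set contained in $[\mathsf j(\Gamma)]$. (3) More generally, let $\boldsymbol\sigma$ be a Borel probability measure on $C([0,1];X)$ concentrated on a Souslin set $\Gamma\subset AC^\infty([0,1];X)$, with parametric barycenter in $L^q(X,\mathfrak m)$ and with $\boldsymbol\sigma$-essentially bounded Lipschitz constants. Then there exists a Borel probability measure $\boldsymbol\rho$ on $C([0,1];X)$ with finite $q$-energy and parametric barycenter in $L^\infty(X,\mathfrak m)$, concentrated on a Souslin set contained in 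$[\Gamma]$.
   Context: $C([0,1];X)$ carries the topology of uniform convergence. $AC([0,1];X)$ is the set of absolutely continuous curves $\gamma:[0,1]\to X$, with metric derivative $|\dot\gamma_t|$ and length $\ell(\gamma)=\int_0^1|\dot\gamma_t|\,dt$; $AC^q([0,1];X)$ is the subset with $|\dot\gamma|\in L^q(0,1)$; $AC^\infty([0,1];X)$ is the set of Lipschitz curves. The $q$-energy is $\mathcal E_q(\gamma)=\int_0^1|\dot\gamma_t|^q\,dt$ if $\gamma\in AC^q([0,1];X)$ and $+\infty$ otherwise. Souslin sets are continuous images of Polish spaces. A Borel probability measure $\boldsymbol\rho$ on $C([0,1];X)$ has finite $q$-energy if it is concentrated on $AC^q([0,1];X)$ and $\int\mathcal E_q\,d\boldsymbol\rho<\infty$. It has parametric barycenter $h$ if $\int\int_0^1 f(\gamma_t)\,dt\,d\boldsymbol\rho(\gamma)=\int_X fh\,d\mathfrak m$ for all bounded continuous $f:X\to\mathbb R$. Equivalence: for $\gamma,\tilde\gamma\in AC([0,1];X)$, $\gamma\sim\tilde\gamma$ if $\gamma=\tilde\gamma\circ\varphi$ for some increasing bijection $\varphi:[0,1]\to[0,1]$ with $\varphi,\varphi^{-1}$ absolutely continuous. For a set $\Gamma$ of curves in $AC([0,1];X)$, $[\Gamma]$ is the set of all curves in $AC([0,1];X)$ equivalent to some element of $\Gamma$. Non-parametric curves: $AC_0([0,1];X)=\{\gamma\in AC([0,1];X): |\dot\gamma|>0\ \text{a.e.}\}$ and $\mathscr C(X)=AC_0([0,1];X)/\!\sim$ with the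 quotient topology (from the uniform topology) and projection $\pi_{\mathscr C}$. $AC^\infty_c([0,1];X)$ is the set of curves with $|\dot\gamma|=\ell(\gamma)>0$ a.e. For $\gamma\in AC([0,1];X)$ with $\ell(\gamma)>0$, $\mathsf k\gamma$ is the unique $\eta\in AC^\infty_c([0,1];X)$ with $\gamma=\eta\circ\mathsf s$, where $\mathsf s(t)=\ell(\gamma)^{-1}\int_0^t|\dot\gamma_r|\,dr$. Then $\mathsf i=\pi_{\mathscr C}\circ\mathsf k$ maps $\{\gamma\in AC([0,1];X):\ell(\gamma)>0\}$ to $\mathscr C(X)$, and $\mathsf j:\mathscr C(X)\to AC^\infty_c([0,1];X)$ sends a class to its unique constant speed representative. The length is well defined on $\mathscr C(X)$. For $\underline\gamma=[\gamma]\in\mathscr C(X)$, $J\underline\gamma=J\gamma$ is the finite Borel measure on $X$ with $\int_X g\,dJ\gamma=\int_0^1 g(\gamma_t)|\dot\gamma_t|\,dt$ for Borel $g\ge0$. A Borel probability measure $\boldsymbol\pi$ on $\mathscr C(X)$ has barycenter in $L^q(X,\mathfrak m)$ if $\int J\underline\gamma\,d\boldsymbol\pi(\underline\gamma)=g\,\mathfrak m$ for some $g\in L^q(X,\mathfrak m)$, and then $c_q(\boldsymbol\pi)=\|g\|_{L^q(X,\mathfrak m)}$. *)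

(* Defs.v *)
From HB Require Import structures.
From mathcomp Require Import all_boot all_order all_algebra generic_quotient.
From mathcomp Require Import all_classical all_reals all_analysis.

Set Implicit Arguments.
Unset Strict Implicit.
Unset Printing Implicit Defensive.

Import Order.TTheory GRing.Theory Num.Theory.
Import numFieldNormedType.Exports.

Local Open Scope classical_set_scope.
Local Open Scope ring_scope.
Local Open Scope quotient_scope.

(* The class Complete includes Pointed (as does measurableType), so spaces of
   this type are nonempty. *)
#[short(type="completeMetricType")]
HB.structure Definition CompleteMetric (R : numDomainType) :=
  {M of Metric R M & Complete M}.

Definition separable_space (T : topologicalType) :=
  exists2 D : set T, countable D & dense D.

(* The empty set is listed apart because completeMetricType is pointed. *)
Definition souslin (R : realType) (T : topologicalType) (A : set T) :=
  A = set0 \/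
  exists (P : completeMetricType R) (f : P -> T),
    [/\ separable_space P, continuous f & range f = A].

Notation borel T := (g_sigma_algebraType (@open T)).

(* A need not be measurable. *)
Definition concentrated d (T : measurableType d) (R : realType)
    (mu : {measure set T -> \bar R}) (A : set T) := mu.-negligible (~` A).

(* nu = f_# mu, where f is measurable with respect to the completion of mu:
   up to a mu-negligible set, f @^-1` B is a measurable set A. *)
Definition image_measure d1 d2 (T1 : measurableType d1)
    (T2 : measurableType d2) (R : realType) (mu : {measure set T1 -> \bar R})
    (f : T1 -> T2) (nu : {measure set T2 -> \bar R}) :=
  forall B, measurable B -> exists A,
    [/\ measurable A, mu.-negligible ((A `\` f @^-1` B) `|` (f @^-1` B `\` A))
      & nu B = mu A].

Definition unit_interval (R : realType) : set R := `[0, 1].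
Arguments unit_interval : clear implicits.

Lemma clamp_subproof (R : realType) (t : R) :
  Num.max 0 (Num.min t 1) \in unit_interval R.
Proof.
rewrite inE /unit_interval/= in_itv/= le_max lexx/= ge_max ler01.
by rewrite ge_min lexx orbT.
Qed.

Definition clamp (R : realType) (t : R) : unit_interval R :=
  exist _ (Num.max 0 (Num.min t 1)) (clamp_subproof t).

Section absolute_continuity.
Context (R : realType) (Y : metricType R).

Definition subintervals (s : seq (unit_interval R * unit_interval R)) :=
  all (fun i => val i.1 <= val i.2) s &&
  pairwise (fun i j => (val i.2 <= val j.1) || (val j.2 <= val i.1)) s.

Definition abs_cont (f : unit_interval R -> Y) :=
  forall e : R, 0 < e -> exists2 d : R, 0 < d &
    forall s, subintervals s -> \sum_(i <- s) (val i.2 - val i.1) < d ->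
      \sum_(i <- s) mdist (f i.1) (f i.2) < e.

End absolute_continuity.

Section increasing.
Context (R : realType).
Implicit Types phi psi : unit_interval R -> unit_interval R.

Lemma increasing_le phi s t : {homo phi : s t / val s < val t} ->
  val s <= val t -> val (phi s) <= val (phi t).
Proof.
move=> phi_inc; rewrite le_eqVlt => /orP[/eqP/val_inj -> //|/phi_inc/ltW//].
Qed.

Lemma increasing_inv phi psi : cancel psi phi ->
  {homo phi : s t / val s < val t} -> {homo psi : s t / val s < val t}.
Proof.
move=> psiK phi_inc s t; rewrite !ltNge; apply: contra => /increasing_le.
by move=> /(_ _ phi_inc); rewrite !psiK.
Qed.

Lemma abs_cont_comp (Y : metricType R) (f : unit_interval R -> Y) phi :
  {homo phi : s t / val s < val t} ->
  abs_cont (fun t => val (phi t) : R^o) -> abs_cont f -> abs_cont (f \o phi).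
Proof.
move=> phi_inc acphi acf e /acf[d /acphi[c c0 phiP] fP]; exists c => // s sI sc.
have /andP[/allP sle spw] := sI.
have := fP [seq (phi i.1, phi i.2) | i <- s]; rewrite !big_map/=; apply.
  apply/andP; split.
    by apply/allP => _ /mapP[i /sle ile ->]/=; exact: increasing_le.
  rewrite pairwise_map; apply: sub_pairwise spw => i j /=.
  by case/orP => /(increasing_le phi_inc) ->; rewrite ?orbT.
rewrite (le_lt_trans _ (phiP s sI sc))// le_eqVlt; apply/orP; left; apply/eqP.
apply: eq_big_seq => i /sle ile.
by rewrite /mdist/= ger0_norm// subr_ge0 increasing_le.
Qed.

End increasing.

Section curves.
Context (R : realType) (X : completeMetricType R).

Definition curve : Type := continuousType (unit_interval R) X.

HB.instance Definition _ := Choice.on curve.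
HB.instance Definition _ := Uniform.copy curve
  (initial_topology
    (id : curve -> arrow_uniform_type (unit_interval R) X)).

Lemma cst_curve_subproof :
  continuous (fun _ : unit_interval R => point : X).
Proof. exact: cst_continuous. Qed.
HB.instance Definition _ := isPointed.Build curve (mkcts cst_curve_subproof).

Implicit Types (g h : curve) (q : R).

Local Notation leb := (@lebesgue_measure R).

(* For an absolutely continuous curve the limit exists for a.e. t in [0, 1];
   where it does not exist, lim takes an arbitrary value. *)
Definition metric_derivative g (t : R) : R :=
  lim (mdist (g (clamp s)) (g (clamp t)) / `|s - t| @[s --> t^']).

Definition AC_curve : set curve := [set g | abs_cont g].

Definition curve_length g : \bar R :=
  \int[leb]_(t in `[0, 1]) (metric_derivative g t)%:E.

Definition power_integral q g : \bar R :=
  \int[leb]_(t in `[0, 1]) (metric_derivative g t `^ q)%:E.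

Definition ACq_curve q : set curve :=
  [set g | AC_curve g /\ (power_integral q g < +oo)%E].

Definition energy q g : \bar R :=
  if `[< ACq_curve q g >] then power_integral q g else +oo%E.

Definition has_lipschitz_constant (L : R) g :=
  forall s t, mdist (g s) (g t) <= L * `|val s - val t|.

Definition ACinfty_curve : set curve :=
  [set g | exists L, has_lipschitz_constant L g].

Definition AC0_curve : set curve :=
  [set g | AC_curve g /\
    {ae leb, forall t, 0 <= t <= 1 -> 0 < metric_derivative g t}].

Definition ACc_curve : set curve :=
  [set g | ACinfty_curve g /\ (0 < curve_length g)%E /\
    {ae leb, forall t, 0 <= t <= 1 ->
      (metric_derivative g t)%:E = curve_length g}].

Definition equiv_curve g h :=
  exists phi psi : unit_interval R -> unit_interval R,
    [/\ cancel phi psi, cancel psi phi,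
        {homo phi : s t / val s < val t},
        abs_cont (fun t => val (phi t) : R^o) &
        abs_cont (fun t => val (psi t) : R^o)] /\
    forall t, g t = h (phi t).

Definition equivalent_curves (G : set curve) : set curve :=
  [set g | AC_curve g /\ exists h, [/\ G h, AC_curve h & equiv_curve g h]].

Lemma equiv_curve_refl g : equiv_curve g g.
Proof.
exists id, id; split=> //; split => //.
all: move=> e e0; exists e => // s /andP[/allP sle _].
all: rewrite [in X in _ -> X](eq_big_seq (fun i => val i.2 - val i.1)) //.
all: by move=> i /sle ile; rewrite /mdist/= ger0_norm// subr_ge0.
Qed.

Lemma equiv_curve_sym g h : equiv_curve g h -> equiv_curve h g.
Proof.
move=> [phi [psi [[phiK psiK phi_inc acphi acpsi] gh]]].
exists psi, phi; split=> [|t]; last by rewrite gh psiK.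
by split=> //; exact: increasing_inv phi_inc.
Qed.

Lemma equiv_curve_trans h g k :
  equiv_curve g h -> equiv_curve h k -> equiv_curve g k.
Proof.
move=> [phi [psi [[phiK psiK phi_inc acphi acpsi] gh]]].
move=> [phi' [psi' [[phiK' psiK' phi_inc' acphi' acpsi'] hk]]].
exists (phi' \o phi), (psi \o psi'); split=> [|t]; last by rewrite gh hk.
split; [exact: can_comp | exact: can_comp | | |].
- by move=> s t /phi_inc/phi_inc'.
- exact: (abs_cont_comp (f := fun t => val (phi' t) : R^o)).
- apply: (abs_cont_comp (f := fun t => val (psi t) : R^o)) => //.
  exact: increasing_inv phi_inc'.
Qed.

Definition equiv_curveb (g h : AC0_curve) := `[< equiv_curve (val g) (val h) >].

Lemma equiv_curveb_refl : reflexive equiv_curveb.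
Proof. by move=> g; apply/asboolP; exact: equiv_curve_refl. Qed.

Lemma equiv_curveb_sym : symmetric equiv_curveb.
Proof. by move=> g h; apply/asboolP/asboolP => /equiv_curve_sym. Qed.

Lemma equiv_curveb_trans : transitive equiv_curveb.
Proof.
by move=> h g k /asboolP gh /asboolP hk; apply/asboolP/(equiv_curve_trans gh).
Qed.

Canonical equiv_curve_rel : equiv_rel AC0_curve :=
  EquivRel equiv_curveb equiv_curveb_refl equiv_curveb_sym equiv_curveb_trans.

Definition nonparam : Type := quotient_topology {eq_quot equiv_curve_rel}.
HB.instance Definition _ := Topological.copy nonparam
  (quotient_topology {eq_quot equiv_curve_rel}).
HB.instance Definition _ := Quotient.copy nonparam
  (quotient_topology {eq_quot equiv_curve_rel}).

(* Measurable types must be pointed, whereas nonparam is empty when X has no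
   nonconstant absolutely continuous curve. *)
Definition pnonparam (c0 : nonparam) : Type := nonparam.
HB.instance Definition _ (c0 : nonparam) :=
  Topological.copy (pnonparam c0) nonparam.
HB.instance Definition _ (c0 : nonparam) := isPointed.Build (pnonparam c0) c0.

Definition representative (c : nonparam) : curve := val (repr c).

Definition nonparam_length (c : nonparam) : \bar R :=
  curve_length (representative c).

Definition normalized_arc_length g (t : R) : R :=
  fine (\int[leb]_(r in `[0%R, t]) (metric_derivative g r)%:E)%E /
  fine (curve_length g).

Definition constant_speed_reparam g : set AC0_curve :=
  [set h | ACc_curve (val h) /\
    forall t : unit_interval R,
      g t = val h (clamp (normalized_arc_length g (val t)))].

(* The curve k g is the unique element of constant_speed_reparam g. The value
   c0 is taken by curves that are not absolutely continuous or have length 0. *)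
Definition i_map (c0 : nonparam) g : nonparam :=
  xget c0 [set c | AC_curve g /\ (0 < curve_length g)%E /\
    exists2 h, constant_speed_reparam g h & c = \pi_nonparam h].

Definition j_map (c : nonparam) : curve :=
  xget (representative c)
    [set h | ACc_curve h /\
      exists2 g : AC0_curve, val g = h & c = \pi_nonparam g].

Definition J_measure g (B : set X) : \bar R :=
  \int[leb]_(t in `[0, 1])
    (\1_B (g (clamp t)) * metric_derivative g t)%:E.

Section barycenters.
Context (m : {measure set (borel X) -> \bar R}).

Definition parametric_barycenter (rho : probability (borel curve) R)
    (h : borel X -> R) :=
  forall f : X -> R, continuous f -> (exists M, forall x, `|f x| <= M) ->
    (\int[rho]_g \int[leb]_(t in `[0%R, 1%R]) (f (g (clamp t)))%:E =
     \int[m]_x (f x * h x)%:E)%E.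

Definition barycenter (c0 : nonparam)
    (ppi : probability (borel (pnonparam c0)) R) (g : borel X -> R) :=
  forall B : set (borel X), measurable B ->
    (\int[ppi]_c J_measure (representative c) B = \int[m]_(x in B) (g x)%:E)%E.

End barycenters.

Definition finite_energy q (rho : probability (borel curve) R) :=
  concentrated rho (ACq_curve q) /\ (\int[rho]_g energy q g < +oo)%E.

End curves.

(* Main.v *)
Require Import Defs.
From HB Require Import structures.
From mathcomp Require Import all_boot all_order all_algebra generic_quotient.
From mathcomp Require Import all_classical all_reals all_analysis.
From mathcomp Require Import measurable_realfun ring lra.

(** The variation V of an absolutely continuous curve c has a Lebesgue density v,
and v is the metric derivative a.e.: V dominates the increments of the countably
many functions d(x_n, c(.)), with x_n dense, and the supremum of their derivatives
is v.

(1) Let mu be the image of |c'_t| dt drho(c) under evaluation, i.e. the integral of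
J c against rho. Hoelder's inequality on rho x dt bounds the mu-integral of phi >= 0
by E^(1/q) |h|_oo^(1/p) |phi|_p, where E is the integral of the energy. Testing with
phi = (min g n)^(q-1), where g is the density of mu, bounds |g|_q.

(3) Put g = max(|h|, 1). Replace each curve c by T c = c o s^-1, where
s(t) = A^-1 int_0^t dr / g(c_r) and A = A(c) normalizes s(1) to 1, and let rho be the
image under T of (A / Z) sigma, with Z a normalizing constant. Its parametric
barycenter is h / (Z g) <= 1 / Z. If L bounds the Lipschitz constant of c then T c has
energy at most L^q A^(q-1) int_0^1 g(c_t)^(q-1) dt, and integrating against sigma gives
the integral of g^(q-1) h, which is finite as h is in L^q. By Lusin's theorem T is
continuous on compact sets that exhaust sigma; their images form the Souslin set.

(2) Apply (3) to the image under j of the measure l pi / Z, with l the length. That i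
and j are Borel follows from the sets of curves c for which some t has
length(c|[0,t]) > a, length(c|[t,1]) > b and c(t) in U: they are open, invariant under
reparametrization, and determine the Borel sets of constant speed curves. *)

Set Implicit Arguments.
Unset Strict Implicit.
Unset Printing Implicit Defensive.

Import Order.TTheory GRing.Theory Num.Theory.
Import numFieldNormedType.Exports.

Local Open Scope classical_set_scope.
Local Open Scope ring_scope.
Local Open Scope quotient_scope.

(** The weight 1/g balances two opposite effects. Passing through x faster by the factor g(x)
    multiplies the time spent there by 1/g(x), which divides the barycenter density by g; in
    exchange the energy per unit of old time is multiplied by g^(q-1). So h/g must be bounded and
    g^(q-1) h integrable, and g = max(|h|, 1) achieves both, since g^(q-1) h <= g^q <= 1 + |h|^q and
    the measure is finite. Rescaling the total time to 1 divides occupation times by A(c), which the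
    weight A(c) on sigma undoes. Likewise J c is l times the occupation measure of the constant
    speed curve, which explains the weight l in (2). The main obstacle is measurability. The
    quotient space is known only through its topology, so maps into it and out of it are studied
    through j, with values in the complete separable space of curves. Energy and J are given by
    limits over real times, and are compared with integrals of a version of the speed that uses
    countably many times. *)

Section clamp.
Context (R : realType).
Implicit Types (s t : R) (u v : unit_interval R).

Lemma val_clamp t : 0 <= t <= 1 -> val (clamp t) = t.
Proof. by case/andP=> t0 t1 /=; rewrite (min_idPl t1); exact/max_idPr. Qed.

Lemma unit_intervalP u : 0 <= val u <= 1.
Proof. by have := valP u; rewrite inE /unit_interval/= in_itv/=. Qed.

Lemma clamp_val u : clamp (val u) = u.
Proof. by apply/val_inj; rewrite val_clamp// unit_intervalP. Qed.

Lemma clamp_le s t : s <= t -> val (clamp s) <= val (clamp t).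
Proof.
move=> st /=; rewrite /Num.max /Num.min.
by repeat case: ifPn; rewrite -?leNgt; lra.
Qed.

Lemma clamp_lipschitz s t : `|val (clamp s) - val (clamp t)| <= `|s - t|.
Proof.
wlog st : s t / s <= t => [H|].
  by have [/H//|/ltW/H] := leP s t; rewrite distrC (distrC t).
rewrite distrC (distrC s) (ger0_norm (x := t - s)) ?subr_ge0//.
rewrite ger0_norm ?subr_ge0 ?clamp_le// /clamp /=.
rewrite /Num.max /Num.min; repeat case: ifPn; rewrite -?leNgt; lra.
Qed.

Lemma clamp_continuous : continuous (@clamp R).
Proof.
apply/continuous_comp_initial => t; apply/cvgrPdist_le => /= e e0.
near=> s; apply: (le_trans (clamp_lipschitz _ _)).
by near: s; apply: cvgr_dist_le.
Unshelve. all: by end_near. Qed.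

Lemma val_continuous : continuous (val : unit_interval R -> R).
Proof. exact: initial_continuous. Qed.

End clamp.

(** * The space of curves as a complete metric space *)

HB.instance Definition _ (R : realType) (X : completeMetricType R) :=
  PseudoMetric.copy (curve X)
    (initial_topology (id : curve X -> arrow_uniform_type (unit_interval R) X)).

Section curve_metric.
Context (R : realType) (X : completeMetricType R).
Implicit Types g h : curve X.

Lemma mdist_triangle2 (x y x' y' : X) :
  `|mdist x y - mdist x' y'| <= mdist x x' + mdist y y'.
Proof.
have H := metric_triangle x x' y; have H' := metric_triangle x' y' y.
have K := metric_triangle x' x y'; have K' := metric_triangle x y y'.
rewrite (metric_sym y' y) (metric_sym x' x) in H H' K K' *.
by rewrite ler_norml; lra.
Qed.

Lemma cvg_mdist (T : Type) (F : set_system T) (FF : Filter F) (f k : T -> X)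
  x y : f @ F --> x -> k @ F --> y ->
  (mdist (f t) (k t) @[t --> F] --> mdist x y)%R.
Proof.
move=> fx ky; apply/cvgrPdist_le => /= e e0; near=> t.
apply: (le_trans (mdist_triangle2 _ _ _ _)).
rewrite (splitr e) lerD//; near: t.
- by apply: (metricType_numDomainType.cvgr_dist_le fx); rewrite divr_gt0.
- by apply: (metricType_numDomainType.cvgr_dist_le ky); rewrite divr_gt0.
Unshelve. all: by end_near. Qed.

(** Extending curves by constants lets Lebesgue integrals and real analysis on [R] be used although
    curves are parametrized by a subtype. *)
Definition cpath g (t : R) : X := g (clamp t).

Lemma cpath_continuous g : continuous (cpath g).
Proof.
move=> t; apply: continuous_comp; first exact: clamp_continuous.
exact: cts_fun.
Qed.

Definition curve_mdist g h : R :=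
  sup [set mdist (g t) (h t) | t in [set: unit_interval R]].

Lemma curve_mdist_max g h : exists t, forall s, mdist (g s) (h s) <= mdist (g t) (h t).
Proof.
have [] := @EVT_max R (fun t => mdist (cpath g t) (cpath h t)) 0 1 ler01.
  apply: continuous_subspaceT => t.
  by apply: cvg_mdist; exact: cpath_continuous.
move=> c _ cmax; exists (clamp c) => s.
have := cmax (val s); rewrite in_itv/= unit_intervalP => /(_ isT).
by rewrite /cpath clamp_val.
Qed.

(** That the supremum is a maximum is what identifies the balls in [curve_ballE]: a strict bound at
    every time stays strict for the supremum. *)
Lemma curve_mdist_attained g h : exists2 t, curve_mdist g h = mdist (g t) (h t) &
  forall s, mdist (g s) (h s) <= mdist (g t) (h t).
Proof.
have [t tmax] := curve_mdist_max g h; exists t => //.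
have ub : ubound [set mdist (g t) (h t) | t in setT] (mdist (g t) (h t)).
  by move=> _ [s _ <-].
apply/eqP; rewrite eq_le; apply/andP; split.
  by apply: ge_sup => //; exists (mdist (g t) (h t)), t.
by apply: ub_le_sup; [exists (mdist (g t) (h t))|exists t].
Qed.

Lemma curve_mdist_ge0 g h : 0 <= curve_mdist g h.
Proof. by have [t -> _] := curve_mdist_attained g h; exact: mdist_ge0. Qed.

Lemma curve_mdist_positivity g h : curve_mdist g h = 0 -> g = h.
Proof.
have [t -> tmax] := curve_mdist_attained g h => gh0.
have gh s : g s = h s.
  by apply: mdist_positivity; apply/eqP; rewrite eq_le mdist_ge0 -gh0 tmax.
by apply/continuousEP.
Qed.

Lemma curve_ballE g d : ball g d = [set h | curve_mdist g h < d].
Proof.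
apply/seteqP; split=> h.
  move=> gh /=; have [t -> _] := curve_mdist_attained g h.
  by have := gh t; rewrite ballEmdist.
move=> gh0; have [t e tmax] := curve_mdist_attained g h.
have {gh0}gh : mdist (g t) (h t) < d by rewrite -e.
suff : forall s, ball (g s) d (h s) by [].
by move=> s; rewrite ballEmdist/=; exact: le_lt_trans gh.
Qed.

HB.instance Definition _ := PseudoMetric_isMetric.Build R (curve X)
  curve_mdist_ge0 curve_mdist_positivity curve_ballE.

Lemma mdist_curve_le g h t : mdist (g t) (h t) <= mdist g h.
Proof.
by have [s e smax] := curve_mdist_attained g h; rewrite [leRHS]e.
Qed.

Lemma curve_complete (F : set_system (curve X)) :
  ProperFilter F -> cauchy F -> cvg F.
Proof.
move=> FF Fc.
pose i := (id : curve X -> arrow_uniform_type (unit_interval R) X).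
have /fun_complete/cvg_ex[f Ff] : cauchy (i @ F).
  move=> A eA; rewrite near_simpl -near2E near_map2.
  by apply: Fc; exists A.
have cf : continuous (f : unit_interval R -> X).
  apply: (@uniform_limit_continuous _ X (i @ F)).
    have H : F [set g : curve X | continuous (g : unit_interval R -> X)].
      by apply: nearW => g; exact: (@cts_fun _ _ g).
    exact: H.
  by rewrite uniform_nbhsT.
apply/cvg_ex; exists ((mkcts cf : continuousType (unit_interval R) X) : curve X).
apply/cvg_entourageP => A [B [E eE sE] sB].
have := (cvg_fct_entourageP (F := i @ F) _ f).1 Ff E eE.
move=> H; have {}H : F [set g | forall t, E (f t, i g t)] by exact: H.
by apply: filterS H => g gE; apply: sB; apply: sE => t /=; exact: gE.
Qed.

HB.instance Definition _ := Uniform_isComplete.Build (curve X) curve_complete.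

End curve_metric.

(** * Dense sequences and Borel measurability *)

Section dense_sequences.
Context (R : realType).
Implicit Type e : R.

Lemma natSinv_lt e : 0 < e -> exists k : nat, k.+1%:R^-1 < e.
Proof.
by move=> e0; have [k _ /(_ k (leqnn _))] := near_infty_natSinv_lt (PosNum e0); exists k.
Qed.

Definition dense_seq (M : metricType R) (x : nat -> M) :=
  forall y e, 0 < e -> exists n, mdist (x n) y < e.

Lemma separable_dense_seq (M : completeMetricType R) :
  separable_space M -> exists x : nat -> M, dense_seq x.
Proof.
move=> [D /countable_injP[f finj] dD].
exists (fun n => xget point [set y | D y /\ f y = n]) => y e e0.
have [z [/interior_subset yz Dz]] := dD _ (ex_intro _ y (nbhsx_ballx y e e0))
  (@open_interior _ (ball y e)).
exists (f z); case: xgetP => [w _ [Dw fwz]|/(_ z)]; last by case.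
have -> : w = z by apply: finj => //; exact/mem_set.
by move: yz; rewrite ballEmdist/= metric_sym.
Qed.

Lemma dense_seq_separable (M : metricType R) (x : nat -> M) :
  dense_seq x -> separable_space M.
Proof.
move=> xd; exists (range x); first by apply: card_le_trans (card_image_le _ _) _; exact: countableP.
move=> O [y Oy] oO; have : nbhs y O by exact: open_nbhs_nbhs.
rewrite -nbhs_ballE => -[e /= e0 yO].
have [n xny] := xd y e e0; exists (x n); split; last by exists n.
by apply: yO; rewrite ballEmdist/= metric_sym.
Qed.

(** One point is chosen in each nonempty class. Separability thus follows from countable covers of
    small mesh, without exhibiting dense points. *)
Lemma dense_seq_cover (M : completeMetricType R) (I : countType)
    (c : nat -> I -> set M) :
  (forall k i a b, c k i a -> c k i b -> mdist a b < k.+1%:R^-1) ->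
  (forall k z, exists i, c k i z) -> exists x : nat -> M, dense_seq x.
Proof.
move=> cdiam ccov.
exists (fun n => if unpickle n is Some ki then xget point (c ki.1 ki.2) else point).
move=> y e /natSinv_lt[k ke]; have [i ciy] := ccov k y.
exists (pickle (k, i)); rewrite pickleK/=.
case: xgetP => [z _ /= cz|/(_ y)//].
by apply: lt_trans ke; exact: cdiam cz ciy.
Qed.

(** The index set asks for closed balls inside U, so that the same indices also exhaust U by closed
    sets in [approx_open]. *)
Lemma open_bigcup_ball (M : metricType R) (x : nat -> M) (U : set M) :
  dense_seq x -> open U ->
  U = \bigcup_(p in [set p : nat * nat | [set y | mdist (x p.1) y <= p.2.+1%:R^-1] `<=` U])
    [set y | mdist (x p.1) y < p.2.+1%:R^-1].
Proof.
move=> xd oU; apply/seteqP; split; last first.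
  by move=> y [p pU yp]; apply: pU => /=; exact: ltW.
move=> y Uy; have : nbhs y U by exact: open_nbhs_nbhs.
rewrite -nbhs_ballE => -[e /= e0 yU].
have [k ke] := natSinv_lt (divr_gt0 e0 (ltr0n _ 2)).
have [j jy] := xd y k.+1%:R^-1 (ltac:(by rewrite invr_gt0)).
exists (j, k) => //= z xz; apply: yU; rewrite ballEmdist/=.
rewrite (le_lt_trans (metric_triangle _ (x j) _))//.
by rewrite metric_sym (splitr e) ltrD//; [exact: lt_trans ke|exact: le_lt_trans ke].
Qed.

End dense_sequences.

Lemma bigcup_measurable_countType d (T : measurableType d) (I : countType)
    (P : set I) (F : I -> set T) :
  (forall i, P i -> measurable (F i)) -> measurable (\bigcup_(i in P) F i).
Proof.
move=> mF; rewrite bigcup_mkcond; apply: countable_bigcupT_measurable => //.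
by move=> i; case: ifPn => // /set_mem; exact: mF.
Qed.

Lemma bigcap_measurable_countType d (T : measurableType d) (I : countType)
    (P : set I) (F : I -> set T) :
  (forall i, P i -> measurable (F i)) -> measurable (\bigcap_(i in P) F i).
Proof.
move=> mF; rewrite -[X in measurable X]setCK setC_bigcap; apply: measurableC.
by apply: bigcup_measurable_countType => i Pi; apply: measurableC; exact: mF.
Qed.

Section borel_measurability.
Context (R : realType).

Lemma open_borel (T : ptopologicalType) (U : set T) :
  open U -> measurable (U : set (borel T)).
Proof. by move=> oU; exact: sub_sigma_algebra. Qed.

Lemma closed_borel (T : ptopologicalType) (F : set T) :
  closed F -> measurable (F : set (borel T)).
Proof.
move=> cF; rewrite -(setCK F); apply: measurableC.
by apply: open_borel; exact: closed_openC.
Qed.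

Lemma measurable_borelP d (T : measurableType d) (T' : ptopologicalType)
    (F : T -> borel T') : (forall U : set T', open U -> measurable (F @^-1` U)) ->
  measurable_fun setT F.
Proof.
move=> FU; apply: (@measurability _ _ _ (borel T') _ _ (@open T')) => // _ [U oU <-].
by rewrite setTI; exact: FU.
Qed.

Lemma continuous_measurable_borel (T : ptopologicalType) (f : T -> R) :
  continuous f -> measurable_fun setT (f : borel T -> R).
Proof.
move=> cf.
apply: (@measurability _ _ (borel T) R setT f _
  (measurable_realfun.RGenOInfty.measurableE R)) => _ [_ [r ->] <-].
rewrite setTI; apply: open_borel.
by apply: open_comp => // x _; exact: cf.
Qed.

Lemma mdist_continuous (M : metricType R) (x : M) : continuous (mdist x).
Proof.
move=> y; apply/cvgrPdist_lt => /= e e0; near=> z.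
have /= : mdist y z < e.
  by near: z; apply: metricType_numDomainType.cvgr_dist_lt e0; exact: cvg_id.
have H1 := metric_triangle x y z; have H2 := metric_triangle x z y.
by rewrite (metric_sym z y) in H2; rewrite ltr_norml; lra.
Unshelve. all: by end_near. Qed.

Lemma closed_mdist_le (M : metricType R) (x : M) r : closed [set y | mdist x y <= r].
Proof.
apply: (@closed_comp _ _ (mdist x) [set s | s <= r]); last exact: closed_le.
by move=> y _; exact: mdist_continuous.
Qed.

Lemma open_mdist_lt (M : metricType R) (x : M) r : open [set y | mdist x y < r].
Proof.
apply: (@open_comp _ _ (mdist x) [set s | s < r]); last exact: open_lt.
by move=> y _; exact: mdist_continuous.
Qed.

Lemma measurable_mdist (M : completeMetricType R) (x : M) :
  measurable_fun setT (mdist x : borel M -> R).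
Proof. by apply: continuous_measurable_borel; exact: mdist_continuous. Qed.

Lemma measurable_metric d (T : measurableType d) (M : completeMetricType R)
    (x : nat -> M) (F : T -> borel M) : dense_seq x ->
  (forall n, measurable_fun setT (fun w => mdist (x n) (F w : M))) ->
  measurable_fun setT F.
Proof.
move=> xd mF; apply: measurable_borelP => U oU.
rewrite (open_bigcup_ball xd oU) preimage_bigcup.
apply: bigcup_measurable_countType => p _.
have := mF p.1 measurableT _ (measurable_itv `]-oo, (p.2.+1%:R^-1)[).
by rewrite setTI; congr measurable; apply/seteqP; split => w/=; rewrite in_itv.
Qed.

Lemma measurable_metric_comp d (T : measurableType d) (M : completeMetricType R)
    (F : T -> borel M) (x : M) : measurable_fun setT F ->
  measurable_fun setT (fun w => mdist x (F w : M)).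
Proof.
by move=> mF; exact: (measurableT_comp (measurable_mdist x)).
Qed.

End borel_measurability.

(** * Regularity, tightness and Lusin's theorem *)

Section regularity.
Context (R : realType) (M : completeMetricType R) (x : nat -> M).
Hypothesis xd : dense_seq x.
Variable mu : {finite_measure set (borel M) -> \bar R}.

Let approx (B : set M) := forall e : R, 0 < e -> exists2 F : set M,
  closed F /\ F `<=` B & (mu (B `\` F) < e%:E)%E.

(** The union of all the closed sets need not be closed; by continuity from above a finite part
    [G n] already loses little mass. *)
Let approx_bigcup (B : nat -> set M) : (forall n, measurable (B n : set (borel M))) ->
  (forall n, approx (B n)) -> approx (\bigcup_n B n).
Proof.
move=> mB aB e e0.
have e2 n : 0 < e / 2 / 2 ^+ n.+1 :> R by rewrite !divr_gt0// exprn_gt0.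
have /choice[F /all_and2[/all_and2[cF FB] muF]] n : exists F : set M,
    (closed F /\ F `<=` B n) /\ (mu (B n `\` F) < (e / 2 / 2 ^+ n.+1)%:E)%E.
  by have [F] := aB n _ (e2 n); exists F.
have mF n : measurable (F n : set (borel M)) by exact: closed_borel.
pose G n := \bigcup_(i < n) F i.
have mG n : measurable (G n : set (borel M)) by apply: bigcup_measurable.
have mUB : measurable (\bigcup_n B n : set (borel M)) by exact: bigcupT_measurable.
have cvgG : mu ((\bigcup_n B n) `\` G n) @[n --> \oo] -->
    mu (\bigcap_n ((\bigcup_n B n) `\` G n)).
  apply: nonincreasing_cvg_mu => //.
  - by rewrite ltey_eq fin_num_measure//; exact: measurableD.
  - by move=> n; exact: measurableD.
  - by apply: bigcapT_measurable => n; exact: measurableD.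
  - move=> m n mn; apply/subsetPset; apply: setDS.
    by move=> z [i/= im Fz]; exists i => //=; exact: leq_trans mn.
have small : (mu (\bigcap_n ((\bigcup_n B n) `\` G n)) < e%:E)%E.
  apply: (@le_lt_trans _ _ (e / 2)%:E); last by rewrite lte_fin ltr_pdivrMr// ltr_pMr// ltr1n.
  apply: (@le_trans _ _ (\sum_(n <oo) mu (B n `\` F n))%E).
    apply: measure_sigma_subadditive => //.
    - by move=> n; exact: measurableD.
    - by apply: bigcapT_measurable => n; exact: measurableD.
    - move=> z Hz; have [[n _ Bnz] _] := Hz 0%N I.
      exists n => //; split => // Fnz; have [_] := Hz n.+1 I.
      by apply; exists n => /=.
  apply: (@le_trans _ _ (\sum_(n <oo) (e / 2 / 2 ^+ n.+1)%:E)%E).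
    by apply: lee_nneseries => // n _; exact: ltW.
  under eq_eseriesr do rewrite -natrX.
  by apply: epsilon_trick0; rewrite divr_ge0// ltW.
have [n Hn] : exists n, (mu ((\bigcup_n B n) `\` G n) < e%:E)%E.
  have [n _ /(_ n (leqnn n))] := cvgG _ (open_ereal_lt' small).
  by exists n.
exists (G n) => //; split; last by move=> z [i _ /FB Bz]; exists i.
by apply: closed_bigcup => //; exact: finite_II.
Qed.

Let approx_closed (F : set M) : closed F -> approx F.
Proof. by move=> cF e e0; exists F; [split|rewrite setDv measure0 lte_fin]. Qed.

Let approx_open (U : set M) : open U -> approx U.
Proof.
move=> oU.
pose P := [set p : nat * nat | [set y | mdist (x p.1) y <= p.2.+1%:R^-1] `<=` U].
pose C n := if unpickle n is Some p then
  if p \in P then [set y | mdist (x p.1) y <= (p.2 : nat).+1%:R^-1] else set0 else set0.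
have cC n : closed (C n).
  rewrite /C; case: (unpickle n) => [p|]; last exact: closed0.
  case: ifPn => _; last exact: closed0.
  exact: closed_mdist_le.
have -> : U = \bigcup_n C n.
  apply/seteqP; split.
    rewrite {1}(open_bigcup_ball xd oU) => y [p Pp yp]; exists (pickle p) => //.
    by rewrite /C pickleK mem_set//=; exact: ltW.
  move=> y [n _]; rewrite /C; case: (unpickle n) => // p.
  by case: ifPn => // /set_mem Pp /Pp.
by apply: approx_bigcup => n; [exact: closed_borel|exact: approx_closed].
Qed.

Let approx_bigcapC (B : nat -> set M) :
  (forall n, measurable (B n : set (borel M))) ->
  (forall n, approx (~` B n)) -> approx (~` \bigcup_n B n).
Proof.
move=> mB aB e e0; rewrite setC_bigcup.
have e2 n : 0 < e / 2 / 2 ^+ n.+1 :> R by rewrite !divr_gt0// exprn_gt0.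
have /choice[F /all_and2[/all_and2[cF FB] muF]] n : exists F : set M,
    (closed F /\ F `<=` ~` B n) /\ (mu (~` B n `\` F) < (e / 2 / 2 ^+ n.+1)%:E)%E.
  by have [F] := aB n _ (e2 n); exists F.
have mF n : measurable (F n : set (borel M)) by exact: closed_borel.
have mCB n : measurable (~` B n : set (borel M)) by exact: measurableC.
exists (\bigcap_n F n).
  split; first exact: closed_bigI.
  by apply: subset_bigcap => n _; exact: FB.
apply: (@le_lt_trans _ _ (e / 2)%:E); last first.
  by rewrite lte_fin ltr_pdivrMr// ltr_pMr// ltr1n.
apply: (@le_trans _ _ (\sum_(n <oo) mu (~` B n `\` F n))%E).
  apply: measure_sigma_subadditive => //.
  - by move=> n; exact: measurableD.
  - by apply: measurableD; exact: bigcapT_measurable.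
  - move=> z [Hz /existsNP[n /not_implyP[_ Fnz]]].
    by exists n => //; split => //; exact: Hz.
apply: (@le_trans _ _ (\sum_(n <oo) (e / 2 / 2 ^+ n.+1)%:E)%E).
  by apply: lee_nneseries => // n _; exact: ltW.
under eq_eseriesr do rewrite -natrX.
by apply: epsilon_trick0; rewrite divr_ge0// ltW.
Qed.

(** The Borel sets B such that both B and its complement are approximated from inside by closed sets
    form a sigma-algebra, and it contains the open sets. *)
Lemma closed_regular (B : set (borel M)) (e : R) : measurable B -> 0 < e ->
  exists2 F : set M, closed F /\ F `<=` B & (mu (B `\` F) < e%:E)%E.
Proof.
move=> mB; move: e; change (approx B).
suff : <<s @open M >> `<=`
    [set B | [/\ measurable (B : set (borel M)), approx B & approx (~` B)]].
  by move=> /(_ B mB)[].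
apply: smallest_sub.
  split.
  - split; [exact: measurable0|exact: approx_open open0|].
    by rewrite setC0; apply: approx_open; exact: openT.
  - by move=> A [mA aA aCA]; rewrite setTD; split => //; [exact: measurableC|rewrite setCK].
  - move=> A AP; split.
    + by apply: bigcupT_measurable => n; have [] := AP n.
    + by apply: approx_bigcup => n; have [] := AP n.
    + by apply: approx_bigcapC => n; have [] := AP n.
move=> U oU; split; [exact: open_borel|exact: approx_open|].
by apply: approx_closed; exact: open_closedC.
Qed.

(** This turns total boundedness into the Cauchy property of ultrafilters in [compact_tight]. *)
Let ultra_bigcup (F : set_system M) (A : nat -> set M) n : UltraFilter F ->
  F (\bigcup_(i < n) A i) -> exists i, F (A i).
Proof.
move=> UF; elim: n => [|n IH] FA.
  have F0 : F set0 by apply: filterS FA => z [i].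
  by exfalso; exact: (@filter_not_empty _ F _ F0).
have [FAn|FAn] := in_ultra_setVsetC (A n) UF; first by exists n.
apply: IH; have : F (~` A n `&` \bigcup_(i < n.+1) A i) by exact: filterI.
apply: filterS => z [Anz [i /= ni Aiz]]; exists i => //=.
by move: ni; rewrite ltnS leq_eqVlt => /predU1P[ni|//]; rewrite ni in Aiz.
Qed.

(** Ulam's argument: at each scale finitely many closed balls carry all but a geometrically small
    share of the mass. The intersection over all scales is closed and totally bounded, hence compact
    by completeness. *)
Lemma compact_tight (e : R) : 0 < e ->
  exists2 K : set M, closed K /\ compact K & (mu (~` K) < e%:E)%E.
Proof.
move=> e0.
pose B m i := [set y | mdist (x i) y <= (m : nat).+1%:R^-1].
have cB m i : closed (B m i) by exact: closed_mdist_le.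
pose H m n := \bigcup_(i < n) B m i.
have cH m n : closed (H m n) by apply: closed_bigcup => //; exact: finite_II.
have mCH m n : measurable (~` H m n : set (borel M)).
  by apply: measurableC; exact: closed_borel.
have HT m : \bigcap_n (~` H m n) = set0.
  have m0 : 0 < m.+1%:R^-1 :> R by rewrite invr_gt0.
  rewrite -subset0 => y Hy; have [i xiy] := xd y m0.
  by apply: (Hy i.+1) => //; exists i => //=; exact: ltW.
have e2 m : 0 < e / 2 / 2 ^+ m.+1 :> R by rewrite !divr_gt0// exprn_gt0.
have /choice[N HN] m : exists n, (mu (~` H m n) < (e / 2 / 2 ^+ m.+1)%:E)%E.
  have cvgH : mu (~` H m n) @[n --> \oo] --> mu (\bigcap_n (~` H m n)).
    apply: nonincreasing_cvg_mu => //.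
    - by rewrite ltey_eq fin_num_measure.
    - exact: bigcapT_measurable.
    - move=> a b ab; apply/subsetPset; apply: subsetC.
      by move=> z [i/= im Bz]; exists i => //=; exact: leq_trans ab.
  rewrite HT measure0 in cvgH.
  have e2m : (0 < (e / 2 / 2 ^+ m.+1)%:E)%E by rewrite lte_fin.
  have [n _ /(_ n (leqnn n)) Hn] := cvgH _ (open_ereal_lt' e2m).
  by exists n.
exists (\bigcap_m H m (N m)).
  split; first exact: closed_bigI.
  rewrite compact_ultra => F UF FK.
  have /cvg_ex[p Fp] : cvg F.
    apply: cauchy_cvg; apply: cauchy_exP => d d0.
    have [m md] := natSinv_lt d0.
    have [i FB] : exists i, F (B m i).
      apply: (@ultra_bigcup _ _ (N m)); apply: filterS FK => z /(_ m); exact.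
    exists (x i); apply: filterS FB => z; rewrite /B ballEmdist/= => H1.
    exact: le_lt_trans md.
  exists p; split => //.
  by apply: (@closed_cvg _ _ F _ id) => //; exact: closed_bigI.
apply: (@le_lt_trans _ _ (e / 2)%:E); last first.
  by rewrite lte_fin ltr_pdivrMr// ltr_pMr// ltr1n.
rewrite setC_bigcap.
apply: (@le_trans _ _ (\sum_(n <oo) mu (~` H n (N n)))%E).
  apply: measure_sigma_subadditive => //.
  exact: bigcupT_measurable.
apply: (@le_trans _ _ (\sum_(n <oo) (e / 2 / 2 ^+ n.+1)%:E)%E).
  by apply: lee_nneseries => // n _; exact: ltW.
under eq_eseriesr do rewrite -natrX.
by apply: epsilon_trick0; rewrite divr_ge0// ltW.
Qed.

(** For each basic ball [U n], the preimage and its complement contain closed sets [C n] and [D n]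
    of almost full mass. On G, the intersection of all [C n] union [D n], a point outside [D n] lies
    in [C n], so the preimage of [U n] is relatively open. *)
Lemma compact_lusin (N : metricType R) (y : nat -> N) (f : M -> N)
    (B : set (borel M)) (e : R) : dense_seq y ->
  (forall U, open U -> measurable (f @^-1` U : set (borel M))) ->
  measurable B -> 0 < e -> exists2 K : set M,
    [/\ closed K, compact K, K `<=` B & {within K, continuous f}] &
    (mu (B `\` K) < e%:E)%E.
Proof.
move=> yd mf mB e0.
(* The loss e is shared as e / 4 for K1, e / 4 for K2, and e / 2 for G, where [C n] and [D n] cost e
   / 4 each in total. *)
have e4 : 0 < e / 4 by rewrite divr_gt0.
have e4n n : 0 < e / 4 / 2 ^+ n.+1 :> R by rewrite !divr_gt0// exprn_gt0.
have [K1 [cK1 KB] K1e] := closed_regular mB e4.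
have [K2 [cK2 kK2] K2e] := compact_tight e4.
pose U n := if unpickle n is Some p then
  [set z : N | mdist (y p.1) z < (p.2 : nat).+1%:R^-1] else set0.
have oU n : open (U n).
  rewrite /U; case: (unpickle n) => [p|]; last exact: open0.
  exact: open_mdist_lt.
have mfU n := mf _ (oU n).
have /choice[C /all_and2[/all_and2[cC CU] muC]] n : exists F : set M,
    (closed F /\ F `<=` f @^-1` U n) /\
    (mu (f @^-1` U n `\` F) < (e / 4 / 2 ^+ n.+1)%:E)%E.
  by have [F] := closed_regular (mfU n) (e4n n); exists F.
have /choice[D /all_and2[/all_and2[cD DU] muD]] n : exists F : set M,
    (closed F /\ F `<=` ~` (f @^-1` U n)) /\
    (mu (~` (f @^-1` U n) `\` F) < (e / 4 / 2 ^+ n.+1)%:E)%E.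
  by have [F] := closed_regular (measurableC (mfU n)) (e4n n); exists F.
pose G := \bigcap_n (C n `|` D n).
have cG : closed G by apply: closed_bigI => n _; exact: closedU.
have cK : closed (K1 `&` (K2 `&` G)).
  by apply: closedI => //; exact: closedI.
pose S n := (f @^-1` U n `\` C n) `|` (~` (f @^-1` U n) `\` D n).
have mC n : measurable (C n : set (borel M)) by exact: closed_borel.
have mD n : measurable (D n : set (borel M)) by exact: closed_borel.
have mfUC n := measurableC (mfU n).
have mS n : measurable (S n : set (borel M)) by apply: measurableU; exact: measurableD.
have muS n : (mu (S n) <= (e / 2 / (2 ^ n.+1)%:R)%:E)%E.
  apply: (@le_trans _ _ (mu (f @^-1` U n `\` C n) + mu (~` (f @^-1` U n) `\` D n))%E).
    by apply: measureU2; exact: measurableD.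
  apply: (@le_trans _ _ ((e / 4 / 2 ^+ n.+1)%:E + (e / 4 / 2 ^+ n.+1)%:E)%E).
    by apply: leeD; exact: ltW.
  by rewrite -EFinD lee_fin natrX -mulrDl ler_wpM2r// ?invr_ge0 ?exprn_ge0//; lra.
have mG : measurable (G : set (borel M)) by exact: closed_borel.
have muG : (mu (~` G) <= (e / 2)%:E)%E.
  apply: (@le_trans _ _ (\sum_(n <oo) mu (S n))%E).
    apply: measure_sigma_subadditive => //; first exact: measurableC.
    rewrite setC_bigcap => z [n _ /not_orP[Cz Dz]]; exists n => //.
    by have [Uz|Uz] := pselect ((f @^-1` U n) z); [left|right].
  apply: (@le_trans _ _ (\sum_(n <oo) (e / 2 / (2 ^ n.+1)%:R)%:E)%E).
    by apply: lee_nneseries => // n _.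
  by apply: epsilon_trick0; rewrite divr_ge0// ltW.
exists (K1 `&` (K2 `&` G)).
  split => //.
  - by apply: subclosed_compact cK kK2 _ => z [_ []].
  - by move=> z [/KB].
  - apply/subspace_continuousP => z [_ [_ Gz]] V /=.
    rewrite nbhsE => -[W [oW Wfz] WV].
    move: Wfz; rewrite (open_bigcup_ball yd oW) => -[p Pp fzp].
    have Uz : U (pickle p) (f z) by rewrite /U pickleK.
    have Dz : ~ D (pickle p) z by move=> /DU.
    have oD : open (~` D (pickle p)) by exact: closed_openC.
    have : nbhs z (~` D (pickle p)) by exact: open_nbhs_nbhs.
    apply: filterS => w Dw [_ [_ Gw]]; apply: WV.
    have [//|/CU|//] := Gw (pickle p).
    rewrite /U /= pickleK/= => yw; apply: Pp => /=; exact: ltW.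
have mK1 : measurable (K1 : set (borel M)) by exact: closed_borel.
have mK2 : measurable (K2 : set (borel M)) by exact: closed_borel.
apply: (@le_lt_trans _ _ (mu ((B `\` K1) `|` (~` K2 `|` ~` G)))).
  apply: le_measure; rewrite ?inE//.
  - by apply: measurableD => //; do 2 apply: measurableI => //.
  - by apply: measurableU; [exact: measurableD|apply: measurableU; exact: measurableC].
  - move=> z [Bz] H; have [K1z|K1z] := pselect (K1 z); [right|by left].
    by have [K2z|K2z] := pselect (K2 z); [right => Gz; exact: H|left].
apply: (@le_lt_trans _ _ (mu (B `\` K1) + (mu (~` K2) + mu (~` G)))%E).
  apply: (le_trans (measureU2 _ _ _)).
  - exact: measurableD.
  - by apply: measurableU; exact: measurableC.
  - by apply: leeD => //; apply: measureU2; exact: measurableC.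
have -> : e%:E = ((e / 4)%:E + ((e / 4)%:E + (e / 2)%:E))%E.
  by rewrite -!EFinD; congr EFin; lra.
apply: lteD => //; apply: (@lt_le_trans _ _ ((e / 4)%:E + mu (~` G))%E).
  rewrite lteD2rE//; rewrite fin_num_measure//; exact: measurableC.
exact: leeD.
Qed.

Lemma compact_lusin_exhaustion (N : metricType R) (y : nat -> N) (f : M -> N)
    (B : set (borel M)) : dense_seq y ->
  (forall U, open U -> measurable (f @^-1` U : set (borel M))) ->
  measurable B -> exists K : nat -> set M,
    [/\ forall n, closed (K n), forall n, compact (K n), forall n, K n `<=` B,
      forall n, {within K n, continuous f} & mu (B `\` \bigcup_n K n) = 0%E].
Proof.
move=> yd mf mB.
have /choice[K HK] n : exists K : set M,
    [/\ closed K, compact K, K `<=` B & {within K, continuous f}] /\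
    (mu (B `\` K) < n.+1%:R^-1%:E)%E.
  have n0 : 0 < n.+1%:R^-1 :> R by rewrite invr_gt0.
  by have [K] := compact_lusin yd mf mB n0; exists K.
exists K; split; try by move=> n; have [[]] := HK n.
have mK n : measurable (K n : set (borel M)).
  by apply: closed_borel; have [[]] := HK n.
apply/eqP; rewrite eq_le measure_ge0 andbT; apply/lee_addgt0Pr => e e0.
rewrite add0e; have [k ke] := natSinv_lt e0.
apply: (@le_trans _ _ (mu (B `\` K k))); last first.
  by apply/ltW/(lt_trans (HK k).2); rewrite lte_fin.
apply: le_measure; rewrite ?inE.
- by apply: measurableD => //; exact: bigcupT_measurable.
- exact: measurableD.
- by apply: setDS; exact: bigcup_sup.
Qed.

End regularity.

(** If the K n are closed this space is complete, so that a countable union of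
    continuous images of closed sets is a Souslin set. *)
Record disjoint_sum (T : Type) (K : nat -> set T) := DisjointSum {
  ds_index : nat; ds_point : T; ds_in : K ds_index ds_point }.

HB.instance Definition _ (T : Type) (K : nat -> set T) :=
  gen_eqMixin (disjoint_sum K).
HB.instance Definition _ (T : Type) (K : nat -> set T) :=
  gen_choiceMixin (disjoint_sum K).

(** * Countable unions of closed sets as Souslin sets *)

Section disjoint_sum_metric.
Context (R : realType) (M : completeMetricType R) (K : nat -> set M).
Implicit Types p : disjoint_sum K.

Definition ds_mdist p p' : R := mdist (ds_point p) (ds_point p') +
  `|(ds_index p)%:R - (ds_index p')%:R|.

Lemma ds_mdistxx p : ds_mdist p p = 0.
Proof. by rewrite /ds_mdist mdistxx subrr normr0 addr0. Qed.

Lemma ds_mdist_positivity p p' : ds_mdist p p' = 0 -> p = p'.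
Proof.
case: p p' => [n x Kx] [n' x' Kx'] /eqP; rewrite /ds_mdist/=.
rewrite paddr_eq0 ?mdist_ge0// => /andP[/eqP/mdist_positivity xx'].
rewrite normr_eq0 subr_eq0 eqr_nat => /eqP nn'; subst n' x'.
by congr DisjointSum; exact: Prop_irrelevance.
Qed.

Lemma ds_mdist_sym p p' : ds_mdist p p' = ds_mdist p' p.
Proof. by rewrite /ds_mdist metric_sym distrC. Qed.

Lemma ds_mdist_triangle p' p p'' : ds_mdist p p'' <= ds_mdist p p' + ds_mdist p' p''.
Proof.
rewrite /ds_mdist addrACA lerD//; first exact: metric_triangle.
exact: ler_distD.
Qed.

HB.instance Definition _ := isMetric.Build R (disjoint_sum K)
  ds_mdistxx ds_mdist_positivity ds_mdist_sym ds_mdist_triangle.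

Lemma ds_index_eq p p' : mdist p p' < 1 -> ds_index p = ds_index p'.
Proof.
move=> pp'; have : `|(ds_index p)%:R - (ds_index p')%:R| < 1 :> R.
  by apply: le_lt_trans pp'; rewrite lerDr mdist_ge0.
have [nn'|nn'|//] := ltngtP (ds_index p) (ds_index p').
- rewrite distrC -natrB ?(ltnW nn')// ger0_norm ?ler0n// ltrn1.
  by rewrite ltnS leqn0 subn_eq0 leqNgt nn'.
- rewrite -natrB ?(ltnW nn')// ger0_norm ?ler0n// ltrn1.
  by rewrite ltnS leqn0 subn_eq0 leqNgt nn'.
Qed.

Lemma ds_mdist_point p p' : mdist (ds_point p) (ds_point p') <= mdist p p'.
Proof. by rewrite [leRHS]/mdist/= lerDl. Qed.

Lemma ds_point_continuous : continuous (@ds_point _ K : disjoint_sum K -> M).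
Proof.
move=> p; have FF := nbhs_filter p.
apply/(@metricType_numDomainType.cvgrPdist_lt _ M _ (nbhs p) FF) => e e0.
have := nbhsx_ballx p e e0; apply: filterS => q; rewrite ballEmdist/=.
by apply: le_lt_trans; exact: ds_mdist_point.
Qed.

(** Distinct pieces are at distance at least 1, so a Cauchy filter eventually lives in one piece,
    and its limit stays there because the piece is closed. *)
Lemma ds_complete (cK : forall n, closed (K n)) (F : set_system (disjoint_sum K)) :
  ProperFilter F -> cauchy F -> exists p, F --> p.
Proof.
move=> FF /cauchy_ballP Fc.
have ex e : 0 < e -> exists p0, F (ball p0 e).
  move=> /Fc[[A B] /= [FA FB] AB]; have [p Ap] := filter_ex FA.
  by exists p; apply: filterS FB => z Bz; exact: (AB (p, z)).
have [p0 Fp0] := ex 1 ltr01.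
pose n := ds_index p0.
have Fn : F [set p | ds_index p = n].
  by apply: filterS Fp0 => p; rewrite ballEmdist => /ds_index_eq.
have /cauchy_cvg/cvg_ex[y Fy] : cauchy (@ds_point _ K @ F).
  apply: cauchy_exP => e e0; have [p Fp] := ex e e0.
  exists (ds_point p).
  suff : F (@ds_point _ K @^-1` ball (ds_point p) e) by [].
  apply: filterS Fp => z; rewrite /preimage/= !ballEmdist/=.
  by apply: le_lt_trans; exact: ds_mdist_point.
have Ky : K n y.
  apply: (@closed_cvg _ _ F _ (@ds_point _ K) (K n) (cK n)) => //.
  by apply: filterS Fn => p <-; exact: ds_in.
exists (DisjointSum Ky).
apply/metricType_numDomainType.fcvgrPdist_lt => e e0.
near=> p; have pn : ds_index p = n by near: p.
rewrite /mdist/= /ds_mdist pn/= subrr normr0 addr0.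
by near: p; exact: (metricType_numDomainType.cvgr_dist_lt Fy e0).
Unshelve. all: by end_near. Qed.

(** The closedness proofs and a point are parameters of the type, so that its completeness and
    pointedness instances can use them. *)
Definition pdisjoint_sum (cK : forall n, closed (K n)) (p : disjoint_sum K) : Type :=
  disjoint_sum K.

HB.instance Definition _ cK p := Metric.copy (@pdisjoint_sum cK p) (disjoint_sum K).
HB.instance Definition _ cK p := isPointed.Build (@pdisjoint_sum cK p) p.

Lemma pdisjoint_sum_complete cK p (F : set_system (@pdisjoint_sum cK p)) :
  ProperFilter F -> cauchy F -> cvg F.
Proof. by move=> FF Fc; apply/cvg_ex; exact: (ds_complete cK FF Fc). Qed.

HB.instance Definition _ cK p :=
  Uniform_isComplete.Build (@pdisjoint_sum cK p) (@pdisjoint_sum_complete cK p).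

Lemma closed_bigcup_souslin (x : nat -> M) : dense_seq x ->
  (forall n, closed (K n)) -> souslin R (\bigcup_n K n).
Proof.
move=> xd cK; have [K0|/set0P[y [n _ Kny]]] := eqVneq (\bigcup_n K n) set0.
  by left.
right; pose P : completeMetricType R := pdisjoint_sum cK (DisjointSum Kny).
exists P, (@ds_point _ K : P -> M); split.
- pose c k (i : nat * nat) : set P :=
    [set p | ds_index p = i.1 /\ mdist (x i.2) (ds_point p) < k.+1%:R^-1 / 2].
  have [||z zd] := @dense_seq_cover R P _ c; last exact: dense_seq_separable zd.
  + move=> k i a b [ai xa] [bi xb].
    rewrite [mdist a b]/mdist/= /ds_mdist ai bi subrr normr0 addr0.
    rewrite (le_lt_trans (metric_triangle _ (x i.2) _))//.
    by rewrite (splitr k.+1%:R^-1) ltrD// metric_sym.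
  + move=> k z; have k0 : 0 < k.+1%:R^-1 / 2 :> R by rewrite divr_gt0// invr_gt0.
    by have [j xj] := xd (ds_point z) _ k0; exists (ds_index z, j).
- exact: ds_point_continuous.
- apply/seteqP; split => [_ [p _ <-]|z [k _ Kz]]; first by exists (ds_index p) => //; exact: ds_in.
  by exists (DisjointSum Kz).
Qed.

End disjoint_sum_metric.

(** The compact sets of Lusin's theorem have compact, hence closed, images. Their union is Souslin
    and Borel, lies in the image of B, and its preimage misses only a null part of B. *)
Lemma souslin_borel_image (R : realType) (M N : completeMetricType R)
    (x : nat -> M) (y : nat -> N) (mu : {finite_measure set (borel M) -> \bar R})
    (f : borel M -> borel N) (B : set (borel M)) :
  dense_seq x -> dense_seq y -> measurable_fun setT f -> measurable B ->
  exists S : set N, [/\ souslin R S, measurable (S : set (borel N)), S `<=` f @` B &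
    mu (B `\` f @^-1` S) = 0%E].
Proof.
move=> xd yd mf mB.
have mfU U : open U -> measurable (f @^-1` U : set (borel M)).
  by move=> oU; rewrite -(setTI (_ @^-1` _)); apply: mf => //; exact: open_borel.
have [K [cK kK KB ctK muK]] := compact_lusin_exhaustion xd mu yd mfU mB.
have cfK n : closed (f @` K n).
  by apply: compact_closed; [exact: metric_hausdorff|exact: continuous_compact].
have mS : measurable (\bigcup_n (f @` K n) : set (borel N)).
  by apply: bigcupT_measurable => n; exact: closed_borel.
exists (\bigcup_n (f @` K n)); split => //.
- exact: closed_bigcup_souslin yd cfK.
- by move=> _ [n _ [z Kz <-]]; exists z => //; exact: KB Kz.
- apply/eqP; rewrite eq_le measure_ge0 andbT -muK; apply: le_measure; rewrite ?inE.
  + by apply: measurableD => //; rewrite -(setTI (_ @^-1` _)); exact: mf.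
  + by apply: measurableD => //; apply: bigcupT_measurable => n; exact: closed_borel.
  + by apply: setDS => z [n _ Kz]; exists n => //; exists z.
Qed.

(** * Separability of the curve space and measurability of evaluations *)

Section separable_curves.
Context (R : realType) (X : completeMetricType R).
Implicit Types g h : curve X.

Lemma cpath_uniform g (e : R) : 0 < e -> exists2 d : R, 0 < d &
  forall s t : R, `|s - t| <= d -> mdist (cpath g s) (cpath g t) < e.
Proof.
move=> e0.
(* P n s says that 1/(n+1) is a modulus of continuity for e at s; near-covering compactness makes
   one n serve all s in [0, 1]. *)
pose P (n : nat) (s : R) := forall t, `|s - t| <= n.+1%:R^-1 ->
  mdist (cpath g s) (cpath g t) < e.
have /compact_near_coveringP/(_ nat \oo P _) := @segment_compact R 0 1.
case=> [x _|n _ Hn].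
  have e2 : 0 < e / 2 by rewrite divr_gt0.
  have := @metricType_numDomainType.cvgr_dist_lt R X R (nbhs x) (nbhs_filter x)
    (cpath g) _ (@cpath_continuous _ _ g x) _ e2.
  move=> /nbhs_ballP[d /= d0 xd].
  have d2 : 0 < d / 2 by rewrite divr_gt0.
  near=> x' n => t x't.
  have xx' : `|x - x'| < d / 2 by near: x'; exact: nbhsx_ballx.
  have nd : n.+1%:R^-1 < d / 2 by near: n; exact: (near_infty_natSinv_lt (PosNum d2)).
  rewrite (le_lt_trans (metric_triangle _ (cpath g x) _))//.
  rewrite (splitr e) ltrD//.
    rewrite metric_sym; apply: xd; rewrite /ball/=; apply: (lt_trans xx').
    by rewrite ltr_pdivrMr// ltr_pMr// ltr1n.
  apply: xd; rewrite /ball/= -(subrKA x') (le_lt_trans (ler_normD _ _))//.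
  by rewrite (splitr d) ltrD//; exact: le_lt_trans nd.
exists n.+1%:R^-1; first by rewrite invr_gt0.
move=> s t st; have := Hn n (leqnn n) (val (clamp s)) _ (val (clamp t)).
rewrite /cpath !clamp_val; apply.
  exact: (set_mem (valP (clamp s))).
exact: le_trans (clamp_lipschitz _ _) st.
Unshelve. all: by end_near. Qed.

(** The classes at scale k consist of the curves uniformly close to a step function with equal steps
    and values among the [x n]. There are countably many of them, and uniform continuity puts every
    curve in one. *)
Lemma curve_dense_seq (x : nat -> X) : dense_seq x ->
  exists g : nat -> curve X, dense_seq g.
Proof.
move=> xd.
pose c k (i : nat * seq nat) : set (curve X) := [set g | forall t : unit_interval R,
  mdist (g t) (x (nth 0%N i.2 (Num.truncn (i.1%:R * val t)))) < k.+1%:R^-1 / 2].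
apply: (@dense_seq_cover R (curve X) _ c).
  move=> k i g h cg ch; have [t e _] := curve_mdist_attained g h.
  rewrite [mdist g h]e.
  pose z := x (nth 0%N i.2 (Num.truncn (i.1%:R * val t))).
  rewrite (le_lt_trans (metric_triangle _ z _))//.
  by rewrite (splitr k.+1%:R^-1) ltrD// metric_sym.
move=> k g; have e0 : 0 < k.+1%:R^-1 / 2 / 2 :> R by rewrite !divr_gt0// invr_gt0.
have [d d0 gd] := cpath_uniform g e0; have [N Nd] := natSinv_lt d0.
have /choice[j jP] (i : nat) : exists j, mdist (x j) (cpath g (i%:R / N.+1%:R)) <
  k.+1%:R^-1 / 2 / 2 by exact: xd.
(* There are N.+1 steps but N.+2 values, because t = 1 has the index N.+1. *)
exists (N.+1, mkseq j N.+2) => t /=; have /andP[t0 t1] := unit_intervalP t.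
have Nt0 : 0 <= N.+1%:R * val t by rewrite mulr_ge0.
have /andP[] := truncn_itv Nt0.
set i := Num.truncn _ => i1 i2.
have iN : (i < N.+2)%N.
  rewrite ltnS -(ler_nat R) (le_trans i1)//.
  by rewrite ler_piMr.
rewrite nth_mkseq//.
rewrite (le_lt_trans (metric_triangle _ (cpath g (i%:R / N.+1%:R)) _))//.
rewrite (splitr (k.+1%:R^-1 / 2)) ltrD//; last by rewrite metric_sym.
rewrite -[in g t](clamp_val t); apply: gd.
apply: le_trans (ltW Nd).
have N0 : 0 < N.+1%:R :> R by [].
rewrite -(ler_pM2l N0) divff ?gt_eqF// -{1}(gtr0_norm N0) -normrM mulrBr.
rewrite mulrCA divff ?gt_eqF// mulr1.
by rewrite -natr1 in i2; rewrite ger0_norm ?subr_ge0//; lra.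
Qed.

Lemma curve_mdist_gtP g h (r : R) : r < mdist g h -> exists q : rat,
  0 < (ratr q : R) < 1 /\ r < mdist (cpath g (ratr q)) (cpath h (ratr q)).
Proof.
have [t e _] := curve_mdist_attained g h; rewrite [mdist g h]e => rt.
have /andP[t0 t1] := unit_intervalP t.
have c : mdist (cpath g s) (cpath h s) @[s --> val t] -->
    mdist (cpath g (val t)) (cpath h (val t)).
  by apply: cvg_mdist; exact: cpath_continuous.
have rt' : r < mdist (cpath g (val t)) (cpath h (val t)) by rewrite /cpath clamp_val.
have /nbhs_ballP[d /= d0 td] : \forall s \near val t,
    r < mdist (cpath g s) (cpath h s) by exact: (cvgr_gt _ c).
have [q] : exists q : rat, ratr q \in `](Num.max 0 (val t - d)), (Num.min 1 (val t + d))[.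
  apply: rat_in_itvoo; rewrite lt_min !gt_max ltr01/= !ltrD2l.
  by rewrite (lt_le_trans d0 _) ?lerDr// (lt_trans _ d0) ?oppr_lt0//= ltrBlDr (le_lt_trans t1)// ltrDl.
rewrite in_itv/= lt_min gt_max => /andP[/andP[q0 tq] /andP[q1 qt]].
exists q; split; first by rewrite q0.
by apply: td; rewrite /ball/= ltr_norml; lra.
Qed.

(** The uniform distance to a fixed curve is a supremum over rational times, and by continuity
    rational times strictly between 0 and 1 suffice. *)
Lemma measurable_curve d (T : measurableType d) (F : T -> borel (curve X)) :
  separable_space X ->
  (forall (t : R) x, 0 < t < 1 ->
    measurable_fun setT (fun w => mdist x (cpath (F w : curve X) t))) ->
  measurable_fun setT F.
Proof.
move=> /separable_dense_seq[x /curve_dense_seq[g gd]] mF.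
apply: (measurable_metric gd) => n.
apply: (@measurability _ _ T R setT _ _
  (measurable_realfun.RGenOInfty.measurableE R)) => _ [_ [r ->] <-].
rewrite setTI (_ : _ @^-1` _ = \bigcup_(q in [set q : rat | 0 < (ratr q : R) < 1])
    [set w | r < mdist (cpath (g n) (ratr q)) (cpath (F w : curve X) (ratr q))]).
  apply: bigcup_measurable_countType => q q01.
  have := mF _ (cpath (g n) (ratr q)) q01 measurableT _ (measurable_itv `]r, +oo[).
  by rewrite setTI; congr measurable; apply/seteqP; split => w/=; rewrite in_itv/= andbT.
apply/seteqP; split => w /=; rewrite in_itv/= andbT.
  by move=> /curve_mdist_gtP[q [q01 rq]]; exists q.
by move=> [q q01 /lt_le_trans]; apply; exact: mdist_curve_le.
Qed.

Lemma mdist_cpath_le g h t : mdist (cpath g t) (cpath h t) <= mdist g h.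
Proof. exact: mdist_curve_le. Qed.

(** To reach the product sigma-algebra, the preimage of a ball is written as a countable union of
    boxes: balls around the dense curves times intervals around rationals, kept when the whole box
    is mapped into the ball. *)
Lemma measurable_eval : separable_space X ->
  measurable_fun setT (fun p : borel (curve X) * R => cpath (p.1 : curve X) p.2 : borel X).
Proof.
move=> /separable_dense_seq[x /[dup] xd /curve_dense_seq[g gd]].
apply: (measurable_metric xd) => n.
apply: (@measurability _ _ (borel (curve X) * R)%type R setT _ _
  (measurable_realfun.RGenInftyO.measurableE R)) => _ [_ [r ->] <-].
rewrite setTI.
pose ok (i : nat * nat * rat) := forall (h : curve X) (s : R),
  mdist (g i.1.1) h < i.1.2.+1%:R^-1 -> `|s - ratr i.2| < i.1.2.+1%:R^-1 ->
  mdist (x n) (cpath h s) < r.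
rewrite (_ : _ @^-1` _ = \bigcup_(i in ok)
   ([set h : borel (curve X) | mdist (g i.1.1) (h : curve X) < i.1.2.+1%:R^-1] `*`
    [set s : R | `|s - ratr i.2| < i.1.2.+1%:R^-1])).
  apply: bigcup_measurable_countType => i _; apply: measurableX.
    exact: (@open_borel (curve X) _ (open_mdist_lt (g i.1.1) _)).
  rewrite (_ : mkset _ = `](ratr i.2 - i.1.2.+1%:R^-1), (ratr i.2 + i.1.2.+1%:R^-1)[%classic).
    exact: measurable_itv.
  by apply/seteqP; split => s /=; rewrite in_itv/= ltr_distl.
apply/seteqP; split => -[h s] /=; rewrite in_itv/=; last first.
  by move=> [i oki [hi si]]; exact: oki.
(* Half of the margin pays for moving the time, the other half for moving the curve. *)
move=> hsr; pose e := (r - mdist (x n) (cpath h s)) / 2.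
have e0 : 0 < e by rewrite divr_gt0// subr_gt0.
have [d d0 hd] := cpath_uniform h e0.
have m0 : 0 < Num.min (d / 2) (e / 2).
  by rewrite lt_min; apply/andP; split; apply: divr_gt0.
have [k] := natSinv_lt m0; rewrite lt_min => /andP[kd ke].
have k0 : 0 < k.+1%:R^-1 :> R by rewrite invr_gt0.
have [j jh] := gd h _ k0.
have [q] : exists q : rat, ratr q \in `](s - k.+1%:R^-1), (s + k.+1%:R^-1)[.
  by apply: rat_in_itvoo; rewrite ltrD2l gtrN.
rewrite in_itv/= => /andP[q1 q2].
exists (j, k, q); last first.
  by split => //=; rewrite ltr_distl ltrBlDr q2/= -ltrBlDr.
move=> h' s' /= jh' s'q.
have ss' : `|s - s'| <= d.
  move: s'q q1 q2 kd; rewrite ltr_distl ler_norml /=.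
  move: (ratr q : R) (k.+1%:R^-1 : R) => z c /andP[? ?] ? ? ?.
  by apply/andP; split; lra.
have H1 := hd _ _ ss'.
have H2 := mdist_cpath_le h h' s'.
have H3 : mdist h h' < e.
  rewrite (le_lt_trans (metric_triangle _ (g j) _))// (splitr e) ltrD//.
    by rewrite metric_sym; exact: lt_trans ke.
  exact: lt_trans ke.
have H4 := metric_triangle (x n) (cpath h s) (cpath h' s').
have H5 := metric_triangle (cpath h s) (cpath h s') (cpath h' s').
have : e + e = r - mdist (x n) (cpath h s) by rewrite /e -splitr.
lra.
Qed.

End separable_curves.

(** * Finite families of nonoverlapping intervals *)

Section subintervals.
Context (R : realType).
Local Notation I := (unit_interval R).
Implicit Types (s u : seq (I * I)) (a b c : I) (i j : I * I).

Definition nonoverlap i j := (val i.2 <= val j.1) || (val j.2 <= val i.1).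

Definition inside a b : pred (I * I) :=
  fun i => (val a <= val i.1) && (val i.2 <= val b).

Lemma subintervalsE s :
  subintervals s = all (fun i => val i.1 <= val i.2) s && pairwise nonoverlap s.
Proof. by []. Qed.

Lemma subintervals_filter (p : pred (I * I)) s :
  subintervals s -> subintervals (seq.filter p s).
Proof.
rewrite !subintervalsE => /andP[sle spw]; apply/andP; split.
  by rewrite all_filter; apply: sub_all sle => i /= ->; rewrite implybT.
exact: pairwise_filter.
Qed.

Lemma subintervals_cat s u : subintervals s -> subintervals u ->
  allrel nonoverlap s u -> subintervals (s ++ u).
Proof.
rewrite !subintervalsE all_cat pairwise_cat => /andP[-> ->] /andP[-> ->] ->.
by [].
Qed.

Lemma subintervals_map (f : I -> I) s :
  (forall x y, val x <= val y -> val (f x) <= val (f y)) ->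
  subintervals s -> subintervals [seq (f i.1, f i.2) | i <- s].
Proof.
move=> fle; rewrite !subintervalsE => /andP[/allP sle spw]; apply/andP; split.
  by apply/allP => _ /mapP[i /sle ile ->]/=; exact: fle.
rewrite pairwise_map; apply: sub_pairwise spw => i j; rewrite /nonoverlap/=.
by case/orP => /fle ->; rewrite ?orbT.
Qed.

(** The list is not sorted. The induction on its size splits the tail into the intervals to the left
    and to the right of the head. *)
Lemma sum_monotone_subintervals (W : I -> R) a b s :
  (forall x y, val x <= val y -> W x <= W y) -> val a <= val b ->
  subintervals s -> all (inside a b) s ->
  \sum_(i <- s) (W i.2 - W i.1) <= W b - W a.
Proof.
move=> Wle; have [n] := ubnP (size s).
elim: n s a b => // n IH [|i s] a b /=; first by rewrite big_nil subr_ge0 => *; exact: Wle.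
rewrite ltnS subintervalsE /= => sn ab /andP[/andP[ile sle] /andP[/allP isep spw]].
move=> /andP[/andP[ai ib] sin].
have sS : subintervals s by rewrite subintervalsE sle.
rewrite big_cons (bigID (fun j => val j.2 <= val i.1))/=.
have H1 : \sum_(j <- s | val j.2 <= val i.1) (W j.2 - W j.1) <= W i.1 - W a.
  rewrite -big_filter; apply: IH => //.
  - by rewrite (leq_ltn_trans _ sn)// size_filter count_size.
  - exact: subintervals_filter.
  - rewrite all_filter; apply: sub_all sin => j /andP[aj jb].
    by apply/implyP => ji; rewrite /inside aj.
have H2 : \sum_(j <- s | ~~ (val j.2 <= val i.1)) (W j.2 - W j.1) <= W b - W i.2.
  rewrite -big_filter; apply: IH => //.
  - by rewrite (leq_ltn_trans _ sn)// size_filter count_size.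
  - exact: subintervals_filter.
  - apply/allP => j; rewrite mem_filter => /andP[ji js].
    have := isep _ js; rewrite /nonoverlap (negPf ji) orbF => ij.
    by have /andP[_ jb] := allP sin _ js; rewrite /inside ij.
lra.
Qed.

(** Applied to both endpoints, [umin a] keeps the part of an interval left of a and [umax a] the
    part right of it. Being monotone, they preserve nonoverlapping families. *)
Definition umin a b : I := if val a <= val b then a else b.
Definition umax a b : I := if val a <= val b then b else a.

Lemma val_umin a b : val (umin a b) = Num.min (val a) (val b).
Proof. by rewrite /umin minElt; case: ltgtP => // ->. Qed.

Lemma val_umax a b : val (umax a b) = Num.max (val a) (val b).
Proof. by rewrite /umax maxElt; case: ltgtP => // ->. Qed.

Lemma umin_le a x y : val x <= val y -> val (umin a x) <= val (umin a y).
Proof. by move=> xy; rewrite !val_umin le_min ge_min lexx/= ge_min xy orbT. Qed.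

Lemma umax_le a x y : val x <= val y -> val (umax a x) <= val (umax a y).
Proof. by move=> xy; rewrite !val_umax ge_max le_max lexx/= le_max xy orbT. Qed.

End subintervals.

(** * Variation of a map into a metric space *)

Section mvariation.
Context (R : realType) (Y : metricType R) (g : unit_interval R -> Y).
Local Notation I := (unit_interval R).
Implicit Types (s u : seq (I * I)) (a b c : I) (i j : I * I).
Local Open Scope ereal_scope.

Definition vsum s : R := (\sum_(i <- s) mdist (g i.1) (g i.2))%R.

Definition mvariation a b : \bar R :=
  ereal_sup [set (vsum s)%:E | s in [set s | subintervals s && all (inside a b) s]].

Lemma vsum_cat s u : vsum (s ++ u) = (vsum s + vsum u)%R.
Proof. by rewrite /vsum big_cat. Qed.

Lemma vsum_le_mvariation a b s : subintervals s -> all (inside a b) s ->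
  (vsum s)%:E <= mvariation a b.
Proof. by move=> sS sin; apply: ereal_sup_ubound; exists s => //=; rewrite sS. Qed.

Lemma mvariation_ge0 a b : 0 <= mvariation a b.
Proof.
by apply: le_trans (@vsum_le_mvariation a b [::] _ _) => //; rewrite /vsum big_nil.
Qed.

Lemma mdist_le_mvariation a b : (val a <= val b)%R ->
  (mdist (g a) (g b))%:E <= mvariation a b.
Proof.
move=> ab; have := @vsum_le_mvariation a b [:: (a, b)].
by rewrite /vsum big_seq1; apply; rewrite /= /subintervals /inside/= ?ab ?lexx.
Qed.

(** Every interval of a competitor on [a, c] is cut at b; the triangle inequality handles the one
    that straddles b. *)
Lemma mvariation_cat_le a b c : (val a <= val b)%R -> (val b <= val c)%R ->
  mvariation a c <= mvariation a b + mvariation b c.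
Proof.
move=> ab bc; apply: ge_ereal_sup => _ [s /= /andP[sS sin] <-].
pose f i := (umin b i.1, umin b i.2).
pose k i := (umax b i.1, umax b i.2).
apply: (@le_trans _ _ ((vsum (map f s))%:E + (vsum (map k s))%:E)).
  rewrite -EFinD lee_fin /vsum !big_map -big_split/=; apply: ler_sum => i _.
  rewrite /umin /umax; case: (leP (val b) (val i.1)) => b1; case: (leP (val b) (val i.2)) => b2; rewrite ?mdistxx ?add0r ?addr0//.
    by rewrite addrC; exact: metric_triangle.
  exact: metric_triangle.
apply: leeD; apply: vsum_le_mvariation.
- by apply: subintervals_map => // x y; exact: umin_le.
- apply/allP => _ /mapP[i /(allP sin)/andP[ai ic] ->]; rewrite /inside !val_umin/=.
  by rewrite le_min ab ai ge_min lexx.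
- by apply: subintervals_map => // x y; exact: umax_le.
- apply/allP => _ /mapP[i /(allP sin)/andP[ai ic] ->]; rewrite /inside !val_umax/=.
  by rewrite le_max lexx ge_max bc ic.
Qed.

Lemma mvariation_cat_ge a b c : (val a <= val b)%R -> (val b <= val c)%R ->
  mvariation a b \is a fin_num -> mvariation b c \is a fin_num ->
  mvariation a b + mvariation b c <= mvariation a c.
Proof.
move=> ab bc fab fbc; rewrite -leeBrDr//.
apply: ge_ereal_sup => _ [s /= /andP[sS sin] <-].
rewrite leeBrDr// addeC -leeBrDr//.
apply: ge_ereal_sup => _ [u /= /andP[uS uin] <-].
rewrite ?EFinN leeBrDr// -EFinD addrC -vsum_cat; apply: vsum_le_mvariation.
  apply: subintervals_cat => //; apply/allrelP => i j /(allP sin)/andP[ai ib].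
  by move=> /(allP uin)/andP[bj jc]; rewrite /nonoverlap (le_trans ib bj).
rewrite all_cat; apply/andP; split.
  by apply: sub_all sin => i /andP[ai ib]; rewrite /inside ai (le_trans ib).
by apply: sub_all uin => i /andP[ai ib]; rewrite /inside (le_trans _ ai).
Qed.

Lemma mvariation_sub a b a' b' : (val a' <= val a)%R -> (val b <= val b')%R ->
  mvariation a b <= mvariation a' b'.
Proof.
move=> a'a bb'; apply: ge_ereal_sup => _ [s /= /andP[sS sin] <-].
apply: vsum_le_mvariation => //.
by apply: sub_all sin => i /andP[ai ib]; rewrite /inside (le_trans a'a)// (le_trans ib).
Qed.

Lemma mvariation_minimal (W : I -> R) a b :
  (forall x y, val x <= val y -> mdist (g x) (g y) <= W y - W x)%R ->
  (val a <= val b)%R -> mvariation a b <= (W b - W a)%:E.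
Proof.
move=> gW ab; apply: ge_ereal_sup => _ [s /= /andP[sS sin] <-]; rewrite lee_fin.
apply: (@le_trans _ _ (\sum_(i <- s) (W i.2 - W i.1))%R).
  rewrite /vsum big_seq [leRHS]big_seq; apply: ler_sum => i js; apply: gW.
  by move: sS => /andP[/allP/(_ _ js)].
apply: sum_monotone_subintervals => // x y /gW H; rewrite -subr_ge0.
by apply: le_trans H; exact: mdist_ge0.
Qed.

(** This carries absolute continuity from distances to variations. The list [u] holds the intervals
    already refined; the induction replaces the head of [s] by an arbitrary family inside it, which
    does not increase the total length, and takes the supremum. *)
Lemma sum_mvariation_le (d e : R) u s :
  (forall s, subintervals s -> \sum_(i <- s) (val i.2 - val i.1) < d ->
     vsum s < e)%R ->
  subintervals (u ++ s) -> (\sum_(i <- u ++ s) (val i.2 - val i.1) < d)%R ->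
  (vsum u)%:E + \sum_(i <- s) mvariation i.1 i.2 <= e%:E.
Proof.
move=> ve; elim: s u => [|i s IH] u.
  by rewrite cats0 big_nil adde0 => uS ud; rewrite lee_fin ltW// ve.
move=> uS ud; rewrite big_cons.
have S0 : 0 <= \sum_(j <- s) mvariation j.1 j.2.
  by apply: sume_ge0 => j _; exact: mvariation_ge0.
(* Finiteness of the remaining terms, obtained by dropping the interval i, is what allows them to be
   moved across the inequality in the extended reals. *)
have Sfin : \sum_(j <- s) mvariation j.1 j.2 \is a fin_num.
  have := IH u; rewrite ge0_fin_numE// => /(_ _ _)H.
  have {}H : (vsum u)%:E + \sum_(j <- s) mvariation j.1 j.2 <= e%:E.
    apply: H.
      have /andP[] := uS; rewrite all_cat pairwise_cat/= => /andP[u1 /andP[_ s1]].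
      rewrite allrel_consr => /and3P[/andP[_ us] u2 /andP[_ s2]].
      by rewrite subintervalsE all_cat pairwise_cat u1 s1 u2 s2 us.
    apply: le_lt_trans ud; rewrite !big_cat/= big_cons lerD2l lerDr subr_ge0.
    by move: uS => /andP[+ _]; rewrite all_cat/= => /and3P[].
  rewrite -leeBrDl// in H; apply: (le_lt_trans H); exact: ltry.
rewrite addeA -leeBrDr// -leeBrDl//.
apply: ge_ereal_sup => _ [l /= /andP[lS lin] <-].
rewrite ?EFinN leeBrDr// -EFinD leeBrDr// [X in X%:E]addrC -vsum_cat; apply: IH.
  move: uS; rewrite -!catA !subintervalsE !all_cat !pairwise_cat/=.
  move: lS; rewrite subintervalsE => /andP[-> ->].
  move=> /andP[/and3P[-> ile ->]] /and3P[+ -> /andP[/allP isep ->]].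
  rewrite allrel_consr => /andP[/allP ui us] /=; rewrite andbT.
  rewrite allrel_catr us andbT; apply/andP; split.
    apply/allrelP => x y xu /(allP lin)/andP[iy yi]; have := ui _ xu.
    rewrite /nonoverlap => /orP[xi|ix]; first by rewrite (le_trans xi iy).
    by rewrite (le_trans yi ix) orbT.
  apply/allrelP => x y /(allP lin)/andP[ix xi] /isep.
  rewrite /nonoverlap => /orP[iy|yi]; first by rewrite (le_trans xi iy).
  by rewrite (le_trans yi ix) orbT.
apply: le_lt_trans ud; rewrite !big_cat/= big_cons -addrA lerD2l lerD2r.
apply: (@sum_monotone_subintervals _ val) => //.
by move: uS => /andP[+ _]; rewrite all_cat/= => /and3P[].
Qed.

End mvariation.

Section abs_cont_mvariation.
Context (R : realType) (Y : metricType R) (g : unit_interval R -> Y).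
Local Notation I := (unit_interval R).
Hypothesis acg : abs_cont g.

Lemma abs_cont_vsum (e : R) : 0 < e -> exists2 d : R, 0 < d &
  forall s : seq (I * I), subintervals s -> \sum_(i <- s) (val i.2 - val i.1) < d ->
    vsum g s < e.
Proof. by move=> /acg. Qed.

Let mvariation_small (e : R) : 0 < e -> exists2 d : R, 0 < d &
  forall a b : I, val a <= val b -> val b - val a < d -> (mvariation g a b <= e%:E)%E.
Proof.
move=> /abs_cont_vsum[d d0 dP]; exists d => // a b ab abd.
have := @sum_mvariation_le _ _ g d e [::] [:: (a, b)] dP.
rewrite /vsum big_nil add0e !big_seq1/=; apply => //.
by rewrite subintervalsE/= ab.
Qed.

(** The unit interval is cut into N.+1 pieces shorter than the modulus for e = 1, each of variation
    at most 1. *)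
Lemma mvariation_fin a b : mvariation g a b \is a fin_num.
Proof.
have [d d0 dP] := mvariation_small ltr01; have [N Nd] := natSinv_lt d0.
have N0 : 0 < N.+1%:R :> R by [].
have vq n : (n <= N.+1)%N -> val (clamp (n%:R / N.+1%:R) : I) = n%:R / N.+1%:R.
  move=> nN; rewrite val_clamp// divr_ge0//= ler_pdivrMr// mul1r ler_nat//.
have H n : (n <= N.+1)%N -> (mvariation g (clamp 0) (clamp (n%:R / N.+1%:R)) < +oo)%E.
  elim: n => [|n IH] nN.
    by rewrite mul0r (le_lt_trans (dP _ _ _ _))// ?subrr// ltry.
  apply: (@le_lt_trans _ _ (mvariation g (clamp 0) (clamp (n%:R / N.+1%:R)) +
      mvariation g (clamp (n%:R / N.+1%:R)) (clamp (n.+1%:R / N.+1%:R)))%E).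
    apply: mvariation_cat_le; rewrite !vq// ?(ltnW nN)// ?val_clamp ?lexx ?ler01//.
    by rewrite ler_pM2r ?invr_gt0// ler_nat.
  rewrite lte_add_pinfty// ?IH// ?(ltnW nN)// (le_lt_trans (dP _ _ _ _)) ?ltry//.
    by rewrite !vq ?(ltnW nN)// ler_pM2r ?invr_gt0// ler_nat.
  by rewrite !vq ?(ltnW nN)// -mulrBl -natrB// subSnn mul1r.
rewrite ge0_fin_numE ?mvariation_ge0//.
have := H N.+1 (leqnn _); rewrite divff ?gt_eqF//; apply: le_lt_trans.
have /andP[a0 _] := unit_intervalP a; have /andP[_ b1] := unit_intervalP b.
by apply: mvariation_sub; rewrite val_clamp// ?lexx ?ler01.
Qed.

Definition vfun (t : I) : R := fine (mvariation g (clamp 0) t).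

Let clamp0_le (t : I) : val (clamp 0 : I) <= val t.
Proof. by rewrite val_clamp ?lexx ?ler01//; case/andP: (unit_intervalP t). Qed.

Lemma vfunB s t : val s <= val t -> (vfun t - vfun s)%:E = mvariation g s t.
Proof.
move=> st; rewrite /vfun EFinB !fineK ?mvariation_fin//.
have -> : mvariation g (clamp 0) t = (mvariation g (clamp 0) s + mvariation g s t)%E.
  apply/eqP; rewrite eq_le; apply/andP; split.
    exact: mvariation_cat_le.
  by apply: mvariation_cat_ge => //; exact: mvariation_fin.
by rewrite -addeA addeCA subee ?mvariation_fin// adde0.
Qed.

Lemma vfun_le s t : val s <= val t -> vfun s <= vfun t.
Proof.
by move=> st; rewrite -subr_ge0 -lee_fin vfunB//; exact: mvariation_ge0.
Qed.

Lemma mdist_le_vfun s t : val s <= val t -> mdist (g s) (g t) <= vfun t - vfun s.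
Proof. by move=> st; rewrite -lee_fin vfunB//; exact: mdist_le_mvariation. Qed.

(** With the primitive of a candidate speed as [W], this bounds the density of the variation from
    above in [vfun_density]. *)
Lemma vfun_minimal (W : I -> R) s t :
  (forall x y, val x <= val y -> mdist (g x) (g y) <= W y - W x) ->
  val s <= val t -> vfun t - vfun s <= W t - W s.
Proof. by move=> gW st; rewrite -lee_fin vfunB//; exact: mvariation_minimal. Qed.

Lemma abs_cont_vfun : abs_cont (vfun : I -> R^o).
Proof.
move=> e e0; have e2 : 0 < e / 2 by rewrite divr_gt0.
have [d d0 dP] := abs_cont_vsum e2; exists d => // s sS sd.
apply: (@le_lt_trans _ _ (e / 2)); last by rewrite ltr_pdivrMr// ltr_pMr// ltr1n.
have := @sum_mvariation_le _ _ g d (e / 2) [::] s dP sS sd.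
rewrite /vsum big_nil add0e => H; rewrite -lee_fin; apply: le_trans H.
rewrite -sumEFin big_seq [leRHS]big_seq; apply: lee_sum => i js.
have ile : val i.1 <= val i.2 by case/andP: sS => /allP/(_ _ js).
by rewrite -vfunB// lee_fin /mdist/= ger0_norm// subr_ge0 vfun_le.
Qed.

End abs_cont_mvariation.

(** * Absolute continuity and Lebesgue densities *)

Section disjointify.
Context (R : realType).
Local Notation I := (unit_interval R).
Implicit Types (s : seq (I * I)).

Definition ocitvs s : set R := [set x | has (fun i => val i.1 < x <= val i.2) s].

Lemma ocitvs_cons i s : ocitvs (i :: s) = `]val i.1, val i.2]%classic `|` ocitvs s.
Proof.
apply/seteqP; split => x; rewrite /ocitvs/= in_itv/=.
  by case/orP => H; [left|right].
by case => ->; rewrite ?orbT.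
Qed.

Lemma ocitvs_nil : ocitvs [::] = set0.
Proof. by apply/seteqP; split. Qed.

Lemma measurable_ocitvs s : measurable (ocitvs s).
Proof.
elim: s => [|i s IH]; first by rewrite ocitvs_nil.
by rewrite ocitvs_cons; apply: measurableU.
Qed.

(** The new interval ]a, b] is kept whole, and the others are reduced to their parts left of a ([f])
    and right of b ([k]); what would overlap collapses to a degenerate, hence empty, interval. *)
Lemma ocitvs_disjointify s : all (fun i => val i.1 <= val i.2) s ->
  exists2 s', subintervals s' & ocitvs s' = ocitvs s.
Proof.
elim: s => [_|[a b] s IH /= /andP[ab /IH[s' sS' s'E]]]; first by exists [::].
pose f := fun i : I * I => (umin a i.1, umin a i.2).
pose k := fun i : I * I => (umax b i.1, umax b i.2).
exists ((a, b) :: map f s' ++ map k s').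
  have fS : subintervals (map f s') by apply: subintervals_map sS' => x y; exact: umin_le.
  have kS : subintervals (map k s') by apply: subintervals_map sS' => x y; exact: umax_le.
  have abS : subintervals [:: (a, b)] by rewrite subintervalsE/= ab.
  rewrite -cat1s; apply: subintervals_cat => //; first apply: subintervals_cat => //.
    apply/allrelP => _ _ /mapP[i _ ->] /mapP[j _ ->]; rewrite /nonoverlap/=.
    rewrite [val (umin a i.2)]val_umin [val (umax b j.1)]val_umax; apply/orP; left.
    by rewrite ge_min le_max ab.
  apply/allrelP => _ j /[!inE] /eqP->; rewrite mem_cat => /orP[]/mapP[i _ ->].
    by rewrite /nonoverlap [val (f i).2]val_umin ge_min lexx orbT.
  by rewrite /nonoverlap [val (k i).1]val_umax le_max lexx.
rewrite !ocitvs_cons -s'E; apply/seteqP; split => x /=; rewrite in_itv/=.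
  case=> [|/hasP[j]]; first by left.
  rewrite mem_cat => /orP[]/mapP[i is' ->]/=.
    rewrite [val (umin _ i.1)]val_umin [val (umin _ i.2)]val_umin => /andP[H1 H2].
    right; apply/hasP; exists i => //; move: H1 H2.
    rewrite gt_min le_min => /orP[ax /andP[xa _]|ix /andP[_ xi]].
      by move: (lt_le_trans ax xa); rewrite ltxx.
    by rewrite ix.
  rewrite [val (umax _ i.1)]val_umax [val (umax _ i.2)]val_umax => /andP[H1 H2].
  right; apply/hasP; exists i => //; move: H1 H2.
  rewrite gt_max le_max => /andP[bx ix] /orP[xb|xi].
    by move: (lt_le_trans bx xb); rewrite ltxx.
  by rewrite ix.
case=> [|/hasP[i is' /andP[ix xi]]]; first by left.
have [xa|ax] := leP x (val a).
  right; apply/hasP; exists (f i); first by rewrite mem_cat map_f.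
  by rewrite [val (f i).1]val_umin [val (f i).2]val_umin le_min xa xi gt_min ix orbT.
have [xb|bx] := leP x (val b); first by left.
right; apply/hasP; exists (k i); first by rewrite mem_cat map_f ?orbT.
by rewrite [val (k i).1]val_umax [val (k i).2]val_umax le_max xi orbT gt_max bx ix.
Qed.

End disjointify.

Section stieltjes_density.
Context (R : realType).
Local Notation I := (unit_interval R).
Local Notation leb := (@lebesgue_measure R).
Local Open Scope ereal_scope.

Lemma ocitvs_measure_le (mu : {measure set (measurableTypeR R) -> \bar R})
    (F : R -> R) (s : seq (I * I)) :
  (forall a b : R, (a <= b)%R -> mu `]a, b]%classic = (F b - F a)%:E) ->
  all (fun i => val i.1 <= val i.2)%R s ->
  mu (ocitvs s) <= (\sum_(i <- s) (F (val i.2) - F (val i.1)))%:E.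
Proof.
move=> muF; elim: s => [_|i s IH /= /andP[ile /IH{}IH]].
  by rewrite ocitvs_nil measure0 big_nil.
rewrite ocitvs_cons big_cons EFinD.
apply: (le_trans (measureU2 _ _ _)) => //; first exact: measurable_ocitvs.
apply: leeD; last exact: IH.
by have E := muF _ _ ile; rewrite le_eqVlt; apply/orP; left; apply/eqP; exact: E.
Qed.

Lemma ocitvs_lebesgue (s : seq (I * I)) : subintervals s ->
  leb (ocitvs s) = (\sum_(i <- s) (val i.2 - val i.1))%:E.
Proof.
elim: s => [_|i s IH]; first by rewrite ocitvs_nil measure0 big_nil.
rewrite subintervalsE/= => /andP[/andP[ile sle] /andP[/allP isep spw]].
rewrite ocitvs_cons measureU//; last 2 first.
- exact: measurable_ocitvs.
- apply/seteqP; split => // x [] /=; rewrite in_itv/= => /andP[ix xi] /hasP[j js].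
  move=> /andP[jx xj]; have /orP[H|H] := isep _ js.
    by have := le_lt_trans xi (le_lt_trans H jx); rewrite ltxx.
  by have := le_lt_trans xj (le_lt_trans H ix); rewrite ltxx.
have /IH E1 : subintervals s by rewrite subintervalsE sle.
have E2 : leb `]val i.1, val i.2]%classic = (val i.2 - val i.1)%:E.
  rewrite lebesgue_measure_itv/= lte_fin; case: ltP => // H.
  by have /eqP -> : val i.1 == val i.2; [rewrite eq_le ile|rewrite subrr].
by rewrite big_cons EFinD -E1 -E2.
Qed.

Lemma lebesgue_cover0 (A : set R) (d : R) : measurable A -> leb A = 0 -> (0 < d)%R ->
  exists M : nat -> set R, [/\ forall n, measurable (M n : set (ocitv_type R)),
    A `<=` \bigcup_n M n & \sum_(n <oo) leb (M n) < d%:E].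
Proof.
move=> mA A0 d0.
have /ereal_inf_lt[z [/= M [mM AM] Mz zd]] : leb A < d%:E by rewrite A0 lte_fin.
exists M; split => //; apply: le_lt_trans zd; rewrite -Mz.
apply: lee_nneseries => // n _.
by rewrite /lebesgue_measure /lebesgue_stieltjes_measure /= /measure_extension/= measurable_mu_extE.
Qed.

(** A null set is covered by half-open intervals of total length less than the modulus d. Absolute
    continuity only speaks of finite nonoverlapping families, so the initial segments [L n] of the
    cover are disjointified, and the bound passes to the union by continuity from below. *)
Lemma abs_cont_dominates (mu : {measure set (measurableTypeR R) -> \bar R})
    (F : R -> R) (A : set R) :
  (forall a b : R, (a <= b)%R -> mu `]a, b]%classic = (F b - F a)%:E) ->
  abs_cont (F \o val : I -> R^o) -> measurable A -> leb A = 0 ->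
  mu (A `&` `]0%R, 1%R]) = 0.
Proof.
move=> muF acF mA A0; apply/eqP; rewrite eq_le measure_ge0 andbT.
apply/lee_addgt0Pr => e e0; rewrite add0e.
have [d d0 dP] := acF e e0.
have [M [mM AM Md]] := lebesgue_cover0 mA A0 d0.
(* [ab n] is [M n] with its endpoints clamped: it keeps the part of [M n] in ]0, 1] and stays inside
   [M n]. An empty [M n] receives a degenerate interval. *)
have /choice[ab abP] n : exists i : I * I, [/\ (val i.1 <= val i.2)%R,
    M n `&` `]0%R, 1%R] `<=` `]val i.1, val i.2] &
    `]val i.1, val i.2] `<=` M n].
  have /ocitvP[->|[[a b] /= ab ->]] := mM n.
    exists (clamp 0, clamp 0); split => //; first by rewrite set0I.
    by move=> x /=; rewrite in_itv/= => /andP[/lt_le_trans H /H]; rewrite ltxx.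
  exists (clamp a, clamp b); split; first exact/clamp_le/ltW.
    move=> x [] /=; rewrite !in_itv/= => /andP[ax xb] /andP[x0 x1].
    by rewrite gt_max x0 gt_min ax /= le_max le_min xb x1 orbT.
  move=> x /=; rewrite !in_itv/= gt_max gt_min le_max le_min.
  move=> /andP[/andP[x0 /orP[ax|x1]] /orP[x0'|/andP[xb x1']]].
  - by have := lt_le_trans x0 x0'; rewrite ltxx.
  - by rewrite ax.
  - by have := lt_le_trans x0 x0'; rewrite ltxx.
  - by have := lt_le_trans x1 x1'; rewrite ltxx.
pose L n := [seq ab k | k <- iota 0 n].
have Lle n : all (fun i => val i.1 <= val i.2)%R (L n).
  by apply/allP => _ /mapP[k _ ->]; have [] := abP k.
have muL n : mu (ocitvs (L n)) <= e%:E.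
  have [L' L'S L'E] := ocitvs_disjointify (Lle n).
  have L'd : (\sum_(i <- L') (val i.2 - val i.1) < d)%R.
    rewrite -lte_fin -ocitvs_lebesgue// L'E; apply: le_lt_trans Md.
    apply: (@le_trans _ _ (leb (\bigcup_n M n))).
      apply: le_measure; rewrite ?inE; first exact: measurable_ocitvs.
        by apply: bigcupT_measurable => k; exact: sub_sigma_algebra.
      move=> x /hasP[_ /mapP[k _ ->] kx]; exists k => //.
      by have [_ _] := abP k; apply; rewrite /= in_itv.
    apply: outer_measure_sigma_subadditive.
  rewrite -L'E; apply: le_trans (ocitvs_measure_le muF _) _.
    by case/andP: L'S.
  rewrite lee_fin; apply: le_trans (ltW (dP _ L'S L'd)).
  apply: ler_sum => i _ /=; exact: ler_norm.
have cL : mu (ocitvs (L n)) @[n --> \oo] --> mu (\bigcup_n ocitvs (L n)).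
  apply: nondecreasing_cvg_mu.
  - by move=> n; exact: measurable_ocitvs.
  - by apply: bigcupT_measurable => n; exact: measurable_ocitvs.
  - move=> n k nk; apply/subsetPset => x /hasP[_ /mapP[j + ->] jx].
    rewrite mem_iota/= add0n => jn; apply/hasP; exists (ab j) => //.
    by rewrite map_f// mem_iota/= add0n (leq_trans jn).
apply: (@le_trans _ _ (mu (\bigcup_n ocitvs (L n)))).
  apply: le_measure; rewrite ?inE; first exact: measurableI.
    by apply: bigcupT_measurable => n; exact: measurable_ocitvs.
  move=> x [/AM[n _ Mnx] x01]; exists n.+1 => //; apply/hasP; exists (ab n).
    by rewrite map_f// mem_iota/= add0n.
  by have [_ + _] := abP n => /(_ x (conj Mnx x01)); rewrite /= in_itv.
rewrite -(cvg_lim _ cL)//; apply: lime_le; first by apply/cvg_ex; eexists; exact: cL.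
by apply: nearW.
Qed.

End stieltjes_density.

Lemma ae_forall_nat d (T : measurableType d) (R : realType)
    (mu : {measure set T -> \bar R}) (P : nat -> T -> Prop) :
  (forall n, {ae mu, forall x, P n x}) -> {ae mu, forall x, forall n, P n x}.
Proof.
move=> aeP; have := negligible_bigcup aeP; apply: negligibleS => x /=.
by move=> /existsNP[n nP]; exists n.
Qed.

Section ae.
Context d (T : measurableType d) (R : realType) (mu : {measure set T -> \bar R}).

Lemma ae_mono (P Q : T -> Prop) :
  (forall x, P x -> Q x) -> {ae mu, forall x, P x} -> {ae mu, forall x, Q x}.
Proof. by move=> PQ; apply: negligibleS => x /= nQ /PQ. Qed.

Lemma ae_and (P Q : T -> Prop) : {ae mu, forall x, P x} -> {ae mu, forall x, Q x} ->
  {ae mu, forall x, P x /\ Q x}.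
Proof.
move=> aP aQ; have := negligibleU aP aQ; apply: negligibleS => x /=.
by move=> /not_andP.
Qed.

End ae.

Lemma ae_unit_interval (R : realType) (P : R -> Prop) :
  {ae (@lebesgue_measure R), forall t, 0 < t < 1 -> P t} ->
  {ae (@lebesgue_measure R), forall t, 0 <= t <= 1 -> P t}.
Proof.
have ne (r : R) : {ae (@lebesgue_measure R), forall t, t != r}.
  exists [set r]; split => //; first by rewrite lebesgue_measure_set1.
  by move=> t /= /negP; rewrite negbK => /eqP.
move=> aeP; apply: ae_mono (ae_and aeP (ae_and (ne 0) (ne 1))).
by move=> t [H [t0 t1]] /andP[t0' t1']; apply: H; rewrite !lt_neqAle t0' t1' eq_sym t0 t1.
Qed.

Section density.
Context (R : realType).
Local Notation I := (unit_interval R).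
Local Notation leb := (@lebesgue_measure R).
Implicit Types (f : I -> R) (v : R -> R).

Definition density f v := [/\ measurable_fun setT v,
  leb.-integrable setT (EFin \o v) &
  forall s t : I, val s <= val t ->
    f t - f s = \int[leb]_(r in `[val s, val t]) v r].

Lemma abs_cont_continuous f : abs_cont (f : I -> R^o) -> continuous (f \o @clamp R).
Proof.
move=> acf t; apply/cvgrPdist_lt => e e0; have [d d0 dP] := acf e e0.
have H s r : s <= r -> `|s - r| < d -> `|f (clamp r) - f (clamp s)| < e.
  move=> sr srd; have dsr := dP [:: (clamp s, clamp r)].
  rewrite !big_seq1 in dsr; apply: dsr.
    by apply/andP; split => //; apply/andP; split => //; exact: clamp_le.
  apply: le_lt_trans srd; rewrite distrC.
  by apply: le_trans (ler_norm _) _; exact: clamp_lipschitz.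
apply/nbhs_ballP; exists d => //= s; rewrite /ball/= => st.
have [ts|/ltW ts] := leP t s; last by apply: H => //; rewrite distrC.
by rewrite distrC; exact: H.
Qed.

Lemma lebesgue_stieltjes_itv (F : cumulative R R) a b : a <= b ->
  lebesgue_stieltjes_measure F `]a, b]%classic = (F b - F a)%:E.
Proof.
move=> ab; rewrite /lebesgue_stieltjes_measure /measure_extension/=.
by rewrite measurable_mu_extE/= ?wlength_itv_bnd//; exact: is_ocitv.
Qed.

(** The density is the Radon-Nikodym derivative of the Stieltjes measure of f composed with [clamp],
    restricted to ]0, 1]; [abs_cont_dominates] gives the domination by Lebesgue measure. *)
Lemma abs_cont_density f : (forall s t, val s <= val t -> f s <= f t) ->
  abs_cont (f : I -> R^o) -> exists2 v, density f v & forall t, 0 <= v t.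
Proof.
move=> f_nd acf.
pose F := f \o @clamp R.
have F_nd : nondecreasing F by move=> s t st; apply: f_nd; exact: clamp_le.
have F_rc : right_continuous F by apply: right_continuousW; exact: abs_cont_continuous.
pose F' : cumulative R R := HB.pack F (isCumulative.Build R _ R F F_nd F_rc).
pose mu := lebesgue_stieltjes_measure F'.
have muF a b : a <= b -> mu `]a, b]%classic = (F b - F a)%:E.
  exact: (lebesgue_stieltjes_itv F').
have mD : measurable (`]0, 1]%classic : set (measurableTypeR R)) by exact: measurable_itv.
have moo : (mu `]0%R, 1%R]%classic < +oo)%E by rewrite muF// ltry.
pose nu : {finite_measure set (measurableTypeR R) -> \bar R} := mfrestr mD moo.
have nu_leb : nu `<< leb.
  apply/null_content_dominatesP => A mA A0; rewrite /nu/= /mfrestr /mrestr.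
  apply: (@abs_cont_dominates R mu F) => //.
  have -> // : F \o val = f.
  by apply/funext => t; exact: (congr1 f (clamp_val t)).
have [w [w0 wfin intw wE]] := radon_nikodym_sigma_finite nu_leb.
have fw : EFin \o (fine \o w) = w by apply/funext => t /=; rewrite fineK.
exists (fine \o w); last by move=> t; rewrite /= fine_ge0.
split.
- by apply/measurable_EFinP; rewrite fw; exact: measurable_int intw.
- by rewrite fw.
- move=> s t st; have st1 := muF _ _ st; rewrite /F/= !clamp_val in st1.
  apply: EFin_inj; rewrite -st1 /Rintegral.
  rewrite (_ : (fun x => _) = w) ?fw//.
  rewrite fineK; last first.
    apply: integrable_fin_num => //; exact: (integrableS measurableT).
  rewrite -integral_itv_obnd_cbnd; last first.
    by apply: measurable_funTS; exact: measurable_int intw.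
  rewrite -wE// /nu/= /mfrestr /mrestr; congr (mu _).
  apply/esym/setIidl => r /=; rewrite !in_itv/= => /andP[sr rt].
  have /andP[s0 _] := unit_intervalP s; have /andP[_ t1] := unit_intervalP t.
  by rewrite (le_lt_trans s0 sr) (le_trans rt t1).
Qed.

(** Lebesgue differentiation, stated without quotients so that such estimates can be added and
    subtracted. *)
Lemma density_derivative f v : density f v ->
  {ae leb, forall t, 0 < t < 1 -> forall e, 0 < e -> exists2 d, 0 < d &
    forall s, `|s - t| < d -> 0 <= s <= 1 /\
      `|f (clamp s) - f (clamp t) - v t * (s - t)| <= e * `|s - t|}.
Proof.
move=> [mv iv fv].
have iNy y : leb.-integrable `]-oo, y] (EFin \o v) by exact: (integrableS measurableT).
have lv : locally_integrable [set: R] v by apply: open_integrable_locally => //; exact: openT.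
have := FTC1Ny iNy lv; apply: ae_mono => t /=.
set F := fun x : R => (\int[leb]_(t in `]-oo, x]) v t).
move=> [dF dFt] /andP[t0 t1] e e0.
have cF : h^-1 * (F (t + h) - F t) @[h --> 0^'] --> v t.
  rewrite -dFt; have := dF; rewrite /derivable => /cvg_ex[l Fl].
  rewrite derive1E /derive (cvg_lim _ Fl)//.
  apply: cvg_trans Fl; apply: near_eq_cvg; near=> h.
  by rewrite [h%:A]mulr1 /= (addrC h t).
move/cvgrPdist_le : cF => /(_ e e0).
rewrite near_withinE => /nbhs_ballP[d /= d0 dP].
(* The bounds t and 1 - t keep s inside [0, 1], where the increments of f and of the primitive F
   agree. *)
have m0 : 0 < Num.min d (Num.min t (1 - t)).
  by rewrite !lt_min d0 t0 subr_gt0.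
exists (Num.min d (Num.min t (1 - t))) => // s; rewrite !lt_min => /and3P[sd st0 st1].
have s01 : 0 <= s <= 1 by move: st0 st1; rewrite !ltr_norml; lra.
split => //.
have FE a b : a <= b -> 0 <= a -> b <= 1 -> f (clamp b) - f (clamp a) = F b - F a.
  move=> ab a0 b1; rewrite fv; last exact: clamp_le.
  rewrite !val_clamp ?a0 ?b1 ?(le_trans a0)//; last exact: le_trans b1.
  rewrite -Rintegral_itv_obnd_cbnd; last exact: (integrableS measurableT).
  by rewrite /F -(Rintegral_itvB (iNy b) _ _)//= bnd_simp.
have -> : f (clamp s) - f (clamp t) = F s - F t.
  have /andP[s0 s1] := s01; have [st|st] := leP s t.
    by apply: oppr_inj; rewrite !opprB FE// ltW.
  by rewrite FE// ltW.
have [->|st] := eqVneq s t; first by rewrite !subrr mulr0 normr0 mulr0 subrr normr0.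
have := dP (s - t); rewrite /ball/= sub0r normrN => /(_ sd).
rewrite subr_eq0 => /(_ st); rewrite (addrC t) subrK => H.
rewrite -normrN opprB.
have -> : v t * (s - t) - (F s - F t) = (v t - (s - t)^-1 * (F s - F t)) * (s - t).
  by rewrite mulrBl mulrAC mulVf ?subr_eq0// mul1r.
by rewrite normrM ler_wpM2r.
Unshelve. all: by end_near. Qed.

End density.

(** * The metric derivative as the density of the variation *)

Section metric_speed.
Context (R : realType) (X : completeMetricType R) (g : curve X).
Local Notation I := (unit_interval R).
Local Notation leb := (@lebesgue_measure R).
Hypothesis sepX : separable_space X.
Hypothesis acg : abs_cont g.

Let V := vfun g.

Let derivative_within (f : I -> R) (v : R -> R) (t : R) := forall e, 0 < e ->
  exists2 d, 0 < d & forall s, `|s - t| < d -> 0 <= s <= 1 /\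
      `|f (clamp s) - f (clamp t) - v t * (s - t)| <= e * `|s - t|.

Let mdist_V (s t : R) : mdist (g (clamp s)) (g (clamp t)) <= `|V (clamp s) - V (clamp t)|.
Proof.
wlog st : s t / s <= t => [H|].
  by have [/H//|/ltW/H] := leP s t; rewrite metric_sym distrC.
have := mdist_le_vfun acg (clamp_le st) => /le_trans; apply.
by rewrite distrC ler_norm.
Qed.

Lemma vfun_density : exists v, [/\ density V v, forall t, 0 <= v t &
  {ae leb, forall t, 0 < t < 1 ->
    mdist (g (clamp s)) (g (clamp t)) / `|s - t| @[s --> t^'] --> v t}].
Proof.
have [x xd] := separable_dense_seq sepX.
have [v vV v0] := abs_cont_density (vfun_le acg) (abs_cont_vfun acg).
pose phi n (t : I) := mdist (x n) (g t).
have phi_lip n s t : `|phi n s - phi n t| <= mdist (g s) (g t).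
  by rewrite (le_trans (mdist_triangle2 _ _ _ _))// mdistxx add0r.
(* [phi n] is not monotone, but [V + phi n] is, because V dominates the increments of [phi n]. Hence
   it has a density [w n], and [w n - v] is a density of [phi n]. *)
have /choice[w wP] n : exists w, density (fun t => V t + phi n t) w.
  have [|e e0|w wd _] := @abs_cont_density R (fun t => V t + phi n t).
  - move=> s t st; have := mdist_le_vfun acg st; have := phi_lip n s t.
    rewrite ler_norml /V; lra.
  - have e2 : 0 < e / 2 by rewrite divr_gt0.
    have [d d0 dP] := abs_cont_vfun acg e2; exists d => // s sS sd.
    have dPs := dP s sS sd.
    rewrite (splitr e); apply: le_lt_trans (ltrD dPs dPs).
    rewrite -big_split/= big_seq [leRHS]big_seq; apply: ler_sum => i js.
    have ile : val i.1 <= val i.2 by case/andP: sS => /allP/(_ _ js).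
    have Vi := mdist_le_vfun acg ile; have := phi_lip n i.1 i.2.
    rewrite ler_norml => /andP[p1 p2].
    have V0 : 0 <= V i.2 - V i.1 by apply: le_trans Vi; exact: mdist_ge0.
    have -> : mdist (vfun g i.1 : R^o) (vfun g i.2) = V i.2 - V i.1 by exact: ger0_norm.
    rewrite -[leLHS]/(`|V i.2 + phi n i.2 - (V i.1 + phi n i.1)|).
    by rewrite ler_norml; move: Vi; rewrite -/V => Vi; apply/andP; split; lra.
  - by exists w.
pose u n t := w n t - v t.
have du : {ae leb, forall t, 0 < t < 1 ->
    derivative_within V v t /\ forall n, derivative_within (phi n) (u n) t}.
  have aew n := density_derivative (wP n).
  have := ae_and (density_derivative vV) (ae_forall_nat aew).
  apply: ae_mono => t [Hv Hw] t01; split; first exact: Hv.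
  move=> n e e0; have e2 : 0 < e / 2 by rewrite divr_gt0.
  have [d d0 dP] := Hv t01 _ e2; have [d' d'0 d'P] := Hw n t01 _ e2.
  exists (Num.min d d'); first by rewrite lt_min d0.
  move=> s; rewrite lt_min => /andP[sd sd']; have [s01 H1] := dP _ sd.
  have [_ H2] := d'P _ sd'; split => //.
  have -> : phi n (clamp s) - phi n (clamp t) - u n t * (s - t) =
    (V (clamp s) + phi n (clamp s) - (V (clamp t) + phi n (clamp t)) - w n t * (s - t)) -
    (V (clamp s) - V (clamp t) - v t * (s - t)) by rewrite /u; ring.
  rewrite (le_trans (ler_normB _ _))// (le_trans (lerD H2 H1))//.
  by rewrite -mulrDl -splitr.
have u_le : {ae leb, forall t, 0 < t < 1 -> forall n, `|u n t| <= v t}.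
  apply: ae_mono du => t H t01 n; have {H}[Hv Hu] := H t01.
  apply/ler_addgt0Pr => e e0; have e2 : 0 < e / 2 by rewrite divr_gt0.
  have [d d0 dP] := Hv _ e2; have [d' d'0 d'P] := Hu n _ e2.
  have m0 : 0 < Num.min d d' / 2 by rewrite divr_gt0// lt_min d0.
  pose s := t + Num.min d d' / 2.
  have st : `|s - t| < Num.min d d'.
    by rewrite /s addrC addKr gtr0_norm// ltr_pdivrMr// ltr_pMr ?ltr1n// lt_min d0.
  move: st; rewrite lt_min => /andP[sd sd'].
  have [_ H1] := dP _ sd; have [_ H2] := d'P _ sd'.
  have s0 : 0 < s - t by rewrite /s addrC addKr.
  have H3 := phi_lip n (clamp s) (clamp t); have H4 := mdist_V s t.
  rewrite -(ler_pM2r s0) mulrDl.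
  rewrite (gtr0_norm s0) in H1 H2.
  have H5 : `|u n t * (s - t)| <= e / 2 * (s - t) + `|phi n (clamp s) - phi n (clamp t)|.
    have -> : u n t * (s - t) = (phi n (clamp s) - phi n (clamp t)) -
      (phi n (clamp s) - phi n (clamp t) - u n t * (s - t)) by ring.
    by rewrite (le_trans (ler_normB _ _))// addrC lerD2r.
  have H6 : `|V (clamp s) - V (clamp t)| <= e / 2 * (s - t) + v t * (s - t).
    have -> : V (clamp s) - V (clamp t) = (V (clamp s) - V (clamp t) - v t * (s - t)) + v t * (s - t) by ring.
    rewrite (le_trans (ler_normD _ _))// (ger0_norm (x := v t * _)) ?lerD2r//.
    by rewrite mulr_ge0// ltW.
  rewrite normrM (gtr0_norm s0) in H5; rewrite [e in e * _]splitr mulrDl; lra.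
have [mv iv vE] := vV.
have mu n : measurable_fun setT (u n) by apply: measurable_funB => //; have [] := wP n.
(* The supremum W could be infinite on a null set; its minimum b with v is finite and integrable,
   and still bounds every |u n| almost everywhere on [0, 1]. *)
pose W t : \bar R := esups (fun n => `|u n t|%:E) 0.
have mW : measurable_fun setT W.
  apply: measurable_fun_esups => n; apply/measurable_EFinP.
  exact: measurableT_comp.
pose b t := fine (mine (W t) (v t)%:E).
have W_ge n t : (`|u n t|%:E <= W t)%E by apply: ereal_sup_ubound; exists n.
have W0 t : (0 <= W t)%E by apply: le_trans (W_ge 0%N t); rewrite lee_fin.
have bfin t : mine (W t) (v t)%:E \is a fin_num.
  have m0 : (0 <= mine (W t) (v t)%:E)%E by rewrite le_min W0 lee_fin v0.
  by rewrite ge0_fin_numE// gt_min ltry orbT.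
have bE t : (b t)%:E = mine (W t) (v t)%:E by rewrite /b fineK.
have b0 t : 0 <= b t by rewrite /b fine_ge0// le_min W0 lee_fin v0.
have bv t : b t <= v t by rewrite -lee_fin bE ge_min lexx orbT.
have mb : measurable_fun setT b.
  apply/measurable_EFinP; rewrite (_ : _ \o _ = fun t => mine (W t) (v t)%:E).
    by apply: measurable_mine => //; exact/measurable_EFinP.
  by apply/funext => t; exact: bE.
have ib : leb.-integrable setT (EFin \o b).
  apply: (le_integrable measurableT _ _ iv); first exact/measurable_EFinP.
  by move=> t _ /=; rewrite lee_fin !ger0_norm.
have ub : {ae leb, forall t, 0 <= t <= 1 -> forall n, `|u n t| <= b t}.
  apply: ae_unit_interval; apply: ae_mono u_le => t H t01 n.
  by rewrite -lee_fin bE le_min W_ge/= lee_fin H.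
have iS (f : R -> R) (D : set R) : measurable D -> leb.-integrable setT (EFin \o f) ->
  leb.-integrable D (EFin \o f) by move=> mD; exact: integrableS.
have mau k : measurable_fun setT (fun t => `|u k t|%:E).
  by apply/measurable_EFinP; exact: measurableT_comp.
have mbE : measurable_fun setT (fun t => (b t)%:E) by exact/measurable_EFinP.
have phi_b n (s t : I) : val s <= val t ->
    phi n t - phi n s <= \int[leb]_(r in `[val s, val t]) b r.
  move=> st; have [mw iw wE] := wP n.
  have iu : leb.-integrable setT (EFin \o u n).
    exact: (integrableB measurableT iw iv).
  have -> : phi n t - phi n s = \int[leb]_(r in `[val s, val t]) u n r.
    rewrite RintegralB//; try exact: iS.
    by rewrite -wE// -vE// /V; ring.
  apply: (le_trans (ler_norm _)); apply: le_trans (le_normr_Rintegral _ _) _ => //.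
    exact: iS.
  apply: fine_le.
  - by apply: integrable_fin_num => //; apply: (integrable_norm (iS _ _ _ iu)).
  - by apply: integrable_fin_num => //; exact: iS.
  - apply: ae_ge0_le_integral => //.
    + exact: (measurable_funTS (mau n)).
    + by move=> r _; rewrite lee_fin.
    + exact: (measurable_funTS mbE).
    + apply: ae_mono ub => r H; rewrite /= in_itv/= => /andP[sr rt]; rewrite lee_fin.
      have /andP[s0 _] := unit_intervalP s; have /andP[_ t1] := unit_intervalP t.
      by apply: H; rewrite (le_trans s0 sr) (le_trans rt t1).
pose B (t : I) := \int[leb]_(r in `[0, val t]) b r.
have BE (s t : I) : val s <= val t -> B t - B s = \int[leb]_(r in `[val s, val t]) b r.
  move=> st; rewrite /B Rintegral_itvB; last 3 first.
  - exact: iS.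
  - by rewrite bnd_simp; case/andP: (unit_intervalP s).
  - by rewrite bnd_simp.
  by apply: Rintegral_itv_obnd_cbnd; exact: iS.
(* For [x n] close to g(s), the increment of [phi n] from s to t almost equals the distance from
   g(s) to g(t). *)
have gB (s t : I) : val s <= val t -> mdist (g s) (g t) <= B t - B s.
  move=> st; rewrite BE//; apply/ler_addgt0Pr => e e0.
  have e2 : 0 < e / 2 by rewrite divr_gt0.
  have [n nx] := xd (g s) _ e2.
  have T := metric_triangle (g s) (x n) (g t).
  rewrite (metric_sym (g s) (x n)) in T; apply: (le_trans T).
  have P := phi_b n _ _ st; rewrite lerBlDr in P.
  apply: (le_trans (lerD (ltW nx) P)); rewrite addrCA lerD2l [leRHS]splitr lerD2l.
  exact: ltW.
(* Minimality of the variation gives that the integral of v is at most that of b, while b is at most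
   v pointwise. *)
have vb : {ae leb, forall t, 0 <= t <= 1 -> v t = b t}.
  have Vb := vfun_minimal acg gB (clamp_le ler01).
  rewrite BE ?clamp_le ?ler01// vE ?clamp_le ?ler01// !val_clamp ?lexx ?ler01// in Vb.
  have ivb : leb.-integrable `[0, 1] (EFin \o (fun t => v t - b t)).
    by apply: iS => //; exact: (integrableB measurableT iv ib).
  have m01 : measurable (`[0, 1]%classic : set (measurableTypeR R)) by exact: measurable_itv.
  have fvb : (\int[leb]_(t in `[0%R, 1%R]) (v t - b t)%:E)%E \is a fin_num.
    exact: (integrable_fin_num m01 ivb).
  have : (\int[leb]_(t in `[0%R, 1%R]) `|(v t - b t)%:E| = 0)%E.
    under eq_integral do rewrite gee0_abs ?lee_fin ?subr_ge0//.
    rewrite -[LHS]fineK//; congr EFin; apply/eqP; rewrite eq_le; apply/andP; split.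
      suff : \int[leb]_(t in `[0, 1]) (v t - b t) <= 0 by [].
      by rewrite RintegralB ?subr_le0//; exact: iS.
    by rewrite fine_ge0//; apply: integral_ge0 => t _; rewrite lee_fin subr_ge0.
  move/ae_eq_integral_abs => /(_ m01 (measurable_int _ ivb)).
  apply: ae_mono => t /= H t01; have := H; rewrite in_itv/= => /(_ t01) [] /eqP.
  by rewrite subr_eq0 => /eqP.
exists v; split => //.
apply: ae_mono (ae_and du vb) => t [Hd Hb] t01; have [Hv Hu] := Hd t01.
have vW : ((v t)%:E <= W t)%E.
  by rewrite Hb ?(ltW (andP t01).1) ?(ltW (andP t01).2)// bE ge_min lexx.
(* The difference quotient is squeezed: V bounds it from above, and from below a [phi n] with |u n|
   above v - e / 2 does. *)
apply/cvgrPdist_le => e e0; have e2 : 0 < e / 2 by rewrite divr_gt0.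
have /ereal_sup_gt[_ [n _ <-]] : ((v t - e / 2)%:E < W t)%E.
  by apply: lt_le_trans vW; rewrite lte_fin gtrBl.
rewrite lte_fin => un.
have [d d0 dP] := Hv _ e2; have [d' d'0 d'P] := Hu n _ e2.
rewrite near_withinE; apply/nbhs_ballP; exists (Num.min d d') => /=.
  by rewrite lt_min d0.
move=> s; rewrite /ball/= distrC lt_min => /andP[sd sd'] st.
have s0 : 0 < `|s - t| by rewrite normr_gt0 subr_eq0.
have [_ H1] := dP _ sd; have [_ H2] := d'P _ sd'.
have H3 := phi_lip n (clamp s) (clamp t); have H4 := mdist_V s t.
have H5 : `|V (clamp s) - V (clamp t)| <= e / 2 * `|s - t| + v t * `|s - t|.
  have -> : V (clamp s) - V (clamp t) = (V (clamp s) - V (clamp t) - v t * (s - t)) + v t * (s - t) by ring.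
  by rewrite (le_trans (ler_normD _ _))// (normrM (v t)) (ger0_norm (v0 t)) lerD2r.
have H6 : `|u n t| * `|s - t| <= e / 2 * `|s - t| + `|phi n (clamp s) - phi n (clamp t)|.
  rewrite -normrM.
  have -> : u n t * (s - t) = (phi n (clamp s) - phi n (clamp t)) -
      (phi n (clamp s) - phi n (clamp t) - u n t * (s - t)) by ring.
  by rewrite (le_trans (ler_normB _ _))// addrC lerD2r.
have H7 : (v t - e / 2) * `|s - t| <= `|u n t| * `|s - t|.
  by rewrite ler_pM2r// ltW.
rewrite ler_norml -(ler_pM2r s0) -[X in _ && X](ler_pM2r s0) mulrBl.
rewrite divfK ?gt_eqF//; rewrite mulrBl in H7.
have ee : e * `|s - t| = e / 2 * `|s - t| + e / 2 * `|s - t|.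
  by rewrite -mulrDl -splitr.
by rewrite mulNr ee; lra.
Qed.

End metric_speed.

(** [J_measure] and [energy] are not known to be measurable functions of the curve,
    hence integrals are compared here without measurability of one integrand. *)
Section integral_nonmeasurable.
Context d (T : measurableType d) (R : realType) (mu : {measure set T -> \bar R}).
Local Open Scope ereal_scope.
Implicit Types (D : set T) (f g : T -> \bar R).
Import HBNNSimple.

(** The integral of a nonnegative function is a supremum over the simple functions below it, a
    formula that is monotone for arbitrary functions. *)
Lemma ge0_le_integral_pointwise D f g : (forall x, D x -> 0 <= f x) ->
  (forall x, D x -> f x <= g x) ->
  \int[mu]_(x in D) f x <= \int[mu]_(x in D) g x.
Proof.
move=> f0 fg; have g0 x : D x -> 0 <= g x by move=> Dx; apply: le_trans (fg _ Dx); exact: f0.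
rewrite !ge0_integralE//; apply: le_ereal_sup => _ [h hf <-]; exists h => // x.
by apply: (le_trans (hf x)); rewrite /patch; case: ifPn => // /set_mem; exact: fg.
Qed.

(** The almost everywhere comparison is applied to each simple function below f, which is
    measurable. *)
Lemma ge0_integral_ae_ub D f g : measurable D -> (forall x, D x -> 0 <= f x) ->
  (forall x, D x -> 0 <= g x) -> measurable_fun D g ->
  {ae mu, forall x, D x -> f x <= g x} ->
  \int[mu]_(x in D) f x <= \int[mu]_(x in D) g x.
Proof.
move=> mD f0 g0 mg fg.
rewrite (ge0_integralE _ f0); apply: ge_ereal_sup => _ [h hf <-].
rewrite -integralT_nnsfun integral_mkcond [leRHS]integral_mkcond !patch_setT.
apply: ae_ge0_le_integral => //.
- by move=> x _; rewrite lee_fin.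
- exact/measurable_EFinP.
- by move=> x _; rewrite erestrict_ge0.
- exact/(measurable_restrictT _ _).1.
- apply: ae_mono fg => x H _; apply: (le_trans (hf x)).
  by rewrite /patch; case: ifPn => // /set_mem; exact: H.
Qed.

(** Setting f to 0 on the exceptional null set preserves its integral and makes the comparison with
    g hold everywhere on D. *)
Lemma ge0_integral_ae_lb D f g : measurable D -> (forall x, D x -> 0 <= f x) ->
  (forall x, D x -> 0 <= g x) -> measurable_fun D f ->
  {ae mu, forall x, D x -> f x <= g x} ->
  \int[mu]_(x in D) f x <= \int[mu]_(x in D) g x.
Proof.
move=> mD f0 g0 mf [N [mN N0 fgN]].
apply: (@le_trans _ _ (\int[mu]_(x in D) (f \_ (~` N)) x)).
  apply: ae_ge0_le_integral => //.
  - by move=> x Dx; rewrite /patch; case: ifPn => // _; exact: f0.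
  - by apply/measurable_restrict => //; [exact: measurableC|exact: measurable_funS mf].
  - exists N; split => // x /= /not_implyP[Dx]; apply: contra_notP => Nx.
    by rewrite patchE mem_set.
apply: ge0_le_integral_pointwise => x Dx; rewrite /patch; case: ifPn => [/set_mem Nx|_].
- exact: f0.
- exact: lexx.
- by apply: contrapT => H; apply: Nx; apply: fgN => /= /(_ Dx).
- exact: g0.
Qed.

Lemma ge0_integral_ae_eq D f g : measurable D -> (forall x, D x -> 0 <= f x) ->
  (forall x, D x -> 0 <= g x) -> measurable_fun D g ->
  {ae mu, forall x, D x -> f x = g x} ->
  \int[mu]_(x in D) f x = \int[mu]_(x in D) g x.
Proof.
move=> mD f0 g0 mg fg; apply/eqP; rewrite eq_le; apply/andP; split.
  by apply: ge0_integral_ae_ub => //; apply: ae_mono fg => x H /H ->.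
by apply: ge0_integral_ae_lb => //; apply: ae_mono fg => x H /H ->.
Qed.

End integral_nonmeasurable.

(** The proofs are arguments so that the measure structure can be attached to this term. *)
Definition density_measure d (T : measurableType d) (R : realType)
    (mu : {measure set T -> \bar R}) (f : T -> R)
    (mf : measurable_fun setT f) (f0 : forall x, 0 <= f x) (A : set T) : \bar R :=
  (\int[mu]_(x in A) (f x)%:E)%E.

Section density_measure.
Context d (T : measurableType d) (R : realType) (mu : {measure set T -> \bar R}).
Variables (f : T -> R) (mf : measurable_fun setT f) (f0 : forall x, 0 <= f x).
Local Open Scope ereal_scope.
Local Notation nu := (density_measure mu mf f0).

Let nu0 : nu set0 = 0. Proof. by rewrite /density_measure integral_set0. Qed.

Let mfE : measurable_fun setT (EFin \o f). Proof. exact/measurable_EFinP. Qed.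

Let nu_ge0 A : 0 <= nu A.
Proof. by apply: integral_ge0 => x _; rewrite lee_fin. Qed.

Let nu_sigma_additive : semi_sigma_additive nu.
Proof. by apply: semi_sigma_additive_nng_induced => // x; rewrite lee_fin. Qed.

HB.instance Definition _ := isMeasure.Build _ _ _ nu nu0 nu_ge0 nu_sigma_additive.

Import HBNNSimple.

Lemma ge0_integral_density (g : T -> \bar R) : measurable_fun setT g ->
  (forall x, 0 <= g x) -> \int[nu]_x g x = \int[mu]_x (g x * (f x)%:E).
Proof.
move=> mg g0.
have nnE (h : {nnsfun T >-> R}) : \int[nu]_x (h x)%:E = \int[mu]_x ((h x)%:E * (f x)%:E).
  rewrite integralT_nnsfun sintegralE.
  transitivity (\sum_(r \in range h) \int[mu]_x ((r * \1_(h @^-1` [set r]) x)%:E * (f x)%:E)).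
    apply: eq_fsbigr => r /set_mem [t _ htr].
    have r0 : (0 <= r)%R by rewrite -htr.
    under eq_integral do rewrite EFinM -muleA.
    rewrite ge0_integralZl//; last 2 first.
      by apply: emeasurable_funM => //; exact/measurable_EFinP.
      by move=> x _; rewrite mule_ge0// lee_fin.
    congr (_ * _).
    transitivity (\int[mu]_(x in h @^-1` [set r]) (f x)%:E) => //.
    rewrite [LHS]integral_mkcond.
    by apply: eq_integral => x _; rewrite epatch_indic muleC.
  rewrite -ge0_integral_fsum//; last 2 first.
  - move=> r; apply: emeasurable_funM => //; apply/measurable_EFinP.
    exact: measurable_funM.
  - by move=> r x _; rewrite EFinM mule_ge0 ?nnfun_muleindic_ge0 ?lee_fin.
  apply: eq_integral => x _.
  rewrite [in RHS](fimfunE h x) -fsumEFin// ge0_mule_fsuml//.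
  by move=> r; exact: nnfun_muleindic_ge0.
pose h := nnsfun_approx measurableT mg.
have hg x : (h n x)%:E @[n --> \oo] --> g x by apply: cvg_nnsfun_approx.
have -> : \int[nu]_x g x = limn (fun n => \int[nu]_x (h n x)%:E).
  rewrite -monotone_convergence//.
  - by apply: eq_integral => x _; apply/esym/cvg_lim.
  - by move=> n; exact/measurable_EFinP.
  - by move=> n x _; rewrite lee_fin.
  - by move=> x _ m n mn; rewrite lee_fin; exact/lefP/nd_nnsfun_approx.
under eq_fun do rewrite nnE.
rewrite -monotone_convergence//.
- apply: eq_integral => x _; apply/cvg_lim => //.
  exact: cvgeZr.
- move=> n; apply: emeasurable_funM => //; exact/measurable_EFinP.
- by move=> n x _; rewrite mule_ge0// lee_fin.
- move=> x _ m n mn; apply: lee_wpmul2r; first by rewrite lee_fin.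
  by rewrite lee_fin; exact/lefP/nd_nnsfun_approx.
Qed.

End density_measure.

(** * A measurable version of the metric derivative *)

Section speed.
Context (R : realType) (X : completeMetricType R).
Local Notation leb := (@lebesgue_measure R).
Local Notation I := (unit_interval R).
Implicit Types (g : curve X) (t : R).

(** Jointly measurable in g and t, and a.e. equal to [metric_derivative]. *)
Definition speed g t : \bar R := limn_esup (fun n =>
  (n.+1%:R * mdist (cpath g (t + n.+1%:R^-1)) (cpath g t))%:E).

Lemma speed_ge0 g t : (0 <= speed g t)%E.
Proof.
rewrite /speed limn_esup_lim; apply: lime_ge; first exact: is_cvg_esups.
apply: nearW => n; apply: le_trans (ereal_sup_ubound _); last first.
  by exists n => //=; exact: leqnn.
by rewrite lee_fin mulr_ge0// mdist_ge0.
Qed.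

(** The distance from f to h is the infimum over n of the sums of their distances to [x n]. *)
Lemma measurable_mdist2 d (T : measurableType d) (f h : T -> borel X) :
  separable_space X -> measurable_fun setT f -> measurable_fun setT h ->
  measurable_fun setT (fun w => mdist (f w : X) (h w)).
Proof.
move=> /separable_dense_seq[x xd] mf mh.
apply: (@measurability _ _ T R setT _ _
  (measurable_realfun.RGenInftyO.measurableE R)) => _ [_ [r ->] <-].
rewrite setTI (_ : _ @^-1` _ = \bigcup_n [set w | mdist (x n) (f w : X) + mdist (x n) (h w : X) < r]).
  apply: bigcupT_measurable => n.
  have := measurable_funD (measurable_metric_comp (x n) mf) (measurable_metric_comp (x n) mh)
    measurableT (measurable_itv `]-oo, r[).
  by rewrite setTI; congr measurable; apply/seteqP; split => w; rewrite /= in_itv.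
apply/seteqP; split => w /=; rewrite in_itv/=; last first.
  move=> [n _ /=]; apply: le_lt_trans; rewrite (metric_sym (x n) (f w)).
  exact: metric_triangle.
move=> fhr; have e0 : 0 < (r - mdist (f w : X) (h w)) / 2 by rewrite divr_gt0// subr_gt0.
have [n nx] := xd (f w) _ e0; exists n => //=.
have := metric_triangle (x n) (f w) (h w); move: nx.
move: (mdist (x n) (f w)) (mdist (x n) (h w)) (mdist (f w : X) (h w)) fhr => a b c; lra.
Qed.

Lemma measurable_speed : separable_space X ->
  measurable_fun setT (fun p : borel (curve X) * R => speed (p.1 : curve X) p.2).
Proof.
move=> sX; apply: measurable_fun_limn_esup => n; apply/measurable_EFinP.
apply: measurable_funM => //; apply: measurable_mdist2 => //; last exact: measurable_eval.
apply: (measurableT_comp (measurable_eval sX)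
  (g := fun p : borel (curve X) * R => (p.1, p.2 + n.+1%:R^-1))).
apply/measurable_fun_pairP; split => //=.
  exact: measurable_fst.
apply: measurable_funD => //; exact: measurable_snd.
Qed.

Lemma vfun_clamp0 g : vfun g (clamp 0) = 0.
Proof.
apply/eqP; rewrite eq_le; apply/andP; split; last by rewrite fine_ge0// mvariation_ge0.
have H : (mvariation g (clamp 0) (clamp 0) <= 0%:E)%E.
  apply: ge_ereal_sup => _ [s /= /andP[sS sin] <-]; rewrite lee_fin.
  rewrite /vsum big_seq big1// => i js.
  have /andP[/allP/(_ _ js) ile _] := sS; have /andP[i1 i2] := allP sin _ js.
  have -> : i.1 = i.2; last exact: mdistxx.
  apply/val_inj/eqP; rewrite eq_le ile/=.
  exact: le_trans i2 i1.
rewrite /vfun; move: (mvariation_ge0 g (clamp 0) (clamp 0)) H.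
by case: mvariation => //= r; rewrite !lee_fin.
Qed.

Lemma metric_derivative_density g : separable_space X -> abs_cont g ->
  exists v, [/\ density (vfun g) v, forall t, 0 <= v t &
  {ae leb, forall t, 0 <= t <= 1 ->
    metric_derivative g t = v t /\ speed g t = (v t)%:E}].
Proof.
move=> sX acg; have [v [vV v0 vE]] := vfun_density sX acg.
exists v; split => //; apply: ae_unit_interval; apply: ae_mono vE => t H t01.
have {}H := H t01; split; first exact/cvg_lim.
(* The sequence avoids t, so it follows the punctured neighbourhoods along which the metric
   derivative is a limit. *)
have sq : (t + n.+1%:R^-1)%R @[n --> \oo] --> t^'.
  move=> A /nbhs_ballP[d /= d0 dA].
  suff : \forall n \near \oo, A (t + n.+1%:R^-1) by [].
  near=> n; apply: dA; last by rewrite addrC -subr_eq0 addrK gt_eqF.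
  rewrite /ball/= opprD addNKr normrN gtr0_norm ?invr_gt0//.
  by near: n; exact: (near_infty_natSinv_lt (PosNum d0)).
have uv : (n.+1%:R * mdist (cpath g (t + n.+1%:R^-1)) (cpath g t))%:E @[n --> \oo]
    --> (v t)%:E.
  apply: cvg_EFin; first exact: nearW.
  have := cvg_comp _ _ sq H; apply: cvg_trans; apply: near_eq_cvg; apply: nearW => n /=.
  by rewrite (addrC t) addrK gtr0_norm ?invr_gt0// invrK mulrC.
rewrite /speed is_cvg_limn_esupE; last by apply/cvg_ex; exists (v t)%:E.
exact/cvg_lim.
Unshelve. all: by end_near. Qed.

Lemma metric_derivative_ge0 g t : 0 <= metric_derivative g t.
Proof.
rewrite /metric_derivative; set f := fun s => _.
have [cf|ncf] := pselect (cvg (f s @[s --> t^'])).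
  by apply: limr_ge => //; apply: nearW => s; rewrite divr_ge0// mdist_ge0.
(* Where the limit fails to exist, [lim] returns [point], which is 0 in [R]. *)
by rewrite dvgP.
Qed.

Section AC_integrals.
Variables (g : curve X).
Hypotheses (sX : separable_space X) (acg : abs_cont g).

Let V := vfun g.

Lemma speed_metric_derivative :
  {ae leb, forall t, 0 <= t <= 1 -> (metric_derivative g t)%:E = speed g t}.
Proof.
have [v [_ v0 vE]] := metric_derivative_density sX acg.
by apply: ae_mono vE => t H /H[-> ->].
Qed.

(** The two-argument [h] covers both the q-th power of the speed and the speed times an indicator
    along the curve. *)
Lemma integral_metric_derivative (h : R -> \bar R -> \bar R) :
  (forall t x, (0 <= x -> 0 <= h t x)%E) ->
  measurable_fun setT (fun t => h t (speed g t)) ->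
  (\int[leb]_(t in `[0%R, 1%R]) h t (metric_derivative g t)%:E =
   \int[leb]_(t in `[0%R, 1%R]) h t (speed g t))%E.
Proof.
move=> h0 mh; apply: ge0_integral_ae_eq.
- exact: measurable_itv.
- by move=> t _; apply: h0; rewrite lee_fin metric_derivative_ge0.
- by move=> t _; apply: h0; exact: speed_ge0.
- exact: measurable_funTS.
- apply: ae_mono speed_metric_derivative => t H.
  by rewrite /= in_itv/= => /H ->.
Qed.

Lemma arc_lengthE (t : I) :
  (\int[leb]_(r in `[0%R, val t]) (metric_derivative g r)%:E)%E = (V t)%:E.
Proof.
have [v [[mv iv vE] v0 aev]] := metric_derivative_density sX acg.
have /andP[t0 t1] := unit_intervalP t.
transitivity (\int[leb]_(r in `[0%R, val t]) (v r)%:E)%E.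
  apply: ge0_integral_ae_eq.
  - exact: measurable_itv.
  - by move=> r _; rewrite lee_fin metric_derivative_ge0.
  - by move=> r _; rewrite lee_fin.
  - by apply: measurable_funTS; exact/measurable_EFinP.
  - apply: ae_mono aev => r H; rewrite /= in_itv/= => /andP[r0 rt].
    by have [-> _] := H (ltac:(by rewrite r0 (le_trans rt t1))).
have := vE (clamp 0) t; rewrite val_clamp ?lexx ?ler01// vfun_clamp0 subr0 -/V.
move=> /(_ t0) ->; rewrite /Rintegral fineK//.
by apply: integrable_fin_num => //; exact: (integrableS measurableT).
Qed.

Lemma curve_lengthE : curve_length g = (V (clamp 1))%:E.
Proof. by rewrite -arc_lengthE val_clamp ?lexx ?ler01. Qed.

Lemma normalized_arc_lengthE (t : I) :
  normalized_arc_length g (val t) = V t / V (clamp 1).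
Proof. by rewrite /normalized_arc_length curve_lengthE arc_lengthE. Qed.

End AC_integrals.

Lemma measurable_speed_curve g : separable_space X -> measurable_fun setT (speed g).
Proof.
by move=> sX; exact: (measurable_fun_pair2 (g : borel (curve X)) (measurable_speed sX)).
Qed.

Lemma measurable_cpath g : separable_space X ->
  measurable_fun setT (cpath g : R -> borel X).
Proof.
by move=> sX; exact: (measurable_fun_pair2 (g : borel (curve X)) (measurable_eval sX)).
Qed.

Lemma J_measureE g (B : set (borel X)) : separable_space X -> abs_cont g -> measurable B ->
  J_measure g B = (\int[leb]_(t in `[0%R, 1%R]) ((\1_B (cpath g t))%:E * speed g t))%E.
Proof.
move=> sX acg mB.
rewrite -(integral_metric_derivative sX acg (h := fun t x => ((\1_B (cpath g t))%:E * x)%E)).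
- by apply: eq_integral => t _; rewrite EFinM.
- by move=> t x x0; rewrite mule_ge0// lee_fin.
- apply: emeasurable_funM; last exact: measurable_speed_curve.
  apply/measurable_EFinP; apply: (measurableT_comp (measurable_indic mB)).
  exact: measurable_cpath.
Qed.

Lemma power_integralE q g : separable_space X -> abs_cont g ->
  power_integral q g = (\int[leb]_(t in `[0%R, 1%R]) (speed g t `^ q))%E.
Proof.
move=> sX acg.
rewrite -(integral_metric_derivative sX acg (h := fun t x => (x `^ q)%E)).
- by apply: eq_integral => t _; rewrite poweR_EFin.
- by move=> t x x0; exact: poweR_ge0.
- apply: (measurableT_comp (measurable_poweR q)); exact: measurable_speed_curve.
Qed.

End speed.

Definition push_measure d1 d2 (T1 : measurableType d1) (T2 : measurableType d2)
    (R : realType) (mu : {measure set T1 -> \bar R}) (f : T1 -> T2)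
    (mf : measurable_fun setT f) (B : set T2) : \bar R := mu (f @^-1` B).

Section push_measure.
Context d1 d2 (T1 : measurableType d1) (T2 : measurableType d2) (R : realType).
Variables (mu : {measure set T1 -> \bar R}) (f : T1 -> T2) (mf : measurable_fun setT f).
Local Open Scope ereal_scope.
Local Notation nu := (push_measure mu mf).

Let nu0 : nu set0 = 0. Proof. by rewrite /push_measure preimage_set0 measure0. Qed.

Let nu_ge0 A : 0 <= nu A. Proof. exact: measure_ge0. Qed.

Let nu_sigma_additive : semi_sigma_additive nu.
Proof.
move=> F mF tF mUF; rewrite /push_measure preimage_bigcup.
have mfF A : measurable A -> measurable (f @^-1` A).
  by move=> mA; rewrite -[X in measurable X]setTI; exact: mf.
apply: measure_semi_sigma_additive.
- by move=> n; exact: mfF.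
- apply/trivIsetP => /= i j _ _ ij; rewrite -preimage_setI.
  by move/trivIsetP : tF => /(_ _ _ _ _ ij) ->//; rewrite preimage_set0.
- by rewrite -preimage_bigcup; exact: mfF.
Qed.

HB.instance Definition _ := isMeasure.Build _ _ _ nu nu0 nu_ge0 nu_sigma_additive.

Lemma ge0_integral_push (h : T2 -> \bar R) : measurable_fun setT h ->
  (forall x, 0 <= h x) -> \int[nu]_x h x = \int[mu]_x h (f x).
Proof.
move=> mh h0; have := @ge0_integral_pushforward _ _ _ _ R f mf mu setT h measurableT mh.
move=> H; rewrite -[RHS]H//.
Qed.

End push_measure.

(** * Change of variables and inverses of absolutely continuous functions *)

Section absolutely_continuous_density.
Context (R : realType).
Local Notation I := (unit_interval R).
Local Notation leb := (@lebesgue_measure R).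
Implicit Types (f : I -> R) (v : R -> R).

Lemma measure_ocitvs (mu : {measure set (measurableTypeR R) -> \bar R}) (s : seq (I * I)) :
  subintervals s ->
  mu (ocitvs s) = (\sum_(i <- s) mu `]val i.1, val i.2]%classic)%E.
Proof.
elim: s => [_|i s IH]; first by rewrite ocitvs_nil measure0 big_nil.
rewrite subintervalsE/= => /andP[/andP[ile sle] /andP[/allP isep spw]].
rewrite ocitvs_cons measureU//; last 2 first.
- exact: measurable_ocitvs.
- apply/seteqP; split => // x [] /=; rewrite in_itv/= => /andP[ix xi] /hasP[j js].
  move=> /andP[jx xj]; have /orP[H|H] := isep _ js.
    by have := le_lt_trans xi (le_lt_trans H jx); rewrite ltxx.
  by have := le_lt_trans xj (le_lt_trans H ix); rewrite ltxx.
have /IH E1 : subintervals s by rewrite subintervalsE sle.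
by rewrite big_cons -E1.
Qed.

Lemma density_abs_cont f v : density f v -> abs_cont (f : I -> R^o).
Proof.
move=> [mv iv fv] e e0; have [d [d0 dP]] := integral_normr_continuous iv e0.
exists d => // s sS sd.
have mnv : measurable_fun setT (fun t => `|v t|) by exact: measurableT_comp.
pose nu := density_measure leb mnv (fun t => normr_ge0 (v t)).
have inv (A : set (measurableTypeR R)) : measurable A ->
    leb.-integrable A (EFin \o (fun t => `|v t|)).
  move=> mA; apply: (integrableS measurableT) => //.
  exact: (integrable_norm iv).
have lebs : (leb (ocitvs s) < d%:E)%E by rewrite ocitvs_lebesgue.
have := dP _ (measurable_ocitvs s) lebs.
apply: le_lt_trans; rewrite -lee_fin /Rintegral fineK; last first.
  by apply: integrable_fin_num; [exact: measurable_ocitvs|exact: inv (measurable_ocitvs s)].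
have -> : (\int[leb]_(x in ocitvs s) `|v x|%:E =
    \sum_(i <- s) \int[leb]_(x in `]val i.1, val i.2]) `|v x|%:E)%E.
  exact: (measure_ocitvs nu).
rewrite -sumEFin big_seq [leRHS]big_seq.
apply: lee_sum => i js.
have ile : val i.1 <= val i.2 by case/andP: sS => /allP/(_ _ js).
rewrite /mdist/= fv// -Rintegral_itv_obnd_cbnd; last exact: (integrableS measurableT).
apply: (@le_trans _ _ (\int[leb]_(t in `]val i.1, val i.2]) `|v t|)%:E).
  by rewrite lee_fin le_normr_Rintegral//; exact: (integrableS measurableT).
by rewrite /Rintegral fineK//; apply: integrable_fin_num => //; exact: inv.
Qed.

Lemma density_itv f v (a b : I) : density f v -> val a <= val b ->
  (\int[leb]_(t in `]val a, val b]) (v t)%:E = (f b - f a)%:E)%E.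
Proof.
move=> [_ iv fv] ab; rewrite fv//.
rewrite -Rintegral_itv_obnd_cbnd; last exact: (integrableS measurableT).
rewrite /Rintegral fineK//; apply: integrable_fin_num => //; exact: (integrableS measurableT).
Qed.

Lemma lebesgue_itvcc (a b : R) : a <= b -> leb (`[a, b]%classic : set R) = (b - a)%:E.
Proof.
move=> ab; transitivity (lebesgue_measure (`[a, b]%classic : set R)) => //.
rewrite lebesgue_measure_itv/= lte_fin; case: ltP => // ba.
by rewrite (_ : b = a) ?subrr//; apply/eqP; rewrite eq_le ba.
Qed.

Lemma measure_unique_ray (mu nu : {measure set (measurableTypeR R) -> \bar R}) :
  (forall r : R, mu `]r, +oo[%classic = nu `]r, +oo[%classic) ->
  (mu setT < +oo)%E ->
  forall A, measurable A -> mu A = nu A.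
Proof.
move=> munu fin A mA.
apply: (measure_unique (T := measurableTypeR R) (@measurable_realfun.RGenOInfty.G R) (fun n => `](- n%:R)%R, +oo[%classic) (measurable_realfun.RGenOInfty.measurableE R)) => //.
- move=> _ _ [x ->] [y ->]; exists (Num.max x y).
  by apply/seteqP; split => z /=; rewrite !in_itv/= !andbT gt_max; [case=> -> -> | move/andP].
- by move=> n; exists (- n%:R).
- apply/seteqP; split => // x _; exists (Num.bound `|x|) => //=.
  by rewrite in_itv/= andbT; have := archi_boundP (normr_ge0 x); rewrite ltr_norml => /andP[].
- by move=> _ [x ->]; exact: munu.
- move=> n; apply: le_lt_trans fin; apply: le_measure; rewrite ?inE//.
Qed.

End absolutely_continuous_density.

Section change_of_variables.
Context (R : realType).
Local Notation I := (unit_interval R).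
Local Notation leb := (@lebesgue_measure R).
Variables (s : I -> I) (v : R -> R).
Hypotheses (sv : density (val \o s) v) (v0 : forall t, 0 <= v t).
Hypotheses (s0 : s (clamp 0) = clamp 0) (s1 : s (clamp 1) = clamp 1).

Lemma density_nondecreasing r t : val r <= val t -> val (s r) <= val (s t).
Proof.
move=> rt; rewrite -subr_ge0; have [_ _ ->//] := sv.
by apply: Rintegral_ge0 => x _; exact: v0.
Qed.

Let S (t : R) : R := val (s (clamp t)).

Lemma density_continuous : continuous S.
Proof. exact: (abs_cont_continuous (density_abs_cont sv)). Qed.

Lemma density_surjective (u : I) : exists t, s t = u.
Proof.
have /andP[u0 u1] := unit_intervalP u.
have [] := @IVT R S 0 1 (val u) ler01.
- exact/continuous_subspaceT/density_continuous.
- rewrite /S s0 s1 !val_clamp ?lexx ?ler01// (min_idPl ler01) (max_idPr ler01).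
  by rewrite u0.
- by move=> t _ tu; exists (clamp t); exact: val_inj.
Qed.

(** s may be flat on intervals. With the last preimage t of u, the set where s exceeds u is exactly
    ]t, 1]. *)
Lemma density_last (u : I) : exists2 t, s t = u & forall r, val (s r) <= val u -> val r <= val t.
Proof.
have [t0 t0u] := density_surjective u.
pose A := [set t : R | 0 <= t <= 1 /\ S t <= val u].
have cA : compact A.
  apply: (@subclosed_compact _ A `[0, 1]%classic) => //.
  - rewrite (_ : A = `[0, 1]%classic `&` S @^-1` [set x | x <= val u]).
      apply: closedI; first exact: interval_closed.
      by apply: closed_comp; [move=> x _; exact: density_continuous|exact: closed_le].
    by apply/seteqP; split => x; rewrite /A/= in_itv.
  - exact: segment_compact.
  - by move=> x [+ _]; rewrite /= in_itv.
have At0 : A (val t0) by split; [exact: unit_intervalP|rewrite /S clamp_val t0u].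
have [|c /set_mem[c01 cu] cmax] := @compact_EVT_max _ R id A (ex_intro _ _ At0) cA.
  by apply: continuous_subspaceT => ?; exact: cvg_id.
exists (clamp c).
  apply/val_inj/eqP; rewrite eq_le -/(S c) cu/= -t0u; apply: density_nondecreasing.
  by rewrite val_clamp//; apply: cmax; exact/mem_set.
move=> r ru; rewrite val_clamp//; apply: cmax; apply/mem_set; split.
  exact: unit_intervalP.
by rewrite /S clamp_val.
Qed.

Let vI (t : R) : R := v t * \1_(`[0, 1]%classic : set R) t.

Let mvI : measurable_fun setT vI.
Proof. by apply: measurable_funM => //; have [] := sv. Qed.

Let vI0 t : 0 <= vI t. Proof. by rewrite mulr_ge0. Qed.

Let oI (t : R) : R := \1_(`[0, 1]%classic : set R) t.

Let moI : measurable_fun setT oI. Proof. apply: measurable_indic; exact: measurable_itv. Qed.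

Let oI0 t : 0 <= oI t. Proof. by []. Qed.

Let mS : measurable_fun setT S.
Proof. by apply: continuous_measurable_fun; exact: density_continuous. Qed.

Local Open Scope ereal_scope.

Let integral_vI (A : set R) : \int[leb]_(t in A) (vI t)%:E = \int[leb]_(t in A `&` `[0%R, 1%R]) (v t)%:E.
Proof.
by rewrite integral_mkcondr; apply: eq_integral => t _; rewrite epatch_indic EFinM.
Qed.

Let S01 t : (0 <= S t <= 1)%R. Proof. exact: unit_intervalP. Qed.

Let val0 : val (clamp 0 : I) = 0%R. Proof. by rewrite val_clamp// lexx ler01. Qed.
Let val1 : val (clamp 1 : I) = 1%R. Proof. by rewrite val_clamp// lexx ler01. Qed.

Let clamp_neg (r : R) : (r < 0)%R -> (clamp r : I) = clamp 0.
Proof.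
move=> r0; apply: val_inj => /=.
by rewrite (min_l (ltW (lt_trans r0 ltr01))) (max_l (ltW r0)) min_l ?ler01// maxxx.
Qed.

Let interval_mass (r : R) : \int[leb]_(t in `]r, +oo[) (oI t)%:E = (1 - val (clamp r : I))%:E.
Proof.
rewrite integral_indic//; have [r0|r0] := ltP r 0%R.
  rewrite clamp_neg// (_ : _ `&` _ = `[0%R, 1%R]%classic) ?val0 ?subr0.
    transitivity (lebesgue_measure (`[0%R, 1%R]%classic : set R)) => //.
    by rewrite lebesgue_measure_itv/= lte_fin ltr01 sube0.
  apply/seteqP; split => x; rewrite /= !in_itv/= ?andbT; first by case.
  by move=> /andP[x0 x1]; rewrite x0 x1 (lt_le_trans r0).
have cr : val (clamp r : I) = Num.min r 1%R by rewrite /= max_r// le_min r0 ler01.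
rewrite cr (_ : _ `&` _ = `](Num.min r 1)%R, 1%R]%classic).
  transitivity (lebesgue_measure (`](Num.min r 1)%R, 1%R]%classic : set R)) => //.
  rewrite lebesgue_measure_itv/= lte_fin -EFinB; case: ltP => //.
  by rewrite le_min lexx andbT => r1; rewrite min_r// subrr.
apply/seteqP; split => x; rewrite /= !in_itv/= ?andbT gt_min.
  by move=> [/andP[_ ->] ->].
move=> /andP[/orP[rx|]]; last by move=> /lt_le_trans h /h; rewrite ltxx.
by move=> ->; rewrite (ltW (le_lt_trans r0 rx)) rx.
Qed.

Let reparam_mass (r : R) : \int[leb]_(t in S @^-1` `]r, +oo[) (vI t)%:E = (1 - val (clamp r : I))%:E.
Proof.
rewrite integral_vI.
have [t tr tlast] := density_last (clamp r).
have [r0|r0] := ltP r 0%R.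
  rewrite (_ : _ `&` _ = `[val (clamp 0 : I), val (clamp 1 : I)]%classic).
    have [mv _ _] := sv; rewrite -integral_itv_obnd_cbnd; last first.
      exact/measurable_EFinP/measurable_funTS.
    by rewrite (density_itv sv) -1?[(val \o s) _]/(val (s _)) -1?[(val \o s) _]/(val (s _)) ?s0 ?s1 ?val0 ?val1 ?ler01// clamp_neg// val0.
  rewrite val0 val1; apply/seteqP; split => x; rewrite /= !in_itv/= ?andbT; first by case.
  by split=> //; apply: lt_le_trans r0 _; case/andP: (S01 x).
have cr : val (clamp r : I) = Num.min r 1%R by rewrite /= max_r// le_min r0 ler01.
rewrite (_ : _ `&` _ = `]val t, val (clamp 1 : I)]%classic).
  by rewrite (density_itv sv) -1?[(val \o s) _]/(val (s _)) -1?[(val \o s) _]/(val (s _)) ?tr ?s1 ?val1//; case/andP: (unit_intervalP t).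
have /andP[t0 _] := unit_intervalP t.
rewrite val1; apply/seteqP; split => x; rewrite /= !in_itv/= !andbT.
  move=> [rx /andP[x0 x1]]; rewrite x1 andbT ltNge; apply/negP => xt.
  have := density_nondecreasing (r := clamp x) (t := t); rewrite val_clamp ?x0// => /(_ xt).
  rewrite tr cr -/(S x) le_min => /andP[+ _]; by rewrite leNgt rx.
move=> /andP[tx x1]; have x0 := ltW (le_lt_trans t0 tx); rewrite x0 x1; split => //.
rewrite ltNge; apply/negP => xr; have := tlast (clamp x).
rewrite cr -/(S x) le_min xr; case/andP: (S01 x) => _ -> /(_ isT).
by rewrite val_clamp ?x0// leNgt tx.
Qed.

(** The image of v dt under s and Lebesgue measure on [0, 1] are finite and agree on open rays: both
    give the ray above r the mass 1 - [clamp r]. Flat pieces of s do no harm. *)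
Lemma integral_change_of_variables (h : R -> \bar R) : measurable_fun setT h ->
  (forall t, 0 <= h t) ->
  \int[leb]_(t in `[0%R, 1%R]) (h (val (s (clamp t))) * (v t)%:E) =
  \int[leb]_(u in `[0%R, 1%R]) h u.
Proof.
move=> mh h0.
pose mu1 := push_measure (T2 := measurableTypeR R) (density_measure leb mvI vI0) mS.
transitivity (\int[mu1]_x h x).
  rewrite ge0_integral_push// ge0_integral_density//; last exact: (measurableT_comp mh mS).
  rewrite [LHS]integral_mkcond; apply: eq_integral => t _ /=.
  by rewrite epatch_indic /vI EFinM muleA.
transitivity (\int[density_measure leb moI oI0]_x h x).
  apply: (eq_measure_integral (density_measure leb moI oI0) (D := setT)) => A mA _; apply: (measure_unique_ray (mu := mu1) (nu := density_measure leb moI oI0)) => //.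
    by move=> r; exact: (etrans (reparam_mass r) (esym (interval_mass r))).
  apply: (@le_lt_trans _ _ 1%E); last by rewrite ltry.
  have <- : \int[leb]_(t in S @^-1` `](-1)%R, +oo[) (vI t)%:E = 1%E.
    by rewrite reparam_mass clamp_neg ?ltrN10// val0 subr0.
  rewrite /mu1/= /push_measure/= /density_measure preimage_setT (_ : S @^-1` _ = setT)//.
  apply/seteqP; split => // x _ /=; rewrite in_itv/= andbT.
  by case/andP: (S01 x) => + _; apply: lt_le_trans; rewrite ltrN10.
rewrite ge0_integral_density// [RHS]integral_mkcond.
by apply: eq_integral => t _; rewrite epatch_indic.
Qed.

End change_of_variables.

Section density_unique.
Context (R : realType).
Local Notation I := (unit_interval R).
Local Notation leb := (@lebesgue_measure R).

Lemma density_unique (f : I -> R) (v w : R -> R) : density f v -> density f w ->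
  {ae leb, forall t, 0 <= t <= 1 -> v t = w t}.
Proof.
move=> fv fw; apply: ae_unit_interval.
apply: ae_mono (ae_and (density_derivative fv) (density_derivative fw)) => t [Dv Dw] t01.
apply/eqP; rewrite -subr_eq0 -normr_eq0 -[_ == 0]negbK; apply/negP => vw.
(* Two errors of a quarter would give |v - w| <= |v - w| / 2, which is absurd when v and w differ at
   t. *)
pose e := `|v t - w t| / 4; have vw0 : 0 < `|v t - w t| by rewrite lt_neqAle eq_sym vw normr_ge0.
have e0 : 0 < e by rewrite divr_gt0.
have [d1 d10 D1] := Dv t01 _ e0; have [d2 d20 D2] := Dw t01 _ e0.
pose r := Num.min d1 d2 / 2; have r0 : 0 < r by rewrite divr_gt0// lt_min d10.
have rd : r < Num.min d1 d2 by rewrite gtr_pMr ?invf_lt1 ?ltr1n// lt_min d10.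
have sr : t + r - t = r by rewrite addrC addKr.
have /andP[rd1 rd2] : (r < d1) && (r < d2) by rewrite -lt_min.
have [] := D1 (t + r); first by rewrite sr gtr0_norm.
have [] := D2 (t + r); first by rewrite sr gtr0_norm.
rewrite sr (gtr0_norm r0); set z := f _ - f _ => _ H2 _ H1.
have : `|v t - w t| * r <= 2 * e * r.
  rewrite -[X in _ * X](gtr0_norm r0) -normrM.
  have -> : (v t - w t) * r = (z - w t * r) - (z - v t * r) by ring.
  by rewrite (le_trans (ler_normB _ _))// mulrDl mul1r mulrDl lerD.
rewrite ler_pM2r// /e; move: vw0; move: (`|_|) => y y0 H; lra.
Qed.

End density_unique.

Section inverse.
Context (R : realType).
Local Notation I := (unit_interval R).
Local Notation leb := (@lebesgue_measure R).
Variables (s : I -> I) (v : R -> R).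
Hypotheses (sv : density (val \o s) v) (v0 : forall t, 0 <= v t).
Hypotheses (s0 : s (clamp 0) = clamp 0) (s1 : s (clamp 1) = clamp 1).
Hypothesis vpos : {ae leb, forall t, 0 <= t <= 1 -> 0 < v t}.

(** Equal values of s at a < b would make the integral of v over [a, b] vanish, against positivity
    almost everywhere. *)
Lemma density_increasing : {homo s : a b / val a < val b}.
Proof.
move=> a b ab; have [mv iv fv] := sv.
rewrite lt_neqAle (density_nondecreasing sv v0 (ltW ab)) andbT; apply/negP => /eqP sab.
have v_int0 : (\int[leb]_(t in `[val a, val b]) `|(v t)%:E| = 0)%E.
  have := fv a b (ltW ab); rewrite /= sab subrr => /esym.
  rewrite /Rintegral => H; rewrite -[RHS]/(0%:E) -[in RHS]H fineK.
    by apply: eq_integral => t _; rewrite /= ger0_norm.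
  by apply: integrable_fin_num => //; exact: (integrableS measurableT).
have mvE : measurable_fun `[val a, val b] (EFin \o v).
  exact/measurable_EFinP/measurable_funTS.
have mab : measurable (`[val a, val b]%classic : set (measurableTypeR R)) by exact: measurable_itv.
have [/(_ v_int0) v_ae _] := ae_eq_integral_abs leb mab mvE.
have ne : {ae leb, forall t, ~ (val a <= t <= val b)}.
  apply: ae_mono (ae_and vpos v_ae) => t [vt va] tab.
  have t01 : 0 <= t <= 1.
    have /andP[a0 _] := unit_intervalP a; have /andP[_ b1] := unit_intervalP b.
    by case/andP: tab => /(le_trans a0) -> /le_trans ->.
  have [] : (v t)%:E = 0%:E by apply: va; rewrite /= in_itv.
  by move=> E; have := vt t01; rewrite E ltxx.
have : leb (`[val a, val b]%classic : set R) = 0%E.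
  apply/negligibleP; first exact: measurable_itv.
  by apply: negligibleS ne => t /=; rewrite in_itv/= => ? /(_ _).
rewrite lebesgue_itvcc ?ltW//.
by move=> [E]; move: ab; rewrite -subr_gt0 E ltxx.
Qed.

Lemma density_small_set e : 0 < e ->
  exists n : nat, (leb (`[0%R, 1%R] `&` [set t | (v t <= n.+1%:R^-1)%R]) < e%:E)%E.
Proof.
move=> e0; have [mv _ _] := sv.
pose B n := (`[0%R, 1%R]%classic : set R) `&` [set t | (v t <= n.+1%:R^-1)%R].
have mB n : measurable (B n : set (measurableTypeR R)).
  apply: measurableI; first exact: measurable_itv.
  have -> : [set t | v t <= n.+1%:R^-1] = v @^-1` `]-oo, n.+1%:R^-1]%classic.
    by apply/seteqP; split => t; rewrite /= in_itv.
  by rewrite -[X in measurable X]setTI; apply: mv => //; exact: measurable_itv.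
have mcapB : measurable (\bigcap_n B n : set (measurableTypeR R)) by exact: bigcapT_measurable.
have B0fin : (leb (B 0%N) < +oo)%E.
  apply: (@le_lt_trans _ _ (leb (`[0%R, 1%R]%classic : set R))).
    by apply: le_measure; rewrite ?inE; [exact: mB|exact: measurable_itv|move=> ? []].
  by rewrite lebesgue_itvcc ?ler01// ltry.
have Bdec : nonincreasing_seq B.
  apply/nonincreasing_seqP => n; apply/subsetPset => t [t01 /= vt]; split => //=.
  by rewrite (le_trans vt)// lef_pV2 ?posrE// ler_nat.
have := nonincreasing_cvg_mu B0fin mB mcapB Bdec.
have cap0 : leb (\bigcap_n B n) = 0%E.
  apply/negligibleP => //; apply: negligibleS vpos => t /= tB.
  have [] := tB 0%N Logic.I; rewrite /= in_itv/= => t01 _ /(_ t01) /natSinv_lt[k kv].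
  by have [_ /=] := tB k Logic.I; rewrite leNgt kv.
move=> /(_ [set y | y < e%:E]%E) []; last by move=> n _ /(_ n (leqnn n)); exists n.
by apply: open_nbhs_nbhs; split; [exact: open_ereal_lt_ereal|rewrite /= [X in (X < _)%E]cap0 lte_fin].
Qed.

(** v is positive almost everywhere but need not be bounded below. Off the set B where v <= 1/(n+1),
    which has small measure for large n, Lebesgue measure is at most n+1 times the measure v dt, and
    v dt gives the intervals with endpoints moved by psi their original total length. *)
Lemma density_inverse : exists psi : I -> I, [/\ cancel s psi, cancel psi s,
  {homo s : a b / val a < val b} & abs_cont (fun u => val (psi u) : R^o)].
Proof.
pose psi u := projT1 (cid (density_surjective sv s0 s1 u)).
have psiK : cancel psi s by move=> u; rewrite /psi; case: cid.
have sinc := density_increasing.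
have sK : cancel s psi.
  move=> t; apply: val_inj; apply/eqP; rewrite eq_le !leNgt; apply/andP.
  by split; apply/negP => /sinc; rewrite psiK ltxx.
have psi_inc := increasing_inv psiK sinc.
exists psi; split => // e e0.
have e2 : 0 < e / 2 by rewrite divr_gt0.
have [n Bn] := density_small_set e2; set B := _ `&` _ in Bn.
have n0 : (0 : R) < n.+1%:R by rewrite ltr0n.
(* After multiplication by n+1 the part off B costs less than e / 2; B costs the other e / 2. *)
exists (e / 2 / n.+1%:R); first by rewrite divr_gt0.
move=> l lS ld; pose l' := [seq (psi i.1, psi i.2) | i <- l].
have l'S : subintervals l'.
  have /andP[/allP sle spw] := lS; apply/andP; split.
    by apply/allP => _ /mapP[i /sle ile ->]/=; exact: increasing_le.
  rewrite pairwise_map; apply: sub_pairwise spw => i j /=.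
  by case/orP => /(increasing_le psi_inc) ->; rewrite ?orbT.
pose F := ocitvs l'; have mF := measurable_ocitvs l'; have [mv _ _] := sv.
pose nu := density_measure leb mv v0.
have nuF : nu F = (\sum_(i <- l) (val i.2 - val i.1))%:E.
  have := measure_ocitvs nu l'S; rewrite big_map => E; rewrite -sumEFin.
  apply: (etrans E); rewrite big_seq [RHS]big_seq; apply: eq_bigr => i il.
  rewrite /= /nu/= /density_measure (density_itv sv)/= ?psiK//.
  have /andP[/allP sle _] := lS; exact/increasing_le/sle.
have lebF : leb F = (\sum_(i <- l) mdist (val (psi i.1) : R^o) (val (psi i.2)))%:E.
  rewrite ocitvs_lebesgue// big_map big_seq [in RHS]big_seq; congr (_%:E).
  apply: eq_bigr => i il; have /andP[/allP sle _] := lS.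
  by rewrite /mdist/= ger0_norm// subr_ge0; exact/(increasing_le psi_inc)/sle.
have mB : measurable (B : set (measurableTypeR R)).
  apply: measurableI; first exact: measurable_itv.
  have -> : [set t | v t <= n.+1%:R^-1] = v @^-1` `]-oo, n.+1%:R^-1]%classic.
    by apply/seteqP; split => t; rewrite /= in_itv.
  by rewrite -[X in measurable X]setTI; apply: (mv) => //; exact: measurable_itv.
rewrite -lte_fin -lebF.
have FB : (leb (F `\` B) <= (n.+1%:R)%:E * nu F)%E.
  have mFB : measurable (F `\` B : set (measurableTypeR R)) by exact: measurableD.
  apply: (@le_trans _ _ ((n.+1%:R)%:E * nu (F `\` B))%E); last first.
    rewrite lee_pmul2l ?lte_fin//; apply: le_measure; rewrite ?inE//.
  rewrite /nu/= /density_measure -ge0_integralZl//; last 2 first.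
  - exact/measurable_EFinP/measurable_funTS.
  - by move=> x _; rewrite lee_fin.
  rewrite -[leLHS]mul1e -integral_cst//; apply: ge0_le_integral => //.
  - apply: emeasurable_funM => //; exact/measurable_EFinP/measurable_funTS.
  move=> x [Fx Bx]; rewrite -EFinM lee_fin -ler_pdivrMl// mulr1.
  rewrite leNgt; apply/negP => vx; apply: Bx; split => /=; last exact: ltW.
  have /hasP[_ /mapP[i il ->]/=] := Fx; rewrite in_itv/= => /andP[x1 x2].
  have /andP[p0 _] := unit_intervalP (psi i.1).
  have /andP[_ p1] := unit_intervalP (psi i.2).
  by apply/andP; split; [exact: (ltW (le_lt_trans p0 x1))|exact: le_trans x2 p1].
have : (leb F <= leb (F `\` B) + leb B)%E.
  apply: (@le_trans _ _ (leb ((F `\` B) `|` B))).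
    apply: le_measure; rewrite ?inE//; first by apply: measurableU => //; exact: measurableD.
    by move=> x Fx; have [Bx|Bx] := pselect (B x); [right|left].
  by apply: measureU2 => //; exact: measurableD.
move=> /le_lt_trans; apply; rewrite (splitr e) EFinD; apply: lte_leD => //; last exact: ltW.
  by rewrite ge0_fin_numE//; exact: lt_trans Bn (ltry _).
apply: (le_lt_trans FB); rewrite nuF -EFinM lte_fin.
by rewrite -ltr_pdivlMl// mulrC.
Qed.

End inverse.

(** * Constant speed reparametrization *)

Section constant_speed.
Context (R : realType) (X : completeMetricType R).
Local Notation leb := (@lebesgue_measure R).
Local Notation I := (unit_interval R).
Implicit Types (g h : curve X).

Lemma mvariation_comp_le (Y : metricType R) (f : I -> Y) (phi : I -> I) a b :
  (forall s t, val s <= val t -> val (phi s) <= val (phi t)) ->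
  (mvariation (f \o phi) a b <= mvariation f (phi a) (phi b))%E.
Proof.
move=> phi_nd; apply: ge_ereal_sup => _ [s /= /andP[sS sin] <-].
have := @vsum_le_mvariation _ _ f (phi a) (phi b) [seq (phi i.1, phi i.2) | i <- s].
rewrite /vsum big_map/=; apply.
  move: sS => /andP[/allP sle spw]; apply/andP; split.
    by apply/allP => _ /mapP[i /sle ile ->]/=; exact: phi_nd.
  rewrite pairwise_map; apply: sub_pairwise spw => i j /=.
  by case/orP => /phi_nd ->; rewrite ?orbT.
rewrite all_map; apply: sub_all sin => i /andP[ai ib]; rewrite /inside/=.
by rewrite !phi_nd.
Qed.

Lemma mvariation_comp (Y : metricType R) (f : I -> Y) (phi psi : I -> I) a b :
  cancel phi psi -> cancel psi phi -> {homo phi : s t / val s < val t} ->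
  mvariation (f \o phi) a b = mvariation f (phi a) (phi b).
Proof.
move=> phiK psiK phi_inc; have psi_inc := increasing_inv psiK phi_inc.
apply/eqP; rewrite eq_le mvariation_comp_le/=; last by move=> s t; exact: increasing_le.
have := @mvariation_comp_le _ (f \o phi) psi (phi a) (phi b).
rewrite !phiK (_ : (f \o phi) \o psi = f).
  by apply => s t; exact: increasing_le.
by apply/funext => t /=; rewrite psiK.
Qed.

(** A statement about all subintervals is used instead of an a.e. statement on the metric
    derivative; [ACc_curveP] shows that the two agree when L > 0. *)
Definition constant_speed (L : R) g := forall s t : I, val s <= val t ->
  mvariation g s t = (L * (val t - val s))%:E.

Lemma constant_speed_lipschitz L g : constant_speed L g -> has_lipschitz_constant L g.
Proof.
move=> cg s t; wlog st : s t / val s <= val t.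
  by move=> H; case: (leP (val s) (val t)) => [/H//|/ltW/H]; rewrite metric_sym distrC.
rewrite distrC ger0_norm ?subr_ge0// -lee_fin -cg//; exact: mdist_le_mvariation.
Qed.

Lemma lipschitz_abs_cont L g : has_lipschitz_constant L g -> abs_cont g.
Proof.
(* L can be 0, as for a constant curve; the maximum with 1 permits the division. *)
move=> gL e e0; pose M := Num.max L 1; have M0 : 0 < M by rewrite lt_max ltr01 orbT.
exists (e / M); first by rewrite divr_gt0.
move=> s /andP[/allP sle _] se; apply: (@le_lt_trans _ _ (M * \sum_(i <- s) (val i.2 - val i.1))).
  rewrite mulr_sumr big_seq [leRHS]big_seq; apply: ler_sum => i /sle ile.
  apply: (le_trans (gL _ _)); rewrite distrC ger0_norm ?subr_ge0// ler_wpM2r ?subr_ge0//.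
  by rewrite /M le_max lexx.
by rewrite mulrC -ltr_pdivlMr.
Qed.

Lemma ACinfty_abs_cont g : ACinfty_curve g -> abs_cont g.
Proof. by case=> L /lipschitz_abs_cont. Qed.

Lemma constant_speed_abs_cont L g : constant_speed L g -> abs_cont g.
Proof. by move=> /constant_speed_lipschitz/lipschitz_abs_cont. Qed.

Lemma constant_speed_vfun L g t : constant_speed L g -> vfun g t = L * val t.
Proof.
move=> cg; rewrite /vfun cg val_clamp ?lexx ?ler01 ?subr0//.
by case/andP: (unit_intervalP t).
Qed.

Lemma vfun_constant_speed L g : abs_cont g -> (forall t, vfun g t = L * val t) ->
  constant_speed L g.
Proof. by move=> acg gL s t st; rewrite -vfunB// !gL mulrBr. Qed.

Lemma densityZ (f : I -> R) v c : density f v -> density (fun t => c * f t) (fun t => c * v t).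
Proof.
move=> [mv iv fv]; split; first exact: measurable_funM.
- by rewrite (_ : _ \o _ = (fun t => c%:E * (EFin \o v) t)%E)//; exact: integrableZl.
- move=> s t st; rewrite -mulrBr fv// RintegralZl//; exact: (integrableS measurableT).
Qed.

Lemma affine_density (L : R) : density (fun t : I => L * val t) (fun t => L * \1_(`[0, 1]%classic : set R) t).
Proof.
apply: densityZ.
have m01 : measurable (`[0, 1]%classic : set (measurableTypeR R)) by exact: measurable_itv.
split; first exact: measurable_indic.
  exact: integrable_indic_itv.
move=> s t st; have mst : measurable (`[val s, val t]%classic : set (measurableTypeR R)) by exact: measurable_itv.
rewrite /Rintegral integral_indic//.
have -> : `[0, 1] `&` `[val s, val t] = `[val s, val t]%classic.
  have /andP[s0 _] := unit_intervalP s; have /andP[_ t1] := unit_intervalP t.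
  apply/seteqP; split => x; rewrite /= !in_itv/=; first by case.
  by move=> /andP[sx xt]; rewrite sx xt (le_trans s0 sx) (le_trans xt t1).
by rewrite [X in fine X](lebesgue_itvcc st).
Qed.

Lemma lipschitz_continuous (f : I -> X) L :
  (forall s t, mdist (f s) (f t) <= L * `|val s - val t|) -> continuous f.
Proof.
move=> fL t; apply/(@metricType_numDomainType.cvgrPdist_lt R X I (nbhs t) (nbhs_filter t)) => e e0.
pose M := Num.max L 1; have M0 : 0 < M by rewrite lt_max ltr01 orbT.
have : \forall s \near t, `|val t - val s| < e / M.
  have /cvgrPdist_lt := @val_continuous R t; apply; exact: divr_gt0.
apply: (@filterS _ _ (nbhs_filter t)) => s st; apply: (le_lt_trans (fL _ _)).
apply: (@le_lt_trans _ _ (M * `|val t - val s|)); first by rewrite ler_wpM2r// /M le_max lexx.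
by rewrite mulrC -ltr_pdivlMr.
Qed.

Lemma curve_eqP g h : (forall t, g t = h t) -> g = h.
Proof.
move=> gh; apply: (@mdist_positivity R (curve X)).
by have [t E _] := curve_mdist_attained g h; apply: (etrans E); rewrite gh mdistxx.
Qed.

Hypothesis sX : separable_space X.

Lemma constant_speed_derivative L g : constant_speed L g ->
  {ae leb, forall t, 0 <= t <= 1 -> metric_derivative g t = L /\ speed g t = L%:E}.
Proof.
move=> cg; have acg := constant_speed_abs_cont cg.
have [v [vV _ vE]] := metric_derivative_density sX acg.
have := affine_density L; rewrite -(_ : vfun g = fun t : I => L * val t); last first.
  by apply/funext => t; exact: constant_speed_vfun.
move=> Ld; apply: ae_mono (ae_and vE (density_unique vV Ld)) => t [H1 H2] t01.
by have [-> ->] := H1 t01; rewrite (H2 t01) indicE mem_set ?mulr1//= in_itv.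
Qed.

Lemma constant_speed_length L g : constant_speed L g -> curve_length g = L%:E.
Proof.
move=> cg; rewrite (curve_lengthE sX (constant_speed_abs_cont cg)).
by rewrite (constant_speed_vfun _ cg) val_clamp ?mulr1 ?lexx ?ler01.
Qed.

Lemma ACc_curveP g : ACc_curve g <-> exists2 L, 0 < L & constant_speed L g.
Proof.
split=> [[gL [l0 gl]]|[L L0 cg]]; last first.
  split; first by exists L; exact: constant_speed_lipschitz.
  rewrite (constant_speed_length cg) lte_fin; split => //.
  apply: ae_mono (constant_speed_derivative cg) => t H /H[-> _] //.
have acg := ACinfty_abs_cont gL.
move: l0 gl; rewrite (curve_lengthE sX acg) lte_fin; set L := vfun _ _ => L0 gl.
exists L => //; apply: vfun_constant_speed => // t.
have [v [[mv iv vV] _ vE]] := metric_derivative_density sX acg.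
have /andP[t0 t1] := unit_intervalP t.
have := vV (clamp 0) t; rewrite vfun_clamp0 subr0 val_clamp ?lexx ?ler01// => /(_ t0) ->.
transitivity (\int[leb]_(r in `[0, val t]) (L * \1_(`[0, 1]%classic : set R) r)).
  congr fine; apply: ae_eq_integral => //.
  - exact/measurable_EFinP/measurable_funTS.
  - apply/measurable_EFinP/measurable_funTS; apply: measurable_funM => //.
  - apply: ae_mono (ae_and vE gl) => r [H1 H2]; rewrite /= in_itv/= => /andP[r0 r1].
    have r01 : 0 <= r <= 1 by rewrite r0 (le_trans r1).
    rewrite indicE mem_set ?mulr1//= ?in_itv//.
    by have [<- _] := H1 r01; have [->] := H2 r01.
have [_ _ aff] := affine_density L.
have := aff (clamp 0) t; rewrite val_clamp ?lexx ?ler01// => /(_ t0) <-.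
by rewrite mulr0 subr0.
Qed.

Section reparametrization.
Variable g : curve X.
Hypothesis acg : abs_cont g.
Let L := vfun g (clamp 1).
Hypothesis L0 : 0 < L.

Definition arcp (t : I) : I := clamp (vfun g t / L).

Lemma val_arc t : val (arcp t) = vfun g t / L.
Proof.
have V0 : 0 <= vfun g t by rewrite fine_ge0// mvariation_ge0.
rewrite val_clamp//; apply/andP; split; first by rewrite divr_ge0// ltW.
rewrite ler_pdivrMr// mul1r; apply: vfun_le => //.
by rewrite [leRHS]val_clamp ?lexx ?ler01//; case/andP: (unit_intervalP t).
Qed.

Lemma arc_le s t : val s <= val t -> val (arcp s) <= val (arcp t).
Proof. by move=> st; rewrite !val_arc ler_pM2r ?invr_gt0// vfun_le. Qed.

Lemma arc0 : arcp (clamp 0) = clamp 0.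
Proof. by rewrite /arcp vfun_clamp0 mul0r. Qed.

Lemma arc1 : arcp (clamp 1) = clamp 1.
Proof. by rewrite /arcp divff// gt_eqF. Qed.

Lemma arc_density v : density (vfun g) v -> density (val \o arcp) (fun t => L^-1 * v t).
Proof.
move=> /(@densityZ _ _ L^-1); congr density.
by apply/funext => t; rewrite -[RHS]/(val (arcp t)) val_arc mulrC.
Qed.

Lemma arc_surjective u : exists t, arcp t = u.
Proof.
have [v [vV v0 _]] := metric_derivative_density sX acg.
exact: (density_surjective (arc_density vV) arc0 arc1 u).
Qed.

(** psi is an arbitrary right inverse of arc length. Since g does not move where its variation is
    constant, g factors through [arcp]. The Lipschitz bound of g o psi gives speed at most L, and
    the variation of g between psi(s) and psi(t) gives at least L. *)
Lemma arc_reparam : exists h, constant_speed L h /\ forall t, g t = h (arcp t).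
Proof.
pose psi u := projT1 (cid (arc_surjective u)).
have psiK u : arcp (psi u) = u by rewrite /psi; case: cid.
have vpsi u : vfun g (psi u) = L * val u.
  by rewrite -[in RHS](psiK u) val_arc mulrC divfK// gt_eqF.
have gV s t : mdist (g s) (g t) <= `|vfun g s - vfun g t|.
  wlog st : s t / val s <= val t.
    by move=> H; case: (leP (val s) (val t)) => [/H//|/ltW/H]; rewrite metric_sym distrC.
  by rewrite distrC (le_trans (mdist_le_vfun acg st))// ler_norm.
have hL s t : mdist (g (psi s)) (g (psi t)) <= L * `|val s - val t|.
  by apply: (le_trans (gV _ _)); rewrite !vpsi -mulrBr normrM gtr0_norm.
have ch : continuous (g \o psi) by exact: lipschitz_continuous hL.
pose h : curve X := mkcts ch.
have gh t : g t = h (arcp t).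
  apply/esym/mdist_positivity/eqP; rewrite eq_le mdist_ge0 andbT.
  by apply: (le_trans (gV _ _)); rewrite vpsi val_arc mulrC divfK ?gt_eqF// subrr normr0.
exists h; split => // s t st.
apply/eqP; rewrite eq_le; apply/andP; split.
  rewrite mulrBr; apply: (@mvariation_minimal _ _ _ (fun t => L * val t)) => // x y xy.
  by rewrite -mulrBr (le_trans (hL _ _))// distrC ger0_norm// subr_ge0.
have [pst|pst] := leP (val (psi s)) (val (psi t)); last first.
  have := arc_le (ltW pst); rewrite !psiK => ts.
  by rewrite (_ : val t = val s) ?subrr ?mulr0 ?mvariation_ge0//; apply/eqP; rewrite eq_le ts.
have := @mvariation_comp_le _ h arcp (psi s) (psi t) arc_le; rewrite !psiK.
apply: le_trans; rewrite (_ : h \o arcp = g); last by apply/funext => x; rewrite /= gh.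
by rewrite -vfunB// !vpsi mulrBr.
Qed.

Lemma arc_reparam_unique h h' : (forall t, g t = h (arcp t)) -> (forall t, g t = h' (arcp t)) ->
  h = h'.
Proof.
move=> gh gh'; apply: curve_eqP => u; have [t <-] := arc_surjective u.
by rewrite -gh gh'.
Qed.

Lemma arc_equiv h : (forall t, g t = h (arcp t)) ->
  {ae leb, forall t, 0 <= t <= 1 -> 0 < metric_derivative g t} -> equiv_curve g h.
Proof.
move=> gh pos; have [v [vV v0 vE]] := metric_derivative_density sX acg.
have vL0 t : 0 <= L^-1 * v t by rewrite mulr_ge0// ltW// invr_gt0.
have vpos : {ae leb, forall t, 0 <= t <= 1 -> 0 < L^-1 * v t}.
  apply: ae_mono (ae_and pos vE) => t [H1 H2] t01; rewrite mulr_gt0 ?invr_gt0//.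
  by have [<- _] := H2 t01; exact: H1.
have [psi [psiK psiK' inc acpsi]] := density_inverse (arc_density vV) vL0 arc0 arc1 vpos.
exists arcp, psi; split=> //; split => //.
exact: density_abs_cont (arc_density vV).
Qed.

(** The speed v of g is L times the density of [arcp], so the change of variables turns v dt into L
    du. *)
Lemma J_measure_reparam h (B : set (borel X)) : constant_speed L h ->
  (forall t, g t = h (arcp t)) -> measurable B -> J_measure g B = J_measure h B.
Proof.
move=> ch gh mB; have ach := constant_speed_abs_cont ch.
have [v [vV v0 vE]] := metric_derivative_density sX acg.
have vL0 t : 0 <= L^-1 * v t by rewrite mulr_ge0// ltW// invr_gt0.
have mB' (k : curve X) : measurable_fun setT (fun t => (\1_B (cpath k t : borel X) : R)%:E).
  apply/measurable_EFinP; apply: (measurableT_comp (measurable_indic mB)).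
  exact: measurable_cpath.
rewrite (J_measureE sX acg mB) (J_measureE sX ach mB).
transitivity (\int[leb]_(t in `[0%R, 1%R]) (((\1_B (cpath h t))%:E * L%:E)))%E; last first.
  apply: ae_eq_integral => //.
  - by apply: measurable_funTS; apply: emeasurable_funM => //; exact: mB'.
  - by apply: measurable_funTS; apply: emeasurable_funM; [exact: mB'|exact: measurable_speed_curve].
  - apply: ae_mono (constant_speed_derivative ch) => t H; rewrite /= in_itv/= => t01.
    by have [_ ->] := H t01.
have mH : measurable_fun setT (fun u => (\1_B (cpath h u))%:E * L%:E)%E.
  by apply: emeasurable_funM => //; exact: mB'.
have H0 u : (0 <= (\1_B (cpath h u))%:E * L%:E)%E by rewrite mule_ge0// lee_fin// ltW.
rewrite -[RHS](integral_change_of_variables (arc_density vV) vL0 arc0 arc1 mH H0).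
apply: ae_eq_integral => //.
- by apply: measurable_funTS; apply: emeasurable_funM; [exact: mB'|exact: measurable_speed_curve].
- apply: measurable_funTS; apply: emeasurable_funM.
    apply: (measurableT_comp mH); apply: continuous_measurable_fun.
    exact: density_continuous (arc_density vV).
  by apply/measurable_EFinP; apply: measurable_funM => //; have [] := vV.
- apply: ae_mono vE => t H.
  have H' : `[0%R, 1%R]%classic t -> 0 <= t <= 1 by rewrite /= in_itv.
  move=> /H'/H[_ ->]; rewrite -muleA -(EFinM L) mulVKf ?gt_eqF//.
  by rewrite /cpath clamp_val gh.
Qed.

End reparametrization.

Lemma increasing_bij_clamp (phi psi : I -> I) : cancel psi phi ->
  {homo phi : s t / val s < val t} -> phi (clamp 0) = clamp 0 /\ phi (clamp 1) = clamp 1.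
Proof.
move=> psiK phi_inc; split; apply/val_inj/eqP; rewrite eq_le; apply/andP; split.
- rewrite -[in leRHS](psiK (clamp 0)); apply: increasing_le => //.
  by rewrite val_clamp ?lexx ?ler01//; case/andP: (unit_intervalP (psi (clamp 0))).
- by rewrite val_clamp ?lexx ?ler01//; case/andP: (unit_intervalP (phi (clamp 0))).
- by rewrite [leRHS]val_clamp ?lexx ?ler01//; case/andP: (unit_intervalP (phi (clamp 1))).
- rewrite -[in leLHS](psiK (clamp 1)); apply: increasing_le => //.
  by rewrite [leRHS]val_clamp ?lexx ?ler01//; case/andP: (unit_intervalP (psi (clamp 1))).
Qed.

Lemma equiv_curve_vfun g h phi psi : cancel phi psi -> cancel psi phi ->
  {homo phi : s t / val s < val t} -> (forall t, g t = h (phi t)) ->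
  forall t, vfun g t = vfun h (phi t).
Proof.
move=> phiK psiK phi_inc gh t; have [p0 _] := increasing_bij_clamp psiK phi_inc.
rewrite /vfun (_ : (g : I -> X) = h \o phi); last exact/funext.
by rewrite (mvariation_comp _ _ _ phiK psiK)// p0.
Qed.

(** Variation is invariant under increasing bijections, so the normalized arc lengths of g and g'
    differ only by phi and lead to the same curve. *)
Lemma equiv_curve_reparam g g' h h' : abs_cont g -> abs_cont g' ->
  0 < vfun g (clamp 1) -> equiv_curve g g' ->
  (forall t, g t = h (arcp g t)) -> (forall t, g' t = h' (arcp g' t)) -> h = h'.
Proof.
move=> acg acg' L0 [phi [psi [[phiK psiK inc _ _] gg']]] gh gh'.
have [_ p1] := increasing_bij_clamp psiK inc.
have VV := equiv_curve_vfun phiK psiK inc gg'.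
apply: (arc_reparam_unique acg L0 gh) => t; rewrite gg' gh' /arcp.
by rewrite (VV t) (VV (clamp 1)) p1.
Qed.

End constant_speed.

(** * Borel measurability of constant speed curves through split sets *)

Section split_sets.
Context (R : realType) (X : completeMetricType R).
Local Notation I := (unit_interval R).
Implicit Types (g h : curve X).

Lemma eval_continuous (t : I) : continuous (fun g : curve X => g t).
Proof.
move=> g; apply/(@metricType_numDomainType.cvgrPdist_lt R X (curve X) (nbhs g) (nbhs_filter g)) => e e0.
have := @metricType_numDomainType.cvgr_dist_lt R (curve X) (curve X) (nbhs g) (nbhs_filter g) id g cvg_id e e0.
by apply: filterS => h; apply: le_lt_trans; exact: mdist_curve_le.
Qed.

Lemma vsum_continuous s : continuous (fun g : curve X => vsum g s).
Proof.
elim: s => [|i s IH] g.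
  rewrite (_ : (fun g : curve X => vsum g [::]) = cst 0); first exact: cst_continuous.
  by apply/funext => h; rewrite /vsum big_nil.
rewrite (_ : (fun h : curve X => _) = (fun h => mdist (h i.1) (h i.2) + vsum h s)).
  apply: cvgD; last exact: IH; first exact: (nbhs_filter (g : curve X)).
  have := @cvg_mdist R X (curve X) (nbhs g) (nbhs_filter (g : curve X))
    (fun h => h i.1) (fun h => h i.2) (g i.1) (g i.2).
  by apply; exact: eval_continuous.
by apply/funext => h; rewrite /vsum big_cons.
Qed.

(** The variation is a supremum of functionals continuous in the curve, hence lower
    semicontinuous. *)
Lemma open_lt_mvariation (c : R) a b : open [set g : curve X | (c%:E < mvariation g a b)%E].
Proof.
rewrite (_ : [set _ | _] = \bigcup_(s in [set s | subintervals s && all (inside a b) s])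
    [set g : curve X | c < vsum g s]).
  apply: bigcup_open => s _.
  apply: (@open_comp _ _ (fun g : curve X => vsum g s) [set r | c < r]); last exact: open_gt.
  by move=> g _; exact: vsum_continuous.
apply/seteqP; split => g /=.
  by move=> /ereal_sup_gt[_ [s sS <-]]; rewrite lte_fin => cs; exists s.
move=> [s /= /andP[sS sin] cs]; apply: lt_le_trans (vsum_le_mvariation _ sS sin).
by rewrite lte_fin.
Qed.

(** Unlike the evaluations, these open sets are invariant under reparametrization. *)
Definition split_set (a b : R) (U : set X) : set (curve X) :=
  [set g | exists t : I, [/\ (a%:E < mvariation g (clamp 0%R) t)%E,
    (b%:E < mvariation g t (clamp 1%R))%E & U (g t)]].

Lemma open_split_set a b U : open U -> open (split_set a b U).
Proof.
move=> oU; rewrite (_ : split_set a b U = \bigcup_t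
    ([set g : curve X | (a%:E < mvariation g (clamp 0%R) t)%E] `&`
     ([set g : curve X | (b%:E < mvariation g t (clamp 1%R))%E] `&` [set g : curve X | U (g t)]))).
  apply: bigcup_open => t _; apply: openI; first exact: open_lt_mvariation.
  apply: openI; first exact: open_lt_mvariation.
  by apply: (open_comp _ oU) => g _; exact: eval_continuous.
by apply/seteqP; split => g [t]; [move=> [? ? ?]; exists t | move=> _ [? [? ?]]; exists t].
Qed.

Hypothesis sX : separable_space X.

Lemma split_set_constant_speed L h a b U : constant_speed L h ->
  split_set a b U h <->
  exists t : I, [/\ a < L * val t, b < L * (1 - val t) & U (h t)].
Proof.
move=> ch.
have E (t : I) : mvariation h (clamp 0) t = (L * val t)%:E.
  by rewrite ch val_clamp ?lexx ?ler01 ?subr0//; case/andP: (unit_intervalP t).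
have E' (t : I) : mvariation h t (clamp 1) = (L * (1 - val t))%:E.
  by rewrite ch val_clamp ?lexx ?ler01//; case/andP: (unit_intervalP t).
by split=> -[t [H1 H2 H3]]; exists t; move: H1 H2; rewrite E E' !lte_fin.
Qed.

(** At matching times t and [arcp g t] the two curves have the same position and the same lengths
    before and after, and [arcp g] is onto. *)
Lemma split_set_reparam g h a b U : abs_cont g -> 0 < vfun g (clamp 1) ->
  constant_speed (vfun g (clamp 1)) h -> (forall t, g t = h (arcp g t)) ->
  split_set a b U g <-> split_set a b U h.
Proof.
move=> acg L0 ch gh; apply: (iff_trans _ (iff_sym (split_set_constant_speed a b U ch))).
set L := vfun g (clamp 1) in L0 *.
have E (t : I) : mvariation g (clamp 0) t = (L * val (arcp g t))%:E.
  rewrite -vfunB//; last by rewrite val_clamp ?lexx ?ler01//; case/andP: (unit_intervalP t).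
  by rewrite vfun_clamp0 subr0 val_arc// mulrC divfK// gt_eqF.
have E' (t : I) : mvariation g t (clamp 1) = (L * (1 - val (arcp g t)))%:E.
  rewrite -vfunB//; last by rewrite val_clamp ?lexx ?ler01//; case/andP: (unit_intervalP t).
  by rewrite mulrBr mulr1 val_arc// mulrC divfK// gt_eqF.
split=> [[t [H1 H2 H3]]|[u [H1 H2 H3]]].
  by exists (arcp g t); move: H1 H2; rewrite E E' !lte_fin -gh.
by have [t tu] := arc_surjective sX acg L0 u; exists t; rewrite E E' !lte_fin tu gh tu.
Qed.

(** Split sets see lengths rather than times. Constant speed converts one into the other, once the
    total length l is known to be measurable. *)
Lemma measurable_constant_speed d (T : measurableType d) (F : T -> borel (curve X)) (l : T -> R) :
  (forall w, 0 < l w) -> (forall w, constant_speed (l w) (F w : curve X)) ->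
  (forall a b U, open U -> measurable (F @^-1` split_set a b U)) ->
  measurable_fun setT F.
Proof.
move=> l0 cF mF.
have ml : measurable_fun setT l.
  apply: (@measurability _ _ T R setT _ _
    (measurable_realfun.RGenOInfty.measurableE R)) => _ [_ [r ->] <-].
  (* With U the whole space and the second threshold negative, the split set only says that the
     total length exceeds r. *)
  have := mF r (-1) setT openT; congr measurable; rewrite setTI.
  apply/seteqP; split => w; rewrite /preimage/= in_itv/= andbT.
    move=> /(split_set_constant_speed _ _ _ (cF w))[t [rl _ _]]; apply: (lt_le_trans rl).
    by rewrite -[leRHS]mulr1 ler_pM2l//; case/andP: (unit_intervalP t).
  move=> rl; apply/(split_set_constant_speed _ _ _ (cF w)); exists (clamp 1).
  by rewrite val_clamp ?lexx ?ler01// mulr1 subrr mulr0.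
have mA (al be : R) (U : set X) : open U ->
    measurable [set w | exists t : I, [/\ al < val t, val t < be & U ((F w : curve X) t)]].
  (* A rational a with al l <= a < l t certifies al < t, and a rational b with (1 - be) l <= b < l
     (1 - t) certifies t < be. *)
  move=> oU; rewrite (_ : [set _ | _] = \bigcup_(i in [set: rat * rat])
    ((F @^-1` split_set (ratr i.1) (ratr i.2) U) `&`
     ([set w | al * l w <= ratr i.1] `&` [set w | (1 - be) * l w <= ratr i.2]))).
    apply: bigcup_measurable_countType => i _; apply: measurableI; first exact: mF.
    have mle (c r : R) : measurable [set w | c * l w <= r].
      rewrite (_ : [set _ | _] = (fun w => c * l w) @^-1` `]-oo, r]%classic).
        rewrite -[X in measurable X]setTI.
        by apply: measurable_funM => //; exact: measurable_itv.
      by apply/seteqP; split => w; rewrite /= in_itv.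
    by apply: measurableI; exact: mle.
  apply/seteqP; split => w.
    move=> [t [at_ tb Ut]].
    have /rat_in_itvoo[a] : al * l w < l w * val t by rewrite mulrC ltr_pM2l.
    rewrite in_itv/= => /andP[a1 a2].
    have /rat_in_itvoo[b] : (1 - be) * l w < l w * (1 - val t).
      by rewrite mulrC ltr_pM2l// ltrD2l ltrN2.
    rewrite in_itv/= => /andP[b1 b2].
    exists (a, b) => //; split; last by split; exact: ltW.
    by apply/(split_set_constant_speed _ _ _ (cF w)); exists t.
  move=> [[a b] _ /= [/(split_set_constant_speed _ _ _ (cF w))[t [H1 H2 H3]] [H4 H5]]].
  exists t; split => //.
    by rewrite -(ltr_pM2l (l0 w)) mulrC (le_lt_trans H4).
  have : (1 - be) * l w < l w * (1 - val t) by rewrite (le_lt_trans H5).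
  by rewrite mulrC ltr_pM2l// ltrD2l ltrN2.
apply: measurable_curve => // t x t01.
apply: (@measurability _ _ T R setT _ _
  (measurable_realfun.RGenCInfty.measurableE R)) => _ [_ [r ->] <-].
(* The evaluation at t is recovered from nearby times: the distance at t is at least r when, within
   1/(n+1) of t, some time gives more than r - 1/(n+1), for all n. Uniform continuity gives this
   direction. *)
rewrite setTI (_ : _ @^-1` _ = \bigcap_(n in [set: nat])
    [set w | exists s : I, [/\ t - n.+1%:R^-1 < val s, val s < t + n.+1%:R^-1 &
      [set y | r - n.+1%:R^-1 < mdist x y] ((F w : curve X) s)]]).
  apply: bigcap_measurable_countType => n _; apply: mA.
  apply: (@open_comp _ _ (mdist x) [set s | r - n.+1%:R^-1 < s]); last exact: open_gt.
  by move=> y _; exact: mdist_continuous.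
have t01' : 0 <= t <= 1 by case/andP: t01 => /ltW -> /ltW ->.
apply/seteqP; split => w; rewrite /= in_itv/= andbT.
  move=> rx n _ /=; exists (clamp t); rewrite val_clamp//; split.
  - by rewrite ltrBlDr ltrDl invr_gt0.
  - by rewrite ltrDl invr_gt0.
  - by apply: lt_le_trans rx; rewrite ltrBlDr ltrDl invr_gt0.
move=> H; rewrite leNgt; apply/negP => xr.
pose e := (r - mdist x (cpath (F w : curve X) t)) / 2.
have e0 : 0 < e by rewrite divr_gt0// subr_gt0.
have [c c0 cP] := cpath_uniform (F w : curve X) e0.
have ce0 : 0 < Num.min c e by rewrite lt_min c0.
have [n] := natSinv_lt ce0; rewrite lt_min => /andP[nc ne].
have [s [s1 s2 s3]] := H n Logic.I; set z := n.+1%:R^-1 in nc ne s1 s2 s3.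
have : mdist (cpath (F w : curve X) t) ((F w : curve X) s) < e.
  rewrite -(clamp_val s); apply: cP; apply/ltW/lt_trans/nc; rewrite ltr_distl.
  by apply/andP; split; [rewrite ltrBlDr|rewrite -ltrBlDr].
have := metric_triangle x (cpath (F w : curve X) t) ((F w : curve X) s).
have : r - mdist x (cpath (F w : curve X) t) = 2 * e by rewrite /e mulrC divfK.
move: s3 => /=; move: (mdist _ _) (mdist _ _) (mdist _ _) ne => y1 y2 y3; lra.
Qed.

End split_sets.

(** * The quotient space and the maps i and j *)

Section nonparametric.
Context (R : realType) (X : completeMetricType R).
Local Notation leb := (@lebesgue_measure R).
Local Notation I := (unit_interval R).
Hypothesis sX : separable_space X.
Local Notation AC0 := (@AC0_curve R X).
Implicit Types (g h : curve X) (c : nonparam X).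

Lemma AC0_length g : AC0_curve g -> 0 < vfun g (clamp 1).
Proof.
move=> [acg pos]; have [v [[mv iv vV] v0 vE]] := metric_derivative_density sX acg.
rewrite lt_neqAle fine_ge0 ?mvariation_ge0// andbT; apply/negP => /eqP L0.
have V0 t : vfun g t = 0 * val t.
  apply/eqP; rewrite mul0r eq_le fine_ge0 ?mvariation_ge0// andbT [leRHS]L0.
  by apply: vfun_le => //; rewrite val_clamp ?lexx ?ler01//; case/andP: (unit_intervalP t).
have cg : constant_speed 0 g by exact: vfun_constant_speed.
have : {ae leb, forall t, ~ (0 <= t <= 1)}.
  apply: ae_mono (ae_and pos (constant_speed_derivative sX cg)) => t [H1 H2] t01.
  by have := H1 t01; have [-> _] := H2 t01; rewrite ltxx.
move=> ne; have : leb (`[0%R, 1%R]%classic : set R) = 0%E.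
  apply/negligibleP; first exact: measurable_itv.
  by apply: negligibleS ne => t /=; rewrite in_itv/= => ? /(_ _).
by rewrite lebesgue_itvcc ?ler01// subr0 => -[/eqP]; rewrite oner_eq0.
Qed.

Definition reparam g h := constant_speed (vfun g (clamp 1)) h /\ forall t, g t = h (arcp g t).

Definition karc g : curve X := xget g (reparam g).

Lemma karcP g : abs_cont g -> 0 < vfun g (clamp 1) -> reparam g (karc g).
Proof. by move=> acg L0; apply: xgetPex; exact: arc_reparam. Qed.

Lemma karc_unique g h : abs_cont g -> 0 < vfun g (clamp 1) ->
  (forall t, g t = h (arcp g t)) -> karc g = h.
Proof.
by move=> acg L0 gh; apply: (arc_reparam_unique sX acg L0) => //; case: (karcP acg L0).
Qed.

Lemma karc_ACc g : abs_cont g -> 0 < vfun g (clamp 1) -> ACc_curve (karc g).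
Proof.
by move=> acg L0; apply/ACc_curveP => //; exists (vfun g (clamp 1)) => //; case: (karcP acg L0).
Qed.

Lemma ACc_AC0 h : ACc_curve h -> AC0_curve h.
Proof.
move=> /(ACc_curveP sX)[L L0 ch]; split; first exact: constant_speed_abs_cont ch.
by apply: ae_mono (constant_speed_derivative sX ch) => t H /H[-> _].
Qed.

Lemma ACc_karc h : ACc_curve h -> karc h = h.
Proof.
move=> hc; have [ach _] := ACc_AC0 hc; have L0 := AC0_length (ACc_AC0 hc).
move: (hc) => /(ACc_curveP sX)[L LL0 ch].
apply: karc_unique => // t; congr (h _); apply: val_inj.
by rewrite val_arc// !(constant_speed_vfun _ ch) val_clamp ?lexx ?ler01// mulr1 mulrAC divff ?mul1r// gt_eqF.
Qed.

Lemma equiv_karc g h : abs_cont g -> abs_cont h -> 0 < vfun g (clamp 1) -> 0 < vfun h (clamp 1) ->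
  equiv_curve g h -> karc g = karc h.
Proof.
move=> acg ach Lg Lh gh; apply: (equiv_curve_reparam sX acg ach Lg gh).
- by case: (karcP acg Lg).
- by case: (karcP ach Lh).
Qed.

Lemma equiv_curve_karc g : AC0_curve g -> equiv_curve g (karc g).
Proof.
move=> g0; have L0 := AC0_length g0; have [acg pos] := g0.
by apply: (arc_equiv sX acg L0) => //; case: (karcP acg L0).
Qed.

Definition mkAC0 g (g0 : AC0_curve g) : AC0 := exist _ g (mem_set g0).

Lemma AC0P (g : AC0) : AC0_curve (val g).
Proof. exact: (set_mem (valP g)). Qed.

Lemma pi_eqP (g h : AC0) :
  \pi_(nonparam X) g = \pi_(nonparam X) h <-> equiv_curve (val g) (val h).
Proof.
split=> [/eqmodP/asboolP//|gh]; apply/eqmodP; exact/asboolP.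
Qed.

Lemma j_map_spec c : ACc_curve (j_map c) /\
  exists2 g : AC0, val g = j_map c & c = \pi_(nonparam X) g.
Proof.
apply: (@xgetPex _ _ [set h | ACc_curve h /\
  exists2 g : AC0, val g = h & c = \pi_(nonparam X) g]).
have r0 := AC0P (repr c); have L0 := AC0_length r0; have [acr _] := r0.
have kc := karc_ACc acr L0.
exists (karc (val (repr c))); split => //; exists (mkAC0 (ACc_AC0 kc)) => //.
by rewrite -[LHS]reprK; apply/pi_eqP; exact: equiv_curve_karc.
Qed.

Lemma j_map_pi (g : AC0) : j_map (\pi_(nonparam X) g) = karc (val g).
Proof.
have [jc [h hj /pi_eqP gh]] := j_map_spec (\pi_(nonparam X) g).
have g0 := AC0P g; have h0 := AC0P h.
rewrite (equiv_karc g0.1 h0.1 (AC0_length g0) (AC0_length h0) gh) hj ACc_karc//.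
Qed.

Lemma i_map_spec c0 g : abs_cont g -> 0 < vfun g (clamp 1) -> j_map (i_map c0 g) = karc g.
Proof.
move=> acg L0; rewrite /i_map; case: xgetP => [c _ [_ [_ [h [hc gh] ->]]]|noc].
  rewrite j_map_pi ACc_karc//; apply/esym/karc_unique => // t.
  by rewrite gh normalized_arc_lengthE.
exfalso; have kc := karc_ACc acg L0.
apply: (noc (\pi_(nonparam X) (mkAC0 (ACc_AC0 kc)))); split => //; split.
  by rewrite curve_lengthE// lte_fin.
exists (mkAC0 (ACc_AC0 kc)) => //; split => // t.
by have [_ ->] := karcP acg L0; rewrite normalized_arc_lengthE.
Qed.

Lemma j_map_representative c : j_map c = karc (representative c).
Proof. by rewrite -j_map_pi reprK. Qed.

Lemma J_measure_karc g (B : set (borel X)) : abs_cont g -> 0 < vfun g (clamp 1) ->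
  measurable B -> J_measure (karc g) B = J_measure g B.
Proof.
move=> acg L0 mB; have [cg gk] := karcP acg L0.
exact/esym/J_measure_reparam.
Qed.

Lemma J_measure_representative c (B : set (borel X)) : measurable B ->
  J_measure (representative c) B = J_measure (j_map c) B.
Proof.
have r0 := AC0P (repr c) => mB; rewrite j_map_representative J_measure_karc//; first exact: r0.1.
exact: AC0_length.
Qed.

Lemma nonparam_lengthE c : nonparam_length c = curve_length (j_map c).
Proof.
have r0 := AC0P (repr c); have L0 := AC0_length r0; rewrite j_map_representative.
rewrite (constant_speed_length sX (karcP r0.1 L0).1).
by rewrite /nonparam_length curve_lengthE//; exact: r0.1.
Qed.

(** The preimage of V in AC_0 is the trace of an open W, and [j_map c] is an element of AC_0 in the
    class c. Hence measurability into the quotient can be tested after composition with [j_map]. *)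
Lemma nonparam_openP (V : set (nonparam X)) : open V ->
  exists2 W : set (curve X), open W & forall c, V c <-> W (j_map c).
Proof.
move=> [W oW WV]; exists W => // c.
have [_ [g gc cg]] := j_map_spec c; rewrite -gc.
rewrite [in V c]cg -[V _]/((\pi_(nonparam X) @^-1` V) g) -WV //.
Qed.

(** Split sets are invariant under equivalence on AC_0, so these open sets descend to open sets of
    the quotient. *)
Lemma open_j_map_split (a b : R) (U : set X) : open U -> open [set c | split_set a b U (j_map c)].
Proof.
move=> oU; exists (split_set a b U); first exact: open_split_set.
apply/seteqP; split => g; rewrite /= j_map_pi; have g0 := AC0P g; have L0 := AC0_length g0;
  have [ck gk] := karcP g0.1 L0; by move/(split_set_reparam sX a b U g0.1 L0 ck gk).
Qed.

Lemma measurable_j_map (c0 : nonparam X) :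
  measurable_fun setT (fun c : borel (pnonparam c0) => j_map c : borel (curve X)).
Proof.
apply: (measurable_constant_speed sX (l := fun c : borel (pnonparam c0) => vfun (j_map c : curve X) (clamp 1))).
- move=> c; exact/AC0_length/ACc_AC0/(j_map_spec c).1.
- move=> c; have /(ACc_curveP sX)[L L0 ch] := (j_map_spec c).1.
  by rewrite (constant_speed_vfun _ ch) val_clamp ?lexx ?ler01// mulr1.
- by move=> a b U oU; apply: open_borel; exact: open_j_map_split.
Qed.

Lemma measurable_nonparam (c0 : nonparam X) d (T : measurableType d)
    (F : T -> borel (pnonparam c0)) :
  measurable_fun setT (fun w => j_map (F w) : borel (curve X)) -> measurable_fun setT F.
Proof.
move=> mF; apply: measurable_borelP => V /nonparam_openP[W oW VW].
have := mF measurableT W (open_borel oW); congr measurable; rewrite setTI.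
by apply/seteqP; split => w /VW.
Qed.

(** Replacing [i_map] by the constant c0 off a Borel set D yields a Borel map. With D of full
    measure the image measure is the same. *)
Lemma measurable_i_map (c0 : nonparam X) (D : set (borel (curve X))) : measurable D ->
  (forall g, D g -> abs_cont (g : curve X) /\ 0 < vfun (g : curve X) (clamp 1)) ->
  measurable_fun setT ((fun g => if `[< D g >] then i_map c0 g else c0) :
    borel (curve X) -> borel (pnonparam c0)).
Proof.
move=> mD DP; apply: measurable_nonparam.
have jE (g : curve X) : j_map (if `[< D g >] then i_map c0 g else c0) =
    if `[< D g >] then karc g else j_map c0.
  by case: asboolP => // /DP[]; exact: i_map_spec.
under eq_fun do rewrite jE.
pose F := fun g : borel (curve X) => (if `[< D g >] then karc g else j_map c0 : curve X) : borel (curve X).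
have FA (g : curve X) : ACc_curve (F g : curve X).
  by rewrite /F; case: asboolP => [/DP[? ?]|_]; [exact: karc_ACc|exact: (j_map_spec c0).1].
apply: (measurable_constant_speed sX (F := F) (l := fun g => vfun (F g : curve X) (clamp 1))).
- move=> c; exact/AC0_length/ACc_AC0.
- move=> c; have /(ACc_curveP sX)[L L0 ch] := FA c.
  by rewrite (constant_speed_vfun _ ch) val_clamp ?lexx ?ler01// mulr1.
- move=> a b U oU.
  rewrite (_ : _ @^-1` _ = (D `&` split_set a b U) `|`
    (~` D `&` [set g | split_set a b U (j_map c0)])); last first.
    apply/seteqP; split => g; rewrite /F /preimage/=.
      case: asboolP => [Dg H|]; [left; split => //|by right].
      by have [acg L0] := DP _ Dg; have [ck gk] := karcP acg L0; exact/(split_set_reparam sX _ _ _ acg L0 ck gk).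
    case=> [[Dg H]|[nDg H]]; last by rewrite asboolF.
    rewrite asboolT//.
    by have [acg L0] := DP _ Dg; have [ck gk] := karcP acg L0; exact/(split_set_reparam sX _ _ _ acg L0 ck gk).
  apply: measurableU; first by apply: measurableI => //; apply: open_borel; exact: open_split_set.
  apply: measurableI; first exact: measurableC.
  have [H|H] := pselect (split_set a b U (j_map c0)).
    by rewrite (_ : [set _ | _] = setT)//; apply/seteqP; split.
  by rewrite (_ : [set _ | _] = set0)//; apply/seteqP; split.
Qed.

End nonparametric.

(** * Occupation measures and barycenters *)

Section measures_on_separable_metric_space.
Context (R : realType) (X : completeMetricType R).
Local Open Scope ereal_scope.

(** Tent functions on countably many balls inside U vanish off U, and at each point of U one of them
    is positive. Their partial sums, scaled by n and cut at 1, increase to the indicator. *)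
Lemma open_approx_continuous (x : nat -> X) (U : set X) : dense_seq x -> open U ->
  exists f : nat -> X -> R, [/\ forall n, continuous (f n),
    forall n y, (0 <= f n y <= 1)%R,
    forall y, nondecreasing_seq (f ^~ y) &
    forall y, (f n y)%:E @[n --> \oo] --> (\1_U y : R)%:E].
Proof.
move=> xd oU.
(* A radius 0 switches the tent off, when the ball leaves U or k codes no pair. *)
pose r k : R := if (unpickle k : option (nat * nat)) is Some p then
  (if `[< [set y | mdist (x p.1) y <= p.2.+1%:R^-1]%R `<=` U >] then p.2.+1%:R^-1 else 0)%R else 0%R.
pose c k : X := if (unpickle k : option (nat * nat)) is Some p then x p.1 else x 0%N.
pose phi k y := Num.max 0%R (r k - mdist (c k) y)%R.
have phi0 k y : (0 <= phi k y)%R by rewrite /phi le_max lexx.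
pose S n y := (\sum_(k < n) n%:R * phi k y)%R.
have S0 n y : (0 <= S n y)%R by apply: sumr_ge0 => k _; rewrite mulr_ge0.
pose f n y := Num.min 1%R (S n y).
have cphi k : continuous (phi k).
  move=> y; have := @continuous_max _ _ (fun=> 0%R : R) (fun y : X => (r k - mdist (c k) y)%R) y.
  apply; first exact: cst_continuous.
  by apply: cvgB; [exact: cvg_cst|exact: mdist_continuous].
have cSm n l : continuous (fun y => \sum_(k < l) n%:R * phi k y)%R.
  elim: l => [|l IH] y.
    rewrite (_ : (fun _ => _) = cst 0%R); first exact: cst_continuous.
    by apply/funext => z; rewrite big_ord0.
  rewrite (_ : (fun _ => _) = fun z => (\sum_(k < l) n%:R * phi k z + n%:R * phi l z)%R).
    by apply: cvgD; [exact: IH|apply: cvgM; [exact: cvg_cst|exact: cphi]].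
  by apply/funext => z; rewrite big_ord_recr.
have cS n : continuous (S n) by exact: cSm.
have fnd y : nondecreasing_seq (f ^~ y).
  apply/nondecreasing_seqP => n; rewrite /f le_min !ge_min lexx/=.
  apply/orP; right; rewrite /S big_ord_recr/=; apply: ler_wpDr; first by rewrite mulr_ge0.
  by apply: ler_sum => k _; rewrite ler_wpM2r// ler_nat.
exists f; split => //.
- move=> n y; apply: continuous_min; first exact: cst_continuous.
  exact: cS.
- by move=> n y; rewrite /f le_min ler01 S0/= ge_min lexx.
- move=> y; apply: cvg_EFin; first exact: nearW.
  rewrite indicE; have [Uy|nUy] := pselect (U y).
    rewrite mem_set//=.
    have := Uy; rewrite (open_bigcup_ball xd oU) => -[p pU /= yp].
    have phip : (0 < phi (pickle p) y)%R.
      by rewrite /phi lt_max /r /c pickleK asboolT// subr_gt0 yp orbT.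
    have [N /ltW NP] : exists N : nat, ((phi (pickle p) y)^-1 < N%:R)%R.
      by exists (Num.bound (phi (pickle p) y)^-1); apply: archi_boundP; rewrite invr_ge0.
    apply: cvg_near_cst; exists (maxn N (pickle p).+1) => // n /=; rewrite geq_max => /andP[Nn pn].
    apply/min_idPl; rewrite /S (bigD1 (Ordinal pn))//=; apply: ler_wpDr.
      by apply: sumr_ge0 => k _; rewrite mulr_ge0.
    by rewrite -ler_pdivrMr// div1r (le_trans NP)// ler_nat.
  rewrite memNset//; apply: cvg_near_cst; apply: nearW => n; rewrite /= /f /S big1 ?min_r//.
  move=> k _; rewrite /phi max_l ?mulr0// subr_le0 /r /c; case: unpickle => [p|]; last exact: mdist_ge0.
  case: asboolP => [pU|_]; last exact: mdist_ge0.
  by rewrite leNgt; apply/negP => /ltW yp; apply: nUy; exact: pU.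
Qed.

Lemma measure_eq_continuous (mu nu : {measure set (borel X) -> \bar R}) : separable_space X ->
  mu setT < +oo ->
  (forall f : X -> R, continuous f -> (forall y, 0 <= f y <= 1)%R ->
    \int[mu]_y (f y)%:E = \int[nu]_y (f y)%:E) ->
  forall B, measurable B -> mu B = nu B.
Proof.
move=> /separable_dense_seq[x xd] fin munu.
have mo U : open U -> mu U = nu U.
  move=> oU; have [f [cf f01 fnd fU]] := open_approx_continuous xd oU.
  have mf n : measurable_fun setT (fun y : borel X => (f n y)%:E).
    by apply/measurable_EFinP; exact: continuous_measurable_borel.
  have f0 n y : 0 <= (f n y)%:E by rewrite lee_fin; case/andP: (f01 n y).
  have E (la : {measure set (borel X) -> \bar R}) : la U = limn (fun n => \int[la]_y (f n y)%:E).
    rewrite -monotone_convergence//; last by move=> y _ a b ab; rewrite lee_fin; exact: fnd.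
    rewrite -[U in LHS]setIT -integral_indic//; last exact: open_borel.
    by apply: eq_integral => y _; apply/esym/cvg_lim => //; exact: fU.
  by rewrite !E; congr (limn _); apply/funext => n; exact: munu.
apply: (measure_unique (T := borel X) (@open X) (fun=> setT)) => //.
- by move=> A B oA oB; exact: openI.
- by move=> _; exact: openT.
- by apply/seteqP; split => // y _; exists 0%N.
Qed.

End measures_on_separable_metric_space.

Section integrals_along_curves.
Context (R : realType).
Local Notation leb := (@lebesgue_measure R).
Local Open Scope ereal_scope.

Lemma measurable_integral_unit d (T : measurableType d) (f : T * R -> \bar R) :
  measurable_fun setT f -> (forall p, 0 <= f p) ->
  measurable_fun setT (fun w => \int[leb]_(t in `[0%R, 1%R]) f (w, t)).
Proof.
move=> mf f0; under eq_fun do rewrite integral_mkcond.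
pose F := fun p : T * R => (f p * (\1_(`[0%R, 1%R]%classic : set R) p.2)%:E).
have mF : measurable_fun setT F.
  apply: emeasurable_funM => //; apply/measurable_EFinP.
  by apply: (measurableT_comp _ measurable_snd); apply: measurable_indic; exact: measurable_itv.
have F0 p : 0 <= F p by rewrite mule_ge0// lee_fin.
rewrite (_ : (fun _ => _) = fubini_F leb F); first exact: measurable_fun_fubini_tonelli_F.
by apply/funext => w; apply: eq_integral => t _; rewrite epatch_indic.
Qed.

Variables (X : completeMetricType R).
Hypothesis sX : separable_space X.

(** P times Lebesgue measure on [0, 1], known afterwards only through Tonelli's formula. *)
Lemma product_unit_measure d (T : measurableType d) (P : {finite_measure set T -> \bar R}) :
  exists mu : {measure set (T * R) -> \bar R}, forall f : T * R -> \bar R,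
    measurable_fun setT f -> (forall z, 0 <= f z) ->
    \int[mu]_z f z = \int[P]_w \int[leb]_(t in `[0%R, 1%R]) f (w, t).
Proof.
pose o (z : T * R) : R := \1_(`[0%R, 1%R]%classic : set R) z.2.
have mo : measurable_fun setT o.
  by apply: (measurableT_comp _ measurable_snd); apply: measurable_indic; exact: measurable_itv.
have o0 z : (0 <= o z)%R by [].
exists (push_measure (density_measure (P \x leb) mo o0) (@measurable_id _ (T * R)%type setT)) => f mf f0.
rewrite ge0_integral_push// ge0_integral_density//.
rewrite (fubini_tonelli1 (m1 := P) (m2 := leb)); last 2 first.
- by apply: emeasurable_funM => //; exact/measurable_EFinP.
- by move=> z; rewrite mule_ge0// lee_fin.
apply: eq_integral => w _; rewrite [RHS]integral_mkcond /fubini_F.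
by apply: eq_integral => t _; rewrite epatch_indic.
Qed.

Lemma occupation_measure (sigma : {finite_measure set (borel (curve X)) -> \bar R}) :
  exists nu : {measure set (borel X) -> \bar R}, forall f : borel X -> \bar R,
    measurable_fun setT f -> (forall x, 0 <= f x) ->
    \int[nu]_x f x = \int[sigma]_g \int[leb]_(t in `[0%R, 1%R]) f (cpath (g : curve X) t).
Proof.
have [mu muE] := product_unit_measure sigma.
exists (push_measure mu (measurable_eval sX)) => f mf f0.
rewrite ge0_integral_push// muE//.
exact: (measurableT_comp mf (measurable_eval sX)).
Qed.

(** The defining identity concerns bounded continuous functions and a density h of unknown sign. It
    is extended to nonnegative Borel functions, and h is replaced by its positive part, which gives
    the same measure. *)
Lemma barycenter_ge0 (m : {finite_measure set (borel X) -> \bar R})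
    (sigma : probability (borel (curve X)) R) (h : borel X -> R) :
  m.-integrable setT (EFin \o h) -> parametric_barycenter m sigma h ->
  forall f : borel X -> \bar R, measurable_fun setT f -> (forall x, 0 <= f x) ->
    \int[sigma]_g \int[leb]_(t in `[0%R, 1%R]) f (cpath (g : curve X) t) =
    \int[m]_x (f x * (Num.max (h x) 0)%R%:E).
Proof.
move=> ih bar.
have mh : measurable_fun setT h by have /integrableP[/measurable_EFinP] := ih.
pose hp (x : borel X) := Num.max (h x) 0%R; pose hn (x : borel X) := Num.max (- h x)%R 0%R.
have mhp : measurable_fun setT hp by exact: measurable_maxr.
have mhn : measurable_fun setT hn by apply: measurable_maxr => //; exact: measurable_funN.
have hp0 x : (0 <= hp x)%R by rewrite /hp le_max lexx orbT.
have hn0 x : (0 <= hn x)%R by rewrite /hn le_max lexx orbT.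
have hE x : (h x = hp x - hn x)%R.
  rewrite /hp /hn; case: (leP 0%R (h x)) => h0.
    by rewrite (max_r (_ : - h x <= 0))%R ?subr0// oppr_le0.
  by rewrite (max_l (_ : 0 <= - h x))%R ?sub0r ?opprK// oppr_ge0 ltW.
have hph x : (hp x <= `|h x|)%R by rewrite /hp ge_max normr_ge0 ler_norm.
have hnh x : (hn x <= `|h x|)%R by rewrite /hn ge_max normr_ge0 -normrN ler_norm.
have ihf (k : borel X -> R) (f : X -> R) : measurable_fun setT k -> (forall x, `|k x| <= `|h x|)%R ->
    measurable_fun setT (f : borel X -> R) ->
    (forall x, 0 <= f x <= 1)%R -> m.-integrable setT (fun x => (f x * k x)%:E).
  move=> mk kh mf f01; apply: (le_integrable _ _ _ ih) => //.
    exact/measurable_EFinP/measurable_funM.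
  move=> x _; rewrite /= lee_fin normrM; case/andP: (f01 x) => f0 f1.
  by rewrite ger0_norm// (le_trans _ (kh x))// ler_piMl.
have [nu nuE] := occupation_measure sigma.
pose mp := density_measure m mhp hp0; pose mn := density_measure m mhn hn0.
(* The negative part of h is moved to the side of the occupation measure nu, so that two positive
   measures are compared. *)
have agree (f : X -> R) : continuous f -> (forall y, 0 <= f y <= 1)%R ->
    \int[mp]_y (f y)%:E = \int[measure_add nu mn]_y (f y)%:E.
  move=> cf f01.
  have mf : measurable_fun setT (f : borel X -> R) by exact: continuous_measurable_borel.
  have f0 y : 0 <= (f y)%:E by rewrite lee_fin; case/andP: (f01 y).
  have mfE : measurable_fun setT (fun y : borel X => (f y)%:E) by exact/measurable_EFinP.
  rewrite ge0_integral_measure_add// nuE// !ge0_integral_density//.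
  rewrite bar//; last first.
    by exists 1%R => x; rewrite ger0_norm; case/andP: (f01 x).
  under [X in _ = X + _]eq_integral => x _ do rewrite hE mulrBr EFinB.
  rewrite integralB//; last 2 first.
  - by apply: ihf => // x; rewrite ger0_norm.
  - by apply: ihf => // x; rewrite ger0_norm.
  under [X in _ + X]eq_integral do rewrite -EFinM.
  rewrite subeK//.
  by apply: integrable_fin_num => //; apply: ihf => // x; rewrite ger0_norm.
have mpT : mp setT < +oo.
  rewrite /mp/= /density_measure; apply: (@le_lt_trans _ _ (\int[m]_x `|(h x)%:E|)).
    apply: ge0_le_integral => //.
    - by move=> x _; rewrite lee_fin.
    - exact/measurable_EFinP.
    - by apply: measurableT_comp => //; exact/measurable_EFinP.
    - by move=> x _; rewrite /= lee_fin.
  by have /integrableP[] := ih.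
have eqB B (mB : measurable B) : mp B = nu B + mn B :=
  etrans (measure_eq_continuous sX mpT agree mB) (measure_addE nu mn B).
(* On N the measure h^+ m vanishes, hence so does the sum of nu and h^- m; as h^- is 0 off N, the
   measure h^- m is zero. *)
pose N := [set x : borel X | (h x < 0)%R].
have mN : measurable N.
  rewrite (_ : N = h @^-1` `]-oo, 0%R[%classic); last by apply/seteqP; split => x; rewrite /N/= in_itv.
  by rewrite -[X in measurable X]setTI; apply: mh => //; exact: measurable_itv.
have mpN : mp N = 0.
  rewrite /mp/= /density_measure integral0_eq// => x Nx.
  by rewrite /hp max_r// ltW.
have mnT : mn setT = 0.
  have := measureU mn mN (measurableC mN) (setICr N); rewrite setUv => E.
  have mnN : mn N = 0.
    have /esym/eqP := eqB N mN; rewrite [X in _ == X]mpN.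
    by rewrite padde_eq0// => /andP[_ /eqP].
  have mnC : mn (~` N) = 0.
    rewrite /mn/= /density_measure integral0_eq// => x /= /negP; rewrite -leNgt => h0.
    by rewrite /hn max_r// oppr_le0.
  apply: (etrans E); rewrite -[RHS]adde0; apply: f_equal2; [exact: mnN|exact: mnC].
have nuB B : measurable B -> nu B = mp B.
  move=> mB; rewrite eqB// (_ : mn B = 0) ?adde0//.
  by apply/eqP; rewrite eq_le measure_ge0 andbT -mnT le_measure// inE.
move=> f mf f0; rewrite -nuE// -[RHS](ge0_integral_density m mhp hp0)//.
by apply: eq_measure_integral => B mB _; exact: nuB.
Qed.

End integrals_along_curves.

Lemma lipschitz_speed_le (R : realType) (X : completeMetricType R) (L : R) (g : curve X) t :
  has_lipschitz_constant L g -> (speed g t <= L%:E)%E.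
Proof.
move=> gL; rewrite /speed limn_esup_lim; apply: lime_le; first exact: is_cvg_esups.
apply: nearW => n; apply: ge_ereal_sup => _ [k _ <-]; rewrite lee_fin.
have L0 : 0 <= L.
  have := gL (clamp 0) (clamp 1); rewrite !val_clamp ?lexx ?ler01// sub0r normrN normr1 mulr1.
  by apply: le_trans; exact: mdist_ge0.
have k0 : (0 : R) < k.+1%:R by rewrite ltr0n.
rewrite mulrC -ler_pdivlMr//; apply: (le_trans (gL _ _)); rewrite ler_wpM2l//.
apply: (le_trans (clamp_lipschitz _ _)).
by rewrite addrC addKr ger0_norm// invr_ge0 ltW.
Qed.

Lemma ae_unit_interval_absurd (R : realType) :
  ~ {ae (@lebesgue_measure R), forall t, ~ (0 <= t <= 1)}.
Proof.
move=> ne; have : (@lebesgue_measure R) (`[0%R, 1%R]%classic : set R) = 0%E.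
  apply/negligibleP; first exact: measurable_itv.
  by apply: negligibleS ne => t /=; rewrite in_itv/= => ? /(_ _).
by rewrite lebesgue_itvcc ?ler01// subr0 => -[/eqP]; rewrite oner_eq0.
Qed.

(** * The time change T with weight w *)

Section time_change.
Context (R : realType) (X : completeMetricType R).
Local Notation leb := (@lebesgue_measure R).
Local Notation I := (unit_interval R).
Hypothesis sX : separable_space X.
Variable w : borel X -> R.
Hypotheses (mw : measurable_fun setT w) (w0 : forall x, 0 < w x) (w1 : forall x, w x <= 1).
Implicit Types (c : curve X).

Let J : set R := `[0, 1]%classic.

Let mJ : measurable (J : set (measurableTypeR R)). Proof. exact: measurable_itv. Qed.

Let W c (t : R) : R := w (cpath c t) * \1_J t.

Let mW c : measurable_fun setT (W c).
Proof.
apply: measurable_funM; last exact: measurable_indic.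
by apply: (measurableT_comp mw); exact: measurable_cpath.
Qed.

Let W0 c t : 0 <= W c t. Proof. by rewrite mulr_ge0// ltW. Qed.

Let iW c : leb.-integrable setT (EFin \o W c).
Proof.
apply: (le_integrable _ _ _ (integrable_indic_itv 0 1 true false)) => //.
  by apply/measurable_EFinP; exact: mW.
by move=> t _; rewrite /= lee_fin !ger0_norm// ?W0// ler_piMl.
Qed.

(** With w = 1/g, [elapsed c 1] is the constant A(c) of the overview and [clock] is the map s. *)
Definition elapsed c (t : R) : R := \int[leb]_(r in `[0, t]) W c r.

Lemma elapsed_density c : density (fun t : I => elapsed c (val t)) (W c).
Proof.
split; [exact: mW|exact: iW|] => s t st; rewrite /elapsed.
have /andP[s0 _] := unit_intervalP s; have /andP[t0 _] := unit_intervalP t.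
have iWS (A : set (measurableTypeR R)) : measurable A -> leb.-integrable A (EFin \o W c).
  by move=> mA; exact: integrableS (iW c).
rewrite Rintegral_itvB//; last exact: iWS.
by rewrite Rintegral_itv_obnd_cbnd//; exact: iWS.
Qed.

Lemma elapsed_gt0 c : 0 < elapsed c 1.
Proof.
rewrite lt_neqAle Rintegral_ge0// andbT; apply/negP => /eqP e0.
have e0' (t : I) : elapsed c (val t) = 0 * val t.
  have [_ _ eD] := elapsed_density c; have /andP[t0 t1] := unit_intervalP t.
  have i0 (s u : I) : val s <= val u -> elapsed c (val s) <= elapsed c (val u).
    by move=> su; rewrite -subr_ge0 eD//; apply: Rintegral_ge0 => r _; exact: W0.
  have := i0 t (clamp 1); rewrite val_clamp ?lexx ?ler01// -e0 => /(_ t1) le0.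
  by apply/eqP; rewrite mul0r eq_le le0/=; apply: Rintegral_ge0 => r _; exact: W0.
have E : (fun t : I => elapsed c (val t)) = (fun t => 0 * val t) by exact/funext.
have := elapsed_density c; rewrite E => /density_unique/(_ (affine_density (0 : R))) H; apply: (@ae_unit_interval_absurd R).
apply: ae_mono H => t H t01; have := H t01; rewrite /W indicE mem_set/= ?in_itv// mulr1 mul0r.
by move=> w_0; have := w0 (cpath c t); rewrite w_0 ltxx.
Qed.

Lemma elapsed_le1 c : elapsed c 1 <= 1.
Proof.
have [_ i1 /(_ (clamp 0) (clamp 1))] := affine_density (1 : R).
rewrite !val_clamp ?lexx ?ler01// mulr1 mulr0 subr0 => E; rewrite [leRHS]E ?ler01// /elapsed.
apply: le_Rintegral => //.
- exact: integrableS (iW c).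
- exact: integrableS i1.
- by move=> t _; rewrite /W ler_wpM2r.
Qed.

Lemma elapsed_0 c : elapsed c 0 = 0.
Proof. by rewrite /elapsed set_itv1 Rintegral_set1. Qed.

Lemma elapsed_le c (s t : I) : val s <= val t -> elapsed c (val s) <= elapsed c (val t).
Proof.
move=> st; rewrite -subr_ge0; have [_ _ ->//] := elapsed_density c.
by apply: Rintegral_ge0 => r _; exact: W0.
Qed.

Definition clock c (t : I) : I := clamp (elapsed c (val t) / elapsed c 1).

Lemma val_clock c t : val (clock c t) = elapsed c (val t) / elapsed c 1.
Proof.
have /andP[t0 t1] := unit_intervalP t.
have e0 : val (clamp 0 : I) = 0 by rewrite val_clamp ?lexx ?ler01.
have e1 : val (clamp 1 : I) = 1 by rewrite val_clamp ?lexx ?ler01.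
rewrite val_clamp//; apply/andP; split.
  rewrite divr_ge0 ?(ltW (elapsed_gt0 c))// -(elapsed_0 c) -e0.
  by apply: elapsed_le; rewrite e0.
rewrite ler_pdivrMr ?elapsed_gt0// mul1r -[X in _ <= elapsed c X]e1.
by apply: elapsed_le; rewrite e1.
Qed.

Let v c (t : R) : R := (elapsed c 1)^-1 * W c t.

Lemma clock_density c : density (val \o clock c) (v c).
Proof.
have := densityZ (elapsed c 1)^-1 (elapsed_density c); congr density.
by apply/funext => t; rewrite -[RHS]/(val (clock c t)) val_clock mulrC.
Qed.

Let v0 c t : 0 <= v c t.
Proof. by rewrite mulr_ge0 ?W0// invr_ge0 ltW// elapsed_gt0. Qed.

Lemma clock0 c : clock c (clamp 0) = clamp 0.
Proof. by rewrite /clock val_clamp ?lexx ?ler01// elapsed_0 mul0r. Qed.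

Lemma clock1 c : clock c (clamp 1) = clamp 1.
Proof. by rewrite /clock val_clamp ?lexx ?ler01// divff// gt_eqF// elapsed_gt0. Qed.

Let v_gt0 c t : 0 <= t <= 1 -> 0 < v c t.
Proof.
move=> t01; rewrite mulr_gt0 ?invr_gt0 ?elapsed_gt0//.
by rewrite /W indicE mem_set ?mulr1//= in_itv.
Qed.

Lemma clock_inverse c : exists psi : I -> I, [/\ cancel (clock c) psi, cancel psi (clock c),
  {homo clock c : a b / val a < val b} & abs_cont (fun u => val (psi u) : R^o)].
Proof.
apply: (density_inverse (clock_density c) (v0 c) (clock0 c) (clock1 c)).
by apply: aeW => t; exact: v_gt0.
Qed.

Definition unclock c : I -> I := projT1 (cid (clock_inverse c)).

Lemma clockK c : cancel (clock c) (unclock c).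
Proof. by rewrite /unclock; case: cid => psi []. Qed.

Lemma unclockK c : cancel (unclock c) (clock c).
Proof. by rewrite /unclock; case: cid => psi []. Qed.

Lemma clock_increasing c : {homo clock c : a b / val a < val b}.
Proof. by rewrite /unclock; case: (clock_inverse c) => psi []. Qed.

Lemma unclock_abs_cont c : abs_cont (fun u => val (unclock c u) : R^o).
Proof. by rewrite /unclock; case: cid => psi []. Qed.

Lemma unclock_continuous c : continuous (c \o unclock c).
Proof.
rewrite (_ : _ \o _ = cpath c \o (fun t : R => val (unclock c (clamp t))) \o val); last first.
  by apply/funext => t; rewrite /cpath/= !clamp_val.
move=> t; apply: continuous_comp; first exact: val_continuous.
apply: continuous_comp; last exact: cpath_continuous.
exact: (abs_cont_continuous (@unclock_abs_cont c)).
Qed.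

Definition time_change c : curve X := mkcts (@unclock_continuous c).

Lemma time_changeE c t : time_change c t = c (unclock c t). Proof. by []. Qed.

Lemma time_change_clock c t : time_change c (clock c t) = c t.
Proof. by rewrite time_changeE clockK. Qed.

Lemma time_change_equiv c : equiv_curve (time_change c) c.
Proof.
exists (unclock c), (clock c); split => //; split.
- exact: unclockK.
- exact: clockK.
- exact: (increasing_inv (@unclockK c) (@clock_increasing c)).
- exact: unclock_abs_cont.
- exact: density_abs_cont (clock_density c).
Qed.

Lemma time_change_abs_cont c : abs_cont c -> abs_cont (time_change c).
Proof.
move=> acc; apply: abs_cont_comp => //; last exact: unclock_abs_cont.
exact: (increasing_inv (@unclockK c) (@clock_increasing c)).
Qed.

(** The factor [elapsed c 1] is produced by normalizing the clock; weighting sigma by it later makes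
    the left side linear in the plan and leaves the plain weight w on the right. *)
Lemma time_change_integral c (f : borel X -> \bar R) : measurable_fun setT f ->
  (forall x, 0 <= f x)%E ->
  ((elapsed c 1)%:E * \int[leb]_(t in `[0%R, 1%R]) f (cpath (time_change c) t) =
   \int[leb]_(t in `[0%R, 1%R]) (f (cpath c t) * (w (cpath c t))%:E))%E.
Proof.
move=> mf f0.
have mF : measurable_fun setT (fun t => f (cpath (time_change c) t)).
  by apply: (measurableT_comp mf); exact: measurable_cpath.
rewrite -(integral_change_of_variables (clock_density c) (v0 c) (clock0 c) (clock1 c) mF)//.
rewrite -ge0_integralZl_EFin//; last 3 first.
- by move=> t _; rewrite mule_ge0// lee_fin.
- apply: measurable_funTS; apply: emeasurable_funM; last first.
    by apply/measurable_EFinP; apply: measurable_funM => //; exact: mW.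
  apply: (measurableT_comp mF); apply: continuous_measurable_fun.
  exact: density_continuous (clock_density c).
- by rewrite ltW// elapsed_gt0.
apply: eq_integral => t /set_mem t01.
rewrite muleCA; congr (_ * _)%E.
  by rewrite /cpath clamp_val time_change_clock.
rewrite -EFinM /v mulVKf ?gt_eqF ?elapsed_gt0// /W indicE mem_set ?mulr1//.
Qed.

Lemma measurable_elapsed t : measurable_fun setT (fun c : borel (curve X) => elapsed c t).
Proof.
apply: (measurableT_comp (fine_measurable measurableT)).
rewrite (_ : (fun _ => _) = fun c : borel (curve X) => (\int[leb]_(r in `[0%R, 1%R])
    (w (cpath (c : curve X) r) * \1_(`[0%R, t]%classic : set R) r)%:E)%E); last first.
  apply/funext => c; rewrite [LHS]integral_mkcond [RHS]integral_mkcond.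
  by apply: eq_integral => r _; rewrite !epatch_indic -!EFinM /W mulrAC.
apply: (measurable_integral_unit (f := fun p : borel (curve X) * R =>
    (w (cpath (p.1 : curve X) p.2) * \1_(`[0%R, t]%classic : set R) p.2)%:E)).
  apply/measurable_EFinP; apply: measurable_funM.
    exact: (measurableT_comp mw (measurable_eval sX)).
  by apply: (measurableT_comp _ measurable_snd); apply: measurable_indic; exact: measurable_itv.
by move=> p; rewrite lee_fin mulr_ge0// ltW.
Qed.

Lemma measurable_time_change :
  measurable_fun setT (time_change : borel (curve X) -> borel (curve X)).
Proof.
apply: measurable_curve => // t x t01.
have t01' : 0 <= t <= 1 by case/andP: t01 => /ltW -> /ltW ->.
have mu : measurable_fun setT (fun c : borel (curve X) => val (unclock c (clamp t))).
  apply: (@measurability _ _ (borel (curve X)) R setT _ _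
    (measurable_realfun.RGenOInfty.measurableE R)) => _ [_ [r ->] <-].
  rewrite setTI; have [r0|r0] := ltP r 0.
    rewrite (_ : _ @^-1` _ = setT)//; apply/seteqP; split => // c _.
    rewrite /preimage/= in_itv/= andbT (lt_le_trans r0)//.
    by case/andP: (unit_intervalP (unclock c (clamp t))).
  have [r1|r1] := ltP r 1; last first.
    rewrite (_ : _ @^-1` _ = set0)//; apply/seteqP; split => // c.
    rewrite /preimage/= in_itv/= andbT => /(le_lt_trans r1).
    by rewrite ltNge; case/andP: (unit_intervalP (unclock c (clamp t))) => _ ->.
  have rE : val (clamp r : I) = r by rewrite val_clamp// r0 ltW.
  (* The inverse clock exceeds r at t exactly when the clock at r is below t, a condition on elapsed
     times, which are measurable in c. *)
  rewrite (_ : _ @^-1` _ = (fun c : borel (curve X) => t * elapsed c 1 - elapsed c r) @^-1` `]0, +oo[%classic).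
    have mB : measurable_fun setT (fun c : borel (curve X) => t * elapsed c 1 - elapsed c r).
      apply: measurable_funB; last exact: measurable_elapsed.
      by apply: measurable_funM => //; exact: measurable_elapsed.
    by rewrite -[X in measurable X]setTI; apply: mB => //; exact: measurable_itv.
  have clockr (c : curve X) : (val (clock c (clamp r)) < t) = (0 < t * elapsed c 1 - elapsed c r).
    by rewrite val_clock rE ltr_pdivrMr ?elapsed_gt0// subr_gt0.
  have unclockr (c : curve X) : (r < val (unclock c (clamp t))) = (val (clock c (clamp r)) < t).
    have inc := increasing_inv (@unclockK c) (@clock_increasing c).
    have tE : val (clamp t : I) = t by rewrite val_clamp.
    rewrite -[in LHS]rE -[in RHS]tE; apply/idP/idP => [/(@clock_increasing c)|/inc].
      by rewrite unclockK.
    by rewrite clockK.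
  by apply/seteqP; split => c; rewrite /preimage/= !in_itv/= !andbT -clockr -unclockr.
have -> : (fun c : borel (curve X) => mdist x (cpath (time_change c) t)) =
    mdist x \o ((fun p : borel (curve X) * R => cpath (p.1 : curve X) p.2 : borel X) \o
      (fun c : borel (curve X) => (c, val (unclock c (clamp t))))).
  by apply/funext => c /=; rewrite /cpath clamp_val.
apply: (measurableT_comp (measurable_mdist x)).
apply: (measurableT_comp (measurable_eval sX)).
exact: measurable_fun_pair.
Qed.

(** With v2 the speed of T c and v the density of the clock S, the energy of T c is the integral of
    (v2 o S)^q v = ((v2 o S) v)^q v^(1-q). The product (v2 o S) v is the speed of c, hence at most
    L, and v = w / A. *)
Lemma time_change_energy c (L q : R) : 1 < q -> has_lipschitz_constant L c ->
  (power_integral q (time_change c) <=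
   (L `^ q)%:E * ((elapsed c 1 `^ (q - 1))%:E *
     \int[leb]_(t in `[0%R, 1%R]) (w (cpath c t) `^ (1 - q))%:E))%E.
Proof.
move=> q1 cL; have acc := lipschitz_abs_cont cL; have acT := time_change_abs_cont acc.
have [v2 [v2V v20 v2E]] := metric_derivative_density sX acT.
have [vc [vcV vc0 vcE]] := metric_derivative_density sX acc.
set A := elapsed c 1; have A0 : 0 < A := elapsed_gt0 c.
pose S (t : R) := val (clock c (clamp t)).
have mS : measurable_fun setT S.
  by apply: continuous_measurable_fun; exact: density_continuous (clock_density c).
have mv : measurable_fun setT (v c) by apply: measurable_funM => //; exact: mW.
have mv2 : measurable_fun setT v2 by case: v2V.
have cov (h : R -> \bar R) (mh : measurable_fun setT h) (h0 : forall t, (0 <= h t)%E) :=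
  integral_change_of_variables (clock_density c) (v0 c) (clock0 c) (clock1 c) mh h0.
(* Chain rule in integrated form: the variation of c is that of T c composed with the clock. The
   change of variables is applied to v2 cut off to the image of [a, b], so no composition is
   differentiated. *)
have D_density : density (vfun c) (fun t => v2 (S t) * v c t).
  have cT (t : I) : c t = time_change c (clock c t) by rewrite time_change_clock.
  have inc := increasing_inv (@unclockK c) (@clock_increasing c).
  have VV := equiv_curve_vfun (@clockK c) (@unclockK c) (@clock_increasing c) cT.
  have mD : measurable_fun setT (fun t => v2 (S t) * v c t).
    by apply: measurable_funM => //; exact: (measurableT_comp mv2 mS).
  have inD (a b : I) : val a <= val b ->
      (\int[leb]_(t in `[val a, val b]) (v2 (S t) * v c t)%:E = (vfun c b - vfun c a)%:E)%E.
    move=> ab; have sab := density_nondecreasing (clock_density c) (v0 c) ab.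
    pose h (u : R) := ((v2 u)%:E * (\1_(`[val (clock c a), val (clock c b)]%classic : set R) u)%:E)%E.
    transitivity (\int[leb]_(t in `[0%R, 1%R]) (h (val (clock c (clamp t))) * (v c t)%:E))%E.
      rewrite [LHS]integral_mkcond [RHS]integral_mkcond; apply: eq_integral => t _.
      rewrite !epatch_indic /h -!EFinM; congr (_%:E); rewrite -/(S t).
      have /andP[a0 _] := unit_intervalP a; have /andP[_ b1] := unit_intervalP b.
      have [t01|nt01] := boolP (0 <= t <= 1); last first.
        rewrite [in RHS](_ : \1_(`[0, 1]%classic : set R) t = 0) ?mulr0; last first.
          by rewrite indicE memNset//= in_itv/= (negbTE nt01).
        rewrite [in LHS]indicE memNset ?mulr0//= in_itv/= => /andP[at_ tb].
        by move: nt01; rewrite (le_trans a0)// (le_trans tb).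
      rewrite [in RHS](_ : \1_(`[0, 1]%classic : set R) t = 1) ?mulr1; last first.
        by rewrite indicE mem_set//= in_itv.
      rewrite mulrAC; congr (_ * _ * _); rewrite !indicE; congr ((nat_of_bool _)%:R).
      have clE (x y : I) : (val (clock c x) <= val (clock c y)) = (val x <= val y).
        apply/idP/idP => [|xy]; first by apply: contraTT; rewrite -!ltNge; exact: clock_increasing.
        by have := density_nondecreasing (clock_density c) (v0 c) xy.
      have tE : val (clamp t : I) = t by rewrite val_clamp.
      have memE (x y z : R) : (z \in `[x, y]%classic) = (x <= z <= y).
        by apply/idP/idP => [/set_mem|xyz]; [rewrite /= in_itv|apply/mem_set; rewrite /= in_itv].
      by rewrite !memE /S !clE tE.
    rewrite (cov h); last 2 first.
    - apply: emeasurable_funM; first exact/measurable_EFinP.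
      apply/measurable_EFinP; apply: measurable_indic; exact: measurable_itv.
    - by move=> u; rewrite mule_ge0// lee_fin.
    rewrite !VV; have [_ iv2 v2D] := v2V; rewrite v2D// /Rintegral fineK; last first.
      by apply: integrable_fin_num => //; exact: integrableS iv2.
    rewrite [LHS]integral_mkcond [RHS]integral_mkcond; apply: eq_integral => u _.
    rewrite !epatch_indic /h -!EFinM -mulrA; congr (_ * _)%:E; rewrite !indicE.
    have /andP[a0 _] := unit_intervalP (clock c a); have /andP[_ b1] := unit_intervalP (clock c b).
    have [H|H] := boolP (u \in `[val (clock c a), val (clock c b)]%classic); last by rewrite mul0r.
    rewrite mul1r mem_set//; move/set_mem: H; rewrite /= !in_itv/= => /andP[au ub].
    by rewrite (le_trans a0 au) (le_trans ub b1).
  split => //.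
    apply/integrableP; split; first exact/measurable_EFinP.
    rewrite (_ : (\int[leb]_x `|_|)%E = (\int[leb]_(t in `[0%R, 1%R]) (v2 (S t) * v c t)%:E)%E).
      have := inD (clamp 0) (clamp 1); rewrite !val_clamp ?lexx ?ler01// => -> //.
      by rewrite ltry.
    rewrite [RHS]integral_mkcond; apply: eq_integral => t _; rewrite epatch_indic /=.
    rewrite ger0_norm; last by rewrite mulr_ge0.
    rewrite /v /W -EFinM; congr (_%:E).
    by rewrite -!mulrA; congr (_ * (_ * (_ * _))); rewrite !indicE; case: (_ \in _); rewrite ?mulr1 ?mulr0.
  by move=> a b ab; rewrite /Rintegral inD.
have key : {ae leb, forall t, 0 <= t <= 1 -> v2 (S t) * v c t <= L}.
  apply: ae_mono (ae_and vcE (density_unique D_density vcV)) => t [H1 H2] t01.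
  rewrite H2// -lee_fin; have [_ <-] := H1 t01; exact: lipschitz_speed_le.
have mw' : measurable_fun setT (fun t => (w (cpath c t) `^ (1 - q))%:E).
  apply/measurable_EFinP; apply: (measurableT_comp (measurable_powR _)).
  by apply: (measurableT_comp mw); exact: measurable_cpath.
rewrite power_integralE// -ge0_integralZl//; last first.
- by rewrite lee_fin powR_ge0.
- by move=> t _; rewrite lee_fin powR_ge0.
- exact: measurable_funTS.
rewrite -ge0_integralZl//; last first.
- by rewrite lee_fin powR_ge0.
- by move=> t _; rewrite mule_ge0 ?lee_fin ?powR_ge0.
- by apply: measurable_funTS; apply: emeasurable_funM.
have -> : (\int[leb]_(t in `[0%R, 1%R]) (speed (time_change c) t `^ q) =
    \int[leb]_(t in `[0%R, 1%R]) (v2 t `^ q)%:E)%E.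
  apply: ae_eq_integral => //.
  - apply: measurable_funTS; apply: (measurableT_comp (measurable_poweR q)).
    exact: measurable_speed_curve.
  - apply: measurable_funTS; apply/measurable_EFinP.
    exact: (measurableT_comp (measurable_powR _)).
  - apply: ae_mono v2E => t H; have H' : `[0%R, 1%R]%classic t -> 0 <= t <= 1 by rewrite /= in_itv.
    by move=> /H'/H[_ ->].
rewrite -(cov (fun t => (v2 t `^ q)%:E)); last 2 first.
- by apply/measurable_EFinP; exact: (measurableT_comp (measurable_powR _)).
- by move=> t; rewrite lee_fin powR_ge0.
apply: ae_ge0_le_integral => //.
- by move=> t _; rewrite mule_ge0// lee_fin ?powR_ge0.
- apply: measurable_funTS; apply: emeasurable_funM; last exact/measurable_EFinP.
  apply/measurable_EFinP; apply: (measurableT_comp (measurable_powR _)).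
  exact: (measurableT_comp mv2 mS).
- by move=> t _; rewrite !mule_ge0// lee_fin powR_ge0.
- by apply: measurable_funTS; apply: emeasurable_funM => //; apply: emeasurable_funM.
apply: ae_mono key => t H.
have H' : `[0%R, 1%R]%classic t -> 0 <= t <= 1 by rewrite /= in_itv.
move=> /H' t01; have xL := H t01; have vt0 := v_gt0 c t01.
rewrite -!EFinM lee_fin -/(S t).
have -> : A `^ (q - 1) * w (cpath c t) `^ (1 - q) = v c t `^ (1 - q).
  rewrite /v /W indicE mem_set ?mulr1//= ?in_itv// -/A powRM ?invr_ge0 ?ltW//.
  by congr (_ * _); rewrite -powR_inv1 ?ltW// -powRrM mulN1r opprB.
have -> : v2 (S t) `^ q * v c t = (v2 (S t) * v c t) `^ q * v c t `^ (1 - q).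
  move: (v c t) vt0 (v2 (S t)) (v20 (S t)) => y y0 z z0.
  have q1q : q + (1 - q) = 1 by rewrite addrC subrK.
  rewrite powRM// ?ltW// -mulrA; congr (_ * _).
  by rewrite -powRD q1q ?powRr1 ?ltW// oner_eq0.
rewrite ler_wpM2r ?powR_ge0//; apply: ge0_ler_powR => //.
- by rewrite ltW// (lt_trans ltr01).
- by rewrite nnegrE mulr_ge0.
- by rewrite nnegrE (le_trans _ xL)// mulr_ge0.
Qed.

End time_change.

(** * Weighted probabilities and criteria for barycenters *)

Definition probability_of d (T : measurableType d) (R : realType)
  (mu : {measure set T -> \bar R}) (mu1 : mu setT = 1%E) : set T -> \bar R := mu.

Section probability_of.
Context d (T : measurableType d) (R : realType) (mu : {measure set T -> \bar R}).
Hypothesis mu1 : mu setT = 1%E.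
HB.instance Definition _ := Measure.on (probability_of mu1).
HB.instance Definition _ := Measure_isProbability.Build _ _ _ (probability_of mu1) mu1.
End probability_of.

Lemma measure_probability d (T : measurableType d) (R : realType)
    (mu : {measure set T -> \bar R}) : mu setT = 1%E ->
  exists2 P : probability T R, (forall A, P A = mu A) &
    forall f, (\int[P]_x f x = \int[mu]_x f x)%E.
Proof. by move=> mu1; exists (probability_of mu1). Qed.

(** Z is the integral of f, positive because f is. That P-null sets stay null lets almost sure
    properties of curves pass to the weighted plan. *)
Lemma weighted_probability d (T : measurableType d) (R : realType)
    (P : probability T R) (f : T -> R) : measurable_fun setT f ->
  (forall x, 0 < f x) -> (\int[P]_x (f x)%:E < +oo)%E ->
  exists2 Z : R, 0 < Z & exists2 Q : probability T R,
    forall A, P A = 0%E -> measurable A -> Q A = 0%E &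
    forall h : T -> \bar R, measurable_fun setT h -> (forall x, 0 <= h x)%E ->
      (\int[Q]_x h x = Z^-1%:E * \int[P]_x (h x * (f x)%:E))%E.
Proof.
move=> mf f0 fin.
have mfE : measurable_fun setT (EFin \o f) by exact/measurable_EFinP.
have i0 : (0 <= \int[P]_x (f x)%:E)%E by apply: integral_ge0 => x _; rewrite lee_fin ltW.
have ifin : (\int[P]_x (f x)%:E)%E \is a fin_num by rewrite ge0_fin_numE.
pose Z := fine (\int[P]_x (f x)%:E).
have ZE : (\int[P]_x (f x)%:E = Z%:E)%E by rewrite /Z fineK.
have Z0 : 0 < Z.
  rewrite lt_neqAle fine_ge0// andbT; apply/negP => /eqP Z_0.
  have : (\int[P]_x `|(EFin \o f) x| = 0)%E.
    transitivity (\int[P]_x (f x)%:E)%E; last by rewrite ZE -Z_0.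
    by apply: eq_integral => x _ /=; rewrite gtr0_norm.
  move/(ae_eq_integral_abs P measurableT mfE) => ae0.
  have : P setT = 0%E.
    apply/negligibleP => //; apply: negligibleS ae0 => x _ /= /(_ Logic.I) [].
    by move=> fx0; have := f0 x; rewrite fx0 ltxx.
  by rewrite probability_setT => /eqP; rewrite onee_eq0.
exists Z => //.
have mfZ : measurable_fun setT (fun x => Z^-1 * f x) by exact: measurable_funM.
have fZ0 x : 0 <= Z^-1 * f x by rewrite mulr_ge0// ltW// invr_gt0.
have [|Q QE QI] := @measure_probability _ _ _ (density_measure P mfZ fZ0).
  rewrite /= /density_measure; under eq_integral do rewrite EFinM.
  rewrite ge0_integralZl_EFin//; last 2 first.
  - by move=> x _; rewrite lee_fin ltW.
  - by rewrite invr_ge0 ltW.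
  by rewrite ZE -EFinM mulVf// gt_eqF.
exists Q => [A PA mA|h mh h0].
  rewrite QE /= /density_measure; apply: null_set_integral => //.
    exact/measurable_EFinP/measurable_funTS.
rewrite QI ge0_integral_density// -ge0_integralZl_EFin//.
- by apply: eq_integral => x _; rewrite EFinM muleCA.
- by move=> x _; rewrite mule_ge0// lee_fin ltW.
- exact: emeasurable_funM.
- by rewrite invr_ge0 ltW.
Qed.

Lemma bounded_integrable d (T : measurableType d) (R : realType)
    (mu : {measure set T -> \bar R}) (D : set T) (f : T -> R) (M : R) :
  measurable D -> (mu D < +oo)%E ->
  measurable_fun D f -> (forall x, `|f x| <= M) -> mu.-integrable D (EFin \o f).
Proof.
move=> mD muD mf fM; apply/integrableP; split; first exact/measurable_EFinP.
apply: (@le_lt_trans _ _ (\int[mu]_(x in D) (cst M%:E x))%E).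
  apply: ge0_le_integral => //.
  - by apply: measurableT_comp => //; exact/measurable_EFinP.
  - by move=> x _; rewrite /= lee_fin.
have muDf : mu D \is a fin_num by rewrite ge0_fin_numE.
by rewrite integral_cst// -(fineK muDf) -EFinM ltry.
Qed.

Section barycenter_criteria.
Context (R : realType) (X : completeMetricType R).
Local Notation leb := (@lebesgue_measure R).
Hypothesis sX : separable_space X.
Variable m : {finite_measure set (borel X) -> \bar R}.

Lemma bounded_Lfun (k : borel X -> R) (M : R) : measurable_fun setT k ->
  (forall x, `|k x| <= M) -> k \in Lfun m +oo%E.
Proof.
move=> mk kM; rewrite inE; apply/andP; split; rewrite inE//=.
rewrite /finite_norm unlock /Lnorm; case: ifPn => // _.
apply: (@le_lt_trans _ _ M%:E); last exact: ltry.
by apply/ess_sup_inf.ess_supP; apply: aeW => x /=; rewrite lee_fin.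
Qed.

(** A bounded continuous f is split into positive and negative parts; boundedness makes all the
    integrals finite, so they can be subtracted. *)
Lemma parametric_barycenter_ge0 (rho : probability (borel (curve X)) R) (k : borel X -> R) :
  m.-integrable setT (EFin \o k) -> (forall x, 0 <= k x) ->
  (forall f : borel X -> \bar R, measurable_fun setT f -> (forall x, 0 <= f x)%E ->
    (\int[rho]_g \int[leb]_(t in `[0%R, 1%R]) f (cpath (g : curve X) t) =
     \int[m]_x (f x * (k x)%:E))%E) ->
  parametric_barycenter m rho k.
Proof.
move=> ik k0 bar f cf [N fN].
have mk : measurable_fun setT k by have /integrableP[/measurable_EFinP] := ik.
pose fp (x : borel X) := Num.max (f x) 0; pose fn (x : borel X) := Num.max (- f x) 0.
have mf : measurable_fun setT (f : borel X -> R) by exact: continuous_measurable_borel.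
have mfp : measurable_fun setT fp by exact: measurable_maxr.
have mfn : measurable_fun setT fn by apply: measurable_maxr => //; exact: measurable_funN.
have fp0 x : 0 <= fp x by rewrite /fp le_max lexx orbT.
have fn0 x : 0 <= fn x by rewrite /fn le_max lexx orbT.
have fpN x : `|fp x| <= N.
  by rewrite ger0_norm// /fp ge_max (le_trans (ler_norm _) (fN x)) (le_trans (normr_ge0 _) (fN x)).
have fnN x : `|fn x| <= N.
  rewrite ger0_norm// /fn ge_max (le_trans (normr_ge0 _) (fN x)) andbT.
  by rewrite (le_trans (ler_norm _))// normrN.
have fE x : f x = fp x - fn x.
  rewrite /fp /fn; case: (leP 0 (f x)) => f0.
    by rewrite (max_r (_ : - f x <= 0)) ?subr0// oppr_le0.
  by rewrite (max_l (_ : 0 <= - f x)) ?sub0r ?opprK// oppr_ge0 ltW.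
have N0 : 0 <= N by rewrite (le_trans (normr_ge0 _) (fN point)).
have inner (e : borel X -> R) : measurable_fun setT e -> (forall x, 0 <= e x) ->
    (forall x, `|e x| <= N) ->
    [/\ forall c : curve X, leb.-integrable `[0, 1] (EFin \o (fun t => e (cpath c t))),
        rho.-integrable setT (fun c : borel (curve X) =>
          \int[leb]_(t in `[0%R, 1%R]) (e (cpath (c : curve X) t))%:E)%E,
        m.-integrable setT (fun x => (e x * k x)%:E) &
        (\int[rho]_c \int[leb]_(t in `[0%R, 1%R]) (e (cpath (c : curve X) t))%:E =
         \int[m]_x (e x * k x)%:E)%E].
  move=> me e0 eN.
  have meE : measurable_fun setT (EFin \o e) by exact/measurable_EFinP.
  have bare := bar (EFin \o e) meE (fun x => e0 x).
  have iek : m.-integrable setT (fun x => (e x * k x)%:E).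
    apply: (le_integrable _ _ _ (integrableZl measurableT N ik)) => //.
      exact/measurable_EFinP/measurable_funM.
    move=> x _; rewrite -EFinM !abse_EFin lee_fin !normrM ler_wpM2r// (le_trans (eN x))//.
    exact: ler_norm.
  have eq1 : (\int[rho]_c \int[leb]_(t in `[0%R, 1%R]) (e (cpath (c : curve X) t))%:E =
         \int[m]_x (e x * k x)%:E)%E.
    by rewrite bare; apply: eq_integral => x _; rewrite EFinM.
  split => //.
  - move=> c; apply: (bounded_integrable (M := N)) => //.
    + by rewrite [X in (X < _)%E]lebesgue_itvcc ?ler01// ltry.
    + by apply: measurable_funTS; apply: (measurableT_comp me); exact: measurable_cpath.
  - apply/integrableP; split.
      exact: (measurable_integral_unit (measurableT_comp meE (measurable_eval sX)) (fun p => e0 _)).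
    rewrite (eq_integral (fun c : borel (curve X) =>
        \int[leb]_(t in `[0%R, 1%R]) (e (cpath (c : curve X) t))%:E)%E); last first.
      by move=> c _; rewrite gee0_abs//; apply: integral_ge0 => t _; rewrite lee_fin.
    by rewrite eq1; apply: integrable_lty.
have [ip1 ip2 ip3 ip4] := inner fp mfp fp0 fpN.
have [in1 in2 in3 in4] := inner fn mfn fn0 fnN.
transitivity (\int[rho]_c (\int[leb]_(t in `[0%R, 1%R]) (fp (cpath (c : curve X) t))%:E -
    \int[leb]_(t in `[0%R, 1%R]) (fn (cpath (c : curve X) t))%:E))%E.
  apply: eq_integral => c _; rewrite -integralB//; [|exact: ip1|exact: in1].
  by apply: eq_integral => t _; rewrite -EFinB -fE.
rewrite integralB// ip4 in4 -integralB//.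
by apply: eq_integral => x _; rewrite -EFinB -mulrBl -fE.
Qed.

End barycenter_criteria.

(** * Plans with bounded parametric barycenter *)

Section reparametrized_plan.
Context (R : realType) (X : completeMetricType R).
Local Notation leb := (@lebesgue_measure R).
Hypothesis sX : separable_space X.
Variables (m : {finite_measure set (borel X) -> \bar R}) (q : R).
Hypothesis q1 : 1 < q.

(** |h| is at most 1 + |h|^q, and the measure is finite. *)
Lemma Lfun_integrable1 (h : borel X -> R) : h \in Lfun m q%:E -> m.-integrable setT (EFin \o h).
Proof.
move=> hL; have iq := Lfun_integrable (ltW q1) hL.
have mh : measurable_fun setT h by move: hL; rewrite inE => /andP[/[!inE]].
have i1 : m.-integrable setT (EFin \o cst 1).
  exact: finite_measure_integrable_cst.
apply: (le_integrable _ _ _ (integrableD measurableT i1 iq)) => //.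
  exact/measurable_EFinP.
move=> x _; rewrite /= lee_fin [leRHS]ger0_norm ?addr_ge0 ?powR_ge0//.
have [h1|h1] := leP `|h x| 1; first by rewrite (le_trans h1)// ler_wpDr// powR_ge0.
rewrite ler_wpDl// -[leLHS]powRr1//; apply: ler_powR; exact: ltW.
Qed.

Lemma bounded_density_plan (sigma : probability (borel (curve X)) R) (G : set (curve X)) (L : R)
    (h : borel X -> R) :
  (forall g, G g -> abs_cont g) -> concentrated sigma G ->
  {ae sigma, forall g, has_lipschitz_constant L g} ->
  h \in Lfun m q%:E -> parametric_barycenter m sigma h ->
  exists rho : probability (borel (curve X)) R,
    [/\ finite_energy q rho,
        (exists2 h : borel X -> R, h \in Lfun m +oo%E & parametric_barycenter m rho h) &
        exists S : set (curve X),
          [/\ souslin R S, S `<=` equivalent_curves G & concentrated rho S]].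
Proof.
move=> GAC [N1 [mN1 N10 GN1]] [N2 [mN2 N20 LN2]] hLq bar.
have ih := Lfun_integrable1 hLq.
have mh : measurable_fun setT h by have /integrableP[/measurable_EFinP] := ih.
pose g (x : borel X) := Num.max `|h x| 1.
have g1 x : 1 <= g x by rewrite /g le_max lexx orbT.
have g0 x : 0 < g x by rewrite (lt_le_trans ltr01).
have mg : measurable_fun setT g.
  by apply: measurable_maxr => //; exact: measurableT_comp.
(* Written as a real power so that w^(1-q) becomes g^(q-1) by the rule for iterated powers. *)
pose w (x : borel X) := g x `^ (-1).
have wE x : w x = (g x)^-1 by rewrite /w powR_inv1// ltW.
have mw : measurable_fun setT w by apply: (measurableT_comp (measurable_powR _)).
have w0 x : 0 < w x by rewrite wE invr_gt0.
have w1 x : w x <= 1 by rewrite wE invf_le1.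
have hbar := barycenter_ge0 sX ih bar.
pose hp (x : borel X) := Num.max (h x) 0.
have mhp : measurable_fun setT hp by exact: measurable_maxr.
have hp0 x : 0 <= hp x by rewrite /hp le_max lexx orbT.
have hpg x : hp x <= g x.
  by rewrite /hp ge_max (ltW (g0 x)) andbT /g le_max ler_norm.
pose A (c : borel (curve X)) := elapsed w (c : curve X) 1.
have mA : measurable_fun setT A by exact: measurable_elapsed.
have A0 c : 0 < A c by exact: elapsed_gt0.
have A1 c : A c <= 1 by exact: elapsed_le1.
pose T := time_change sX mw w0 w1 : borel (curve X) -> borel (curve X).
have mT : measurable_fun setT T by exact: measurable_time_change.
have Afin : (\int[sigma]_c (A c)%:E < +oo)%E.
  apply: (@le_lt_trans _ _ (\int[sigma]_c (cst 1%E c))%E); last first.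
    by rewrite integral_cst//= mul1e probability_setT ltry.
  apply: ge0_le_integral => //.
  - by move=> c _; rewrite lee_fin ltW.
  - exact/measurable_EFinP.
  - by move=> c _; rewrite lee_fin.
have [Z Z0 [Q Q0 QE]] := weighted_probability mA A0 Afin.
have [|rho rhoE rhoI] := @measure_probability _ _ _ (push_measure Q mT).
  by rewrite /= /push_measure preimage_setT probability_setT.
have rho_int F : measurable_fun setT F -> (forall c, 0 <= F c)%E ->
    (\int[rho]_c F c = Z^-1%:E * \int[sigma]_c (F (T c) * (A c)%:E))%E.
  move=> mF F0; rewrite rhoI ge0_integral_push// QE//.
  exact: (measurableT_comp mF mT).
(* The density of the new barycenter: h^+ <= g bounds it by 1 / Z. *)
pose k (x : borel X) := Z^-1 * (w x * hp x).
have k0 x : 0 <= k x <= Z^-1.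
  rewrite mulr_ge0 ?invr_ge0 ?(ltW Z0) ?mulr_ge0 ?(ltW (w0 x))//=.
  rewrite ler_piMr ?invr_ge0 ?(ltW Z0)// wE mulrC.
  by rewrite -[X in _ <= X](divff (lt0r_neq0 (g0 x))) ler_pM2r// invr_gt0.
have mk : measurable_fun setT k.
  by apply: measurable_funM => //; exact: measurable_funM.
have rho_bar : parametric_barycenter m rho k.
  have finm : (m setT < +oo)%E by rewrite -ge0_fin_numE ?measure_ge0//; exact: fin_num_measure.
  apply: (parametric_barycenter_ge0 sX); last move=> f mf f0.
  - apply: (bounded_integrable (M := Z^-1)) => // x.
    by have /andP[kx0 kx] := k0 x; rewrite ger0_norm.
  - by move=> x; have /andP[] := k0 x.
  have mfe := measurableT_comp mf (measurable_eval sX).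
  rewrite rho_int; last 2 first.
  - exact: (measurable_integral_unit mfe (fun p => f0 _)).
  - by move=> c; apply: integral_ge0.
  under eq_integral => c _ do rewrite muleC time_change_integral//.
  rewrite (hbar (fun x => f x * (w x)%:E)%E); last 2 first.
  - by apply: emeasurable_funM => //; exact/measurable_EFinP.
  - by move=> x; rewrite mule_ge0// lee_fin ltW.
  rewrite -ge0_integralZl_EFin//; last 3 first.
  - by move=> x _; rewrite mule_ge0 ?lee_fin ?hp0// mule_ge0// lee_fin ltW.
  - by apply: emeasurable_funM; [apply: emeasurable_funM => //|]; exact/measurable_EFinP.
  - by rewrite invr_ge0 ltW.
  by apply: eq_integral => x _; rewrite /k (EFinM Z^-1) (EFinM (w x)) -[X in (_ * X)%E = _]muleA [LHS]muleCA.
(* The energy bound of T c up to the factor L^q A^(q-1). Its integral against sigma is that of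
   g^(q-1) h^+ against m. *)
pose K (c : borel (curve X)) := (\int[leb]_(t in `[0%R, 1%R]) (w (cpath (c : curve X) t) `^ (1 - q))%:E)%E.
have mwq : measurable_fun setT (fun x => (w x `^ (1 - q))%:E).
  by apply/measurable_EFinP; exact: (measurableT_comp (measurable_powR _)).
have mK : measurable_fun setT K.
  apply: (measurable_integral_unit (measurableT_comp mwq (measurable_eval sX))).
  by move=> p; rewrite /= lee_fin powR_ge0.
have K0 c : (0 <= K c)%E by apply: integral_ge0 => t _; rewrite lee_fin powR_ge0.
have Kfin : (\int[sigma]_c K c < +oo)%E.
  rewrite [X in (X < _)%E](hbar _ mwq); last by move=> x; rewrite lee_fin powR_ge0.
  have i1 : m.-integrable setT (EFin \o cst 1).
    exact: finite_measure_integrable_cst.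
  have := integrable_lty measurableT (integrableD measurableT i1 (Lfun_integrable (ltW q1) hLq)).
  apply: le_lt_trans; apply: ge0_le_integral => //.
  - by move=> x _; rewrite -EFinM lee_fin mulr_ge0 ?powR_ge0 ?hp0.
  - by apply: emeasurable_funM => //; exact/measurable_EFinP.
  - apply/measurable_EFinP; apply: measurable_funD => //.
    apply: (measurableT_comp (measurable_powR _)); exact: measurableT_comp.
  move=> x _; rewrite /= -EFinM -EFinD lee_fin.
  rewrite /w -powRrM mulN1r opprB; apply: (@le_trans _ _ (g x `^ q)).
    have -> : g x `^ q = g x `^ (q - 1) * g x.
      rewrite -[in X in _ * X](powRr1 (ltW (g0 x))) -powRD ?subrK//.
      by rewrite (gt_eqF (g0 x)) implybT.
    by rewrite ler_wpM2l ?powR_ge0//; exact: hpg.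
  rewrite {1}/g; case: (leP `|h x| 1) => h1; first by rewrite powR1 ler_wpDr// powR_ge0.
  by rewrite ler_wpDl.
have Koo : measurable [set c | K c = +oo%E].
  by have := mK measurableT _ (emeasurable_set1 +oo%E); rewrite setTI.
have iK : sigma.-integrable setT K.
  apply/integrableP; split => //; under eq_integral do rewrite gee0_abs//.
  exact: Kfin.
(* A Borel set of full sigma-measure on which c is in G and L-Lipschitz and the energy bound of T c
   is finite. *)
pose B := ~` N1 `&` ~` N2 `&` [set c | (K c < +oo)%E].
have BoE : [set c | (K c < +oo)%E] = ~` [set c | K c = +oo%E].
  apply/seteqP; split => c /=; first by move=> + E; rewrite E ltxx.
  by move/eqP; rewrite ltey.
have mB : measurable B.
  by rewrite /B BoE; do !apply: measurableI; exact: measurableC.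
have sB : sigma (~` B) = 0%E.
  apply/negligibleP; first exact: measurableC.
  have NK : sigma.-negligible [set c | K c = +oo%E].
    have := integrable_ae measurableT iK; apply: negligibleS => c /= -> /(_ Logic.I).
    by rewrite fin_numE.
  have NN1 : sigma.-negligible N1 by exists N1; split.
  have NN2 : sigma.-negligible N2 by exists N2; split.
  apply: negligibleS (negligibleU (negligibleU NN1 NN2) NK) => c.
  by rewrite /B BoE -!setCU setCK.
have BP c : B c -> [/\ G c, has_lipschitz_constant L c & (K c < +oo)%E].
  move=> [[n1 n2] Kc]; split => //.
    by apply: contrapT => nG; apply: n1; exact: GN1.
  by apply: contrapT => nL; apply: n2; exact: LN2.
have [x /[dup] xd /curve_dense_seq[y yd]] := separable_dense_seq sX.
(* The exhaustion is taken for Q, whose image under T is rho; so S lies in the image of B and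
   carries rho. *)
have [S [Ssou mS ST QS]] := souslin_borel_image Q yd yd mT mB.
have rhoS : rho (~` S) = 0%E.
  rewrite rhoE /= /push_measure.
  have QB : Q (~` B) = 0%E by apply: Q0 => //; exact: measurableC.
  have mTS : measurable (T @^-1` S) by rewrite -[X in measurable X]setTI; exact: (mT).
  apply/negligibleP; first by rewrite preimage_setC; exact: measurableC.
  have N1' : Q.-negligible (B `\` T @^-1` S).
    by exists (B `\` T @^-1` S); split => //; exact: measurableD.
  have N2' : Q.-negligible (~` B) by exists (~` B); split => //; exact: measurableC.
  apply: negligibleS (negligibleU N1' N2') => c /= nS.
  by have [Bc|nBc] := pselect (B c); [left|right].
pose E (e : borel (curve X)) := (\int[leb]_(t in `[0%R, 1%R]) (speed (e : curve X) t `^ q))%E.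
have mE : measurable_fun setT E.
  apply: (measurable_integral_unit (measurableT_comp (measurable_poweR q) (measurable_speed sX))).
  by move=> p; exact: poweR_ge0.
have E0 e : (0 <= E e)%E by apply: integral_ge0 => t _; exact: poweR_ge0.
have SP e : S e -> ACq_curve q e /\ equivalent_curves G e.
  move=> /ST[c Bc <-]; have [Gc Lc Kc] := BP _ Bc; have acc := GAC _ Gc.
  have acT : abs_cont (T c : curve X) by exact: time_change_abs_cont.
  split.
    split; first exact: acT.
    apply: le_lt_trans (time_change_energy _ _ _ _ q1 Lc) _.
    by rewrite !lte_mul_pinfty// ?lee_fin ?powR_ge0// fin_numE.
  split => //; exists (c : curve X); split => //; exact: time_change_equiv.
exists rho; split.
- split.
    exists (~` S); split => //; first exact: measurableC.
    by move=> e /=; apply: contra_not => /SP[].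
  apply: (@le_lt_trans _ _ (\int[rho]_e E e)%E).
    apply: ge0_integral_ae_ub => //.
      move=> e _; rewrite /energy; case: ifPn => _; last exact: leey.
      by apply: integral_ge0 => t _; rewrite lee_fin powR_ge0.
    exists (~` S); split => //; first exact: measurableC.
    move=> e /=; apply: contra_not => /SP[ACqe _] _.
    by rewrite /energy (asboolT ACqe) (power_integralE _ sX ACqe.1).
  rewrite rho_int//.
  apply: (@le_lt_trans _ _ (Z^-1%:E * \int[sigma]_c ((L `^ q)%:E * K c))%E).
    rewrite lee_wpmul2l ?lee_fin ?invr_ge0 ?(ltW Z0)//.
    apply: ae_ge0_le_integral => //.
    - by move=> c _; rewrite mule_ge0// lee_fin ltW.
    - apply: emeasurable_funM; first exact: (measurableT_comp mE mT).
      exact/measurable_EFinP.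
    - by move=> c _; rewrite mule_ge0// lee_fin powR_ge0.
    - exact: emeasurable_funM.
    exists (~` B); split => //; first exact: measurableC.
    move=> c /=; apply: contra_not => /BP[Gc Lc _] _.
    have acT : abs_cont (T c : curve X) by apply: time_change_abs_cont; exact: GAC.
    (* Since A <= 1, the weight A is dropped here, and the factor A^(q-1) below. *)
    apply: (@le_trans _ _ (E (T c))); first by rewrite -[leRHS]mule1 lee_wpmul2l// lee_fin.
    rewrite /E -power_integralE//; apply: (le_trans (time_change_energy _ _ _ _ q1 Lc)).
    rewrite lee_wpmul2l ?lee_fin ?powR_ge0// -[leRHS]mul1e lee_wpmul2r//; first exact: K0.
    have one : (1 : R) `^ (q - 1) = 1 by rewrite powR1.
    rewrite lee_fin -[leRHS]one; apply: ge0_ler_powR => //.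
    - by rewrite subr_ge0 ltW.
    - by rewrite nnegrE; exact: ltW (A0 c).
    - by rewrite nnegrE.
    - exact: A1.
  rewrite ge0_integralZl_EFin ?powR_ge0//.
  by rewrite !lte_mul_pinfty// ?lee_fin ?powR_ge0 ?invr_ge0 ?(ltW Z0)// fin_numE.
- by exists k => //; apply: (bounded_Lfun m mk (M := Z^-1)) => z; have /andP[kz0 kz] := k0 z; rewrite ger0_norm.
- exists S; split => //; first by move=> e /SP[].
  by exists (~` S); split => //; exact: measurableC.
Qed.

End reparametrized_plan.

(** * The Borel set of constant speed curves *)

Section constant_speed_curves.
Context (R : realType) (X : completeMetricType R).
Local Notation leb := (@lebesgue_measure R).
Local Notation I := (unit_interval R).
Hypothesis sX : separable_space X.
Implicit Types (g : curve X).

Lemma closed_lipschitz_constant (L : R) : closed [set g : curve X | has_lipschitz_constant L g].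
Proof.
rewrite (_ : [set _ | _] = \bigcap_(p in [set: I * I])
    [set g : curve X | mdist (g p.1) (g p.2) <= L * `|val p.1 - val p.2|]).
  apply: closed_bigI => p _.
  rewrite (_ : [set _ | _] = (fun g : curve X => vsum g [:: p]) @^-1`
      [set r | r <= L * `|val p.1 - val p.2|]).
    by apply: closed_comp; [move=> g _; exact: vsum_continuous|exact: closed_le].
  by apply/seteqP; split => g; rewrite /= /vsum big_seq1.
by apply/seteqP; split => g; [move=> gL p _; exact: gL|move=> gL s t; exact: (gL (s, t) Logic.I)].
Qed.

Lemma measurable_mvariation a b :
  measurable_fun setT (fun g : borel (curve X) => mvariation (g : curve X) a b).
Proof.
apply: (@measurability _ _ (borel (curve X)) _ setT _ _
  (measurable_realfun.ErealGenOInfty.measurableE R)) => _ [_ [r ->] <-].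
rewrite setTI; apply: open_borel.
rewrite (_ : _ @^-1` _ = [set g : curve X | (r%:E < mvariation g a b)%E]).
  exact: open_lt_mvariation.
by apply/seteqP; split => g; rewrite /= in_itv/= andbT.
Qed.

Lemma closed_rat (A : set R) : closed A -> (forall a : rat, A (ratr a)) -> forall x, A x.
Proof.
move=> cA Aq x; apply: contrapT => nAx.
have : nbhs x (~` A) by apply: open_nbhs_nbhs; split => //; exact: closed_openC.
rewrite -nbhs_ballE => -[e /= e0 xA].
have /rat_in_itvoo[a] : x - e < x + e by rewrite ltrD2l gtrN.
rewrite in_itv/= => /andP[a1 a2]; apply: (xA (ratr a)) => //.
by rewrite /ball/= ltr_distlC a1.
Qed.

(** A curve has constant speed exactly when its total variation L is positive and finite and is a
    Lipschitz constant: the variations on [0, t] and [t, 1] are then at most L t and L (1 - t) and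
    add up to L, so both bounds are equalities. Testing the Lipschitz bound at rational times makes
    the condition countable. *)
Lemma measurable_ACc_curve : measurable (@ACc_curve R X : set (borel (curve X))).
Proof.
pose V (g : borel (curve X)) := mvariation (g : curve X) (clamp 0%R : I) (clamp 1%R : I).
have mV : measurable_fun setT V by exact: measurable_mvariation.
have mfV : measurable_fun setT (fine \o V) by exact: measurableT_comp.
pose D (p : rat * rat) := [set g : borel (curve X) |
  mdist (cpath (g : curve X) (ratr p.1)) (cpath (g : curve X) (ratr p.2)) <=
    fine (V g) * `|val (clamp (ratr p.1) : I) - val (clamp (ratr p.2) : I)|].
have -> : (@ACc_curve R X : set (borel (curve X))) = [set g | (0 < V g)%E] `&` ([set g | (V g < +oo)%E] `&`
    \bigcap_(p in [set: rat * rat]) D p).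
  apply/seteqP; split => g.
    move=> /(ACc_curveP sX)[L L0 cg].
    have VL : V g = L%:E by rewrite /V cg !val_clamp ?lexx ?ler01// subr0 mulr1.
    rewrite /= VL lte_fin ltry; split => //; split => // p _; rewrite /D/= VL.
    exact: constant_speed_lipschitz.
  move=> [V0 [Vfin Dg]]; apply/(ACc_curveP sX); set L := fine (V g).
  have VL : V g = L%:E by rewrite /L fineK// ge0_fin_numE// ltW.
  have L0 : 0 < L by rewrite -lte_fin -VL.
  have clos (k : curve X) (x : X) (y : R) : closed [set b : R |
      mdist x (cpath k b) <= L * `|y - val (clamp b : I)|].
    rewrite (_ : [set _ | _] = (fun b => mdist x (cpath k b) - L * `|y - val (clamp b : I)|) @^-1` [set r | r <= 0]).
      apply: closed_comp; last exact: closed_le.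
      move=> b _; apply: cvgB.
        by apply: continuous_comp; [exact: cpath_continuous|exact: mdist_continuous].
      apply: cvgM; first exact: cvg_cst.
      apply: (@cvg_norm R R^o); apply: cvgB; first exact: cvg_cst.
      by apply: continuous_comp; [exact: clamp_continuous|exact: val_continuous].
    by apply/seteqP; split => b; rewrite /= subr_le0.
  (* Rational times are replaced by real ones in one argument at a time. *)
  have lip1 (a : rat) (b : R) : mdist (cpath g (ratr a)) (cpath g b) <=
      L * `|val (clamp (ratr a) : I) - val (clamp b : I)|.
    apply: (closed_rat (clos (g : curve X) (cpath g (ratr a)) (val (clamp (ratr a) : I)))) => c.
    exact: (Dg (a, c) Logic.I).
  have lip : has_lipschitz_constant L g.
    move=> s t; rewrite -(clamp_val s) -(clamp_val t) metric_sym distrC.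
    apply: (closed_rat (clos (g : curve X) (g (clamp (val t))) (val (clamp (val t) : I)))) => c.
    by have := lip1 c (val t); rewrite metric_sym distrC.
  have acg := lipschitz_abs_cont lip.
  have lipW (x y : I) : val x <= val y -> mdist (g x) (g y) <= L * val y - L * val x.
    by move=> xy; have := lip x y; rewrite distrC ger0_norm ?subr_ge0// mulrBr.
  have vL : vfun g (clamp 1) = L by [].
  exists L => //; apply: vfun_constant_speed => // t.
  have /andP[t0 t1] := unit_intervalP t.
  have e0 : val (clamp 0 : I) = 0 by rewrite val_clamp ?lexx ?ler01.
  have e1 : val (clamp 1 : I) = 1 by rewrite val_clamp ?lexx ?ler01.
  have := vfun_minimal acg lipW (s := clamp 0) (t := t); rewrite e0 => /(_ t0).
  have := vfun_minimal acg lipW (s := t) (t := clamp 1); rewrite e1 => /(_ t1).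
  rewrite vfun_clamp0 vL mulr0 mulr1 !subr0 => H1 H2.
  by apply/eqP; rewrite eq_le H2/=; move: H1; rewrite lerD2l lerN2.
apply: measurableI.
  rewrite (_ : [set _ | _] = V @^-1` `]0%E, +oo[%classic).
    by rewrite -[X in measurable X]setTI; apply: (mV) => //; exact: emeasurable_itv.
  by apply/seteqP; split => g; rewrite /= in_itv/= andbT.
apply: measurableI.
  rewrite (_ : [set _ | _] = V @^-1` `]-oo, +oo%E[%classic).
    by rewrite -[X in measurable X]setTI; apply: (mV) => //; exact: emeasurable_itv.
  by apply/seteqP; split => g; rewrite /= in_itv.
apply: bigcap_measurable_countType => p _.
have mc (a : R) : measurable_fun setT (fun g : borel (curve X) => cpath (g : curve X) a : borel X).
  exact: (measurable_fun_pair1 a (measurable_eval sX)).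
have mdd := measurable_mdist2 sX (mc (ratr p.1)) (mc (ratr p.2)).
have mB := measurable_funB mdd (measurable_funM mfV (measurable_cst
  (`|val (clamp (ratr p.1) : I) - val (clamp (ratr p.2) : I)|))).
have := mB measurableT _ (measurable_itv `]-oo, 0%R]); rewrite setTI; congr measurable.
by apply/seteqP; split => g; rewrite /D /= in_itv/= subr_le0.
Qed.

Lemma j_map_inj : injective (@j_map R X).
Proof.
move=> c d jcd; have [_ [g gc ->]] := j_map_spec sX c; have [_ [h hd ->]] := j_map_spec sX d.
by congr (\pi _); apply: val_inj; rewrite gc hd.
Qed.

Lemma i_map_j_map c0 (c : nonparam X) : i_map c0 (j_map c) = c.
Proof.
have jc := (j_map_spec sX c).1; have a0 := ACc_AC0 sX jc.
apply: j_map_inj; rewrite i_map_spec//; first by rewrite ACc_karc.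
  exact: a0.1.
exact: AC0_length.
Qed.

Lemma j_map_i_map c0 g : ACc_curve g -> j_map (i_map c0 g) = g.
Proof.
move=> gc; have a0 := ACc_AC0 sX gc; rewrite i_map_spec ?ACc_karc//; first exact: a0.1.
exact: AC0_length.
Qed.

Lemma J_measure_ACc g (B : set (borel X)) : ACc_curve g -> measurable B ->
  J_measure g B =
  (curve_length g * \int[leb]_(t in `[0%R, 1%R]) (\1_B (cpath g t : borel X) : R)%:E)%E.
Proof.
move=> /(ACc_curveP sX)[L L0 cg] mB.
rewrite J_measureE//; last exact: constant_speed_abs_cont cg.
rewrite (constant_speed_length sX cg).
have mI : measurable_fun setT (fun t => (\1_B (cpath g t : borel X) : R)%:E).
  apply/measurable_EFinP; apply: (measurableT_comp (measurable_indic mB)).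
  exact: measurable_cpath.
rewrite -ge0_integralZl//; last 2 first.
- by apply: measurable_funTS; exact: mI.
- by rewrite lee_fin ltW.
apply: ae_eq_integral => //.
- by apply: measurable_funTS; apply: emeasurable_funM; [exact: mI|exact: measurable_speed_curve].
- by apply: measurable_funTS; apply: emeasurable_funM.
- apply: ae_mono (constant_speed_derivative sX cg) => t H.
  have H' : `[0%R, 1%R]%classic t -> 0 <= t <= 1 by rewrite /= in_itv.
  by move=> /H'/H[_ ->]; rewrite muleC.
Qed.

End constant_speed_curves.

Lemma Lfun_of_integral d (T : measurableType d) (R : realType)
    (m : {measure set T -> \bar R}) (q : R) (f : T -> R) : measurable_fun setT f ->
  (\int[m]_x (`|f x| `^ q)%:E < +oo)%E -> f \in Lfun m q%:E.
Proof.
move=> mf fq; rewrite inE; apply/andP; split; rewrite inE//=.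
rewrite /finite_norm unlock /Lnorm; apply: poweR_lty.
exact: fq.
Qed.

(** * From non-parametric to parametric plans *)

Section constant_speed_plan.
Context (R : realType) (X : completeMetricType R).
Local Notation leb := (@lebesgue_measure R).
Hypothesis sX : separable_space X.
Variables (m : {finite_measure set (borel X) -> \bar R}) (q : R).
Hypothesis q1 : 1 < q.

(** J of a constant speed curve is its length l times its occupation measure. Weighting by l / Z
    therefore turns the barycenter g of J into the parametric barycenter g / Z. *)
Lemma nonparam_plan (c0 : nonparam X) (ppi : probability (borel (pnonparam c0)) R)
    (G : set (nonparam X)) (g : borel X -> R) (M : R) :
  g \in Lfun m q%:E -> barycenter m ppi g ->
  {ae ppi, forall c, (nonparam_length c <= M%:E)%E} ->
  concentrated ppi G ->
  exists (sigma : probability (borel (curve X)) R) (h : borel X -> R),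
    [/\ concentrated sigma (@j_map R X @` G),
        {ae sigma, forall c, has_lipschitz_constant M c},
        h \in Lfun m q%:E & parametric_barycenter m sigma h].
Proof.
move=> gL bar [N1 [mN1 N10 lN1]] [N2 [mN2 N20 GN2]].
have ig := Lfun_integrable1 q1 gL.
have mg : measurable_fun setT g by have /integrableP[/measurable_EFinP] := ig.
pose j (c : borel (pnonparam c0)) : borel (curve X) := j_map c.
have mj : measurable_fun setT j by exact: measurable_j_map.
have jc c : ACc_curve (j c : curve X) := (j_map_spec sX c).1.
have jac c : abs_cont (j c : curve X) := (ACc_AC0 sX (jc c)).1.
pose l (c : borel (pnonparam c0)) : R := vfun (j c : curve X) (clamp 1).
have l0 c : 0 < l c by exact/AC0_length/ACc_AC0/jc.
have lE c : curve_length (j c : curve X) = (l c)%:E by rewrite curve_lengthE.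
have ml : measurable_fun setT l.
  apply: measurableT_comp => //.
  exact: (measurableT_comp (@measurable_mvariation R X (clamp 0) (clamp 1)) mj).
have int1 (B : set (borel X)) : measurable B ->
    (\int[ppi]_c ((\int[leb]_(t in `[0%R, 1%R]) (\1_B (cpath (j c : curve X) t : borel X) : R)%:E) * (l c)%:E)
     = \int[m]_(x in B) (g x)%:E)%E.
  move=> mB; rewrite -bar//; apply: eq_integral => c _.
  rewrite (J_measure_representative sX c mB) (J_measure_ACc sX (jc c) mB) lE.
  by rewrite muleC.
have lfin : (\int[ppi]_c (l c)%:E < +oo)%E.
  rewrite (_ : (\int[ppi]_c _ = \int[m]_(x in setT) (g x)%:E)%E); last first.
    rewrite -int1//; apply: eq_integral => c _; rewrite indicT.
    have -> : (\int[leb]_(x in `[0%R, 1%R]) (cst 1 (cpath (j c : curve X) x))%:E = 1)%E.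
      transitivity (\int[leb]_(x in `[0%R, 1%R]) (cst 1%E x))%E => //.
      rewrite integral_cst// mul1e.
      by rewrite [LHS]lebesgue_itvcc ?ler01// subr0.
    by rewrite mul1e.
  have := integrable_fin_num measurableT ig; rewrite fin_numElt => /andP[_].
  exact.
have [Z Z0 [Q Q0 QE]] := weighted_probability ml l0 lfin.
have [|sigma sE sI] := @measure_probability _ _ _ (push_measure Q mj).
  by rewrite /= /push_measure preimage_setT probability_setT.
have sigma_int F : measurable_fun setT F -> (forall c, 0 <= F c)%E ->
    (\int[sigma]_c F c = Z^-1%:E * \int[ppi]_c (F (j c) * (l c)%:E))%E.
  move=> mF F0; rewrite sI ge0_integral_push// QE//.
  exact: (measurableT_comp mF mj).
have [nu nuE] := occupation_measure sX sigma.
have nuB (B : set (borel X)) : measurable B -> nu B = (Z^-1%:E * \int[m]_(x in B) (g x)%:E)%E.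
  move=> mB; have mI : measurable_fun setT (fun x : borel X => (\1_B x : R)%:E).
    exact/measurable_EFinP/measurable_indic.
  rewrite -int1// -[B in LHS]setIT -integral_indic// nuE//.
  rewrite sigma_int//; last by move=> c; apply: integral_ge0 => t _; rewrite lee_fin.
  by apply: (measurable_integral_unit (measurableT_comp mI (measurable_eval sX))) => p; rewrite /= lee_fin.
(* g is only known through its integrals, so it may be negative on a set that is null for the
   occupation measure; the positive part gives a density nonnegative everywhere. *)
pose gp (x : borel X) := Num.max (g x) 0.
have mgp : measurable_fun setT gp by exact: measurable_maxr.
have gp0 x : 0 <= gp x by rewrite /gp le_max lexx orbT.
pose h (x : borel X) := Z^-1 * gp x.
have mh : measurable_fun setT h by exact: measurable_funM.
have h0 x : 0 <= h x by rewrite mulr_ge0// invr_ge0 ltW.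
have nuh (B : set (borel X)) : measurable B -> nu B = (\int[m]_(x in B) (h x)%:E)%E.
  move=> mB; pose N := [set x : borel X | g x < 0].
  have mN : measurable N.
    rewrite (_ : N = g @^-1` `]-oo, 0%R[%classic); last by apply/seteqP; split => x; rewrite /N/= in_itv.
    by rewrite -[X in measurable X]setTI; apply: (mg) => //; exact: measurable_itv.
  have nuN : nu N = 0%E.
    apply/eqP; rewrite eq_le measure_ge0 andbT nuB//.
    rewrite mule_ge0_le0 ?lee_fin ?invr_ge0 ?(ltW Z0)//.
    rewrite -(integral0 m N); apply: le_integral => //.
    - exact: integrableS ig.
    - by apply: (@integrableS _ _ _ m setT) => //; exact: integrable0.
    - by move=> x Nx; rewrite lee_fin ltW//; apply: set_mem Nx.
  have nuBN : nu B = nu (B `\` N).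
    have BN0 : nu (B `&` N) = 0%E.
      apply/eqP; rewrite eq_le measure_ge0 andbT -nuN le_measure ?inE//.
      exact: measurableI.
    apply: (etrans (measureDI nu mB mN)); rewrite -[RHS]adde0.
    by apply: f_equal2; [|exact: BN0].
  pose mH := density_measure m mh h0.
  have mHB : mH B = mH (B `\` N).
    apply: (etrans (measureDI mH mB mN)); rewrite -[RHS]adde0.
    apply: f_equal2 => //; rewrite /mH/= /density_measure integral0_eq// => x [_ Nx].
    by rewrite /h /gp max_r ?mulr0// ltW.
  rewrite nuBN -[RHS]/(mH B) mHB nuB; last exact: measurableD.
  rewrite /mH/= /density_measure.
  under [RHS]eq_integral do rewrite EFinM.
  have mBN : measurable (B `\` N) by exact: measurableD.
  rewrite ge0_integralZl_EFin//; last 3 first.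
  - by move=> x _; rewrite lee_fin.
  - exact/measurable_EFinP/measurable_funTS.
  - by rewrite invr_ge0 ltW.
  congr (_ * _)%E; apply: eq_integral => x /set_mem[_ /negP]; rewrite -leNgt => gx.
  by rewrite /gp max_l.
have hL : h \in Lfun m q%:E.
  apply: Lfun_of_integral => //.
  have ig2 := integrableZl measurableT (Z^-1 `^ q) (Lfun_integrable (ltW q1) gL).
  have := integrable_lty measurableT ig2; apply: le_lt_trans.
  apply: ge0_le_integral => //.
  - apply/measurable_EFinP; apply: (measurableT_comp (measurable_powR _)); exact: measurableT_comp.
  - apply: emeasurable_funM => //; apply/measurable_EFinP.
    apply: (measurableT_comp (measurable_powR _)); exact: measurableT_comp.
  move=> x _; rewrite -EFinM lee_fin -powRM ?invr_ge0 ?(ltW Z0)//.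
  apply: ge0_ler_powR; rewrite ?nnegrE ?mulr_ge0 ?invr_ge0 ?(ltW Z0) ?(ltW (lt_trans ltr01 q1))//.
  rewrite ger0_norm// ler_wpM2l ?invr_ge0 ?(ltW Z0)//.
  by rewrite /gp ge_max normr_ge0 ler_norm.
have ih := Lfun_integrable1 q1 hL.
exists sigma, h; split => //.
- have mA := measurable_ACc_curve sX.
  have mi : measurable_fun setT ((fun g => if `[< ACc_curve (g : curve X) >] then i_map c0 g else c0) :
      borel (curve X) -> borel (pnonparam c0)).
    apply: measurable_i_map => // c ac; have a0 := ACc_AC0 sX ac; split; first exact: a0.1.
    exact: AC0_length.
  set i' := (fun g => _) in mi.
  (* The image of G under j need not be Borel. Its complement is enclosed in a Borel null set by
     means of i, which inverts j on constant speed curves. *)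
  exists (~` (@ACc_curve R X) `|` i' @^-1` N2); split.
  + apply: measurableU; first exact: measurableC.
    by rewrite -[X in measurable X]setTI; exact: mi.
  + apply: (etrans (sE _)); rewrite /= /push_measure (_ : _ @^-1` _ = N2); first by apply: Q0.
    apply/seteqP; split => c; rewrite /preimage/= /i'.
      by case=> [/(_ (jc c))//|]; rewrite asboolT ?i_map_j_map//; exact: jc.
    by move=> Nc; right; rewrite asboolT ?i_map_j_map//; exact: jc.
  + move=> e /= nGe; have [ac|nac] := pselect (ACc_curve (e : curve X)); last by left.
    right; rewrite /i' asboolT//; apply: GN2 => /= Gi; apply: nGe.
    by exists (i_map c0 e) => //; exact: j_map_i_map.
- exists (~` [set c : curve X | has_lipschitz_constant M c]); split => //.
    by apply: measurableC; apply: closed_borel; exact: closed_lipschitz_constant.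
  have mjL : measurable (j @^-1` (~` [set c : curve X | has_lipschitz_constant M c])).
    rewrite -[X in measurable X]setTI; apply: (mj) => //.
    by apply: measurableC; apply: closed_borel; exact: closed_lipschitz_constant.
  apply: (etrans (sE _)); rewrite /= /push_measure; apply: Q0 => //; apply/negligibleP => //.
  have NN1 : ppi.-negligible N1 by exists N1; split.
  (* The length of a constant speed curve is a Lipschitz constant for it. *)
  apply: negligibleS NN1 => c /= nL; apply: lN1 => /= lM; apply: nL => s t.
  have /(ACc_curveP sX)[L L0 cg] := jc c.
  apply: (le_trans (constant_speed_lipschitz cg s t)); rewrite ler_wpM2r// -lee_fin.
  by rewrite -(constant_speed_length sX cg) -nonparam_lengthE.
- apply: (parametric_barycenter_ge0 sX ih h0) => f mf f0.
  rewrite -nuE//.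
  transitivity (\int[density_measure m mh h0]_x f x)%E; last exact: ge0_integral_density.
  by apply: eq_measure_integral => B mB _; exact: nuh.
Qed.

End constant_speed_plan.

(** * Duality and the energy estimate *)

Section finite_measure_of.
Context d (T : measurableType d) (R : realType).

Definition finite_measure_of (mu : {measure set T -> \bar R}) of (mu setT < +oo)%E :
  set T -> \bar R := mu.

Variables (mu : {measure set T -> \bar R}) (muT : (mu setT < +oo)%E).
HB.instance Definition _ := Measure.on (finite_measure_of muT).

Let fin : fin_num_fun (finite_measure_of muT).
Proof.
move=> A mA; rewrite ge0_fin_numE//; apply: (le_lt_trans _ muT).
by apply: le_measure; rewrite ?inE.
Qed.

HB.instance Definition _ := Measure_isFinite.Build _ _ _ (finite_measure_of muT) fin.

End finite_measure_of.

Lemma Lq_duality d (T : measurableType d) (R : realType)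
    (m : {finite_measure set T -> \bar R}) (nu : {measure set T -> \bar R}) (q p C : R) :
  1 < q -> p = q / (q - 1) -> 0 <= C ->
  (forall f : T -> R, measurable_fun setT f -> (forall x, 0 <= f x) ->
    (exists M, forall x, f x <= M) ->
    (\int[nu]_x (f x)%:E <= C%:E * (\int[m]_x (f x `^ p)%:E) `^ p^-1)%E) ->
  exists g : T -> R, [/\ g \in Lfun m q%:E,
    forall B, measurable B -> (nu B = \int[m]_(x in B) (g x)%:E)%E &
    ('N[m]_(q%:E)[EFin \o g] <= C%:E)%E].
Proof.
move=> q1 pE C0 dual.
have q0 : 0 < q by exact: lt_trans q1.
have q10 : 0 < q - 1 by rewrite subr_gt0.
have p0 : 0 < p by rewrite pE divr_gt0.
have pq : (q - 1) * p = q by rewrite pE mulrCA mulfV ?mulr1// gt_eqF.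
have pVqV : p^-1 + q^-1 = 1 by rewrite pE invf_div mulrBl mul1r subrK mulfV// gt_eqF.
(* Testing on indicators gives both that nu is finite and that m dominates it, hence a density. *)
have dualB (B : set T) : measurable B -> (nu B <= C%:E * (m B) `^ p^-1)%E.
  move=> mB; have := dual _ (measurable_indic mB).
  rewrite integral_indic// setIT => -/(_ _ _)/le_trans; apply => //.
    by exists 1 => x; rewrite indicE lern1 leq_b1.
  rewrite le_eqVlt; apply/orP; left; apply/eqP; congr (_ * (_ `^ _))%E.
  rewrite -[in RHS](setIT B) -integral_indic//; apply: eq_integral => x _.
  by rewrite indicE; case: (x \in B); rewrite ?powR1 ?powR0// gt_eqF.
have nuT : (nu setT < +oo)%E.
  apply: (le_lt_trans (dualB _ measurableT)); rewrite ltey_eq; apply/orP; left.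
  by rewrite fin_numM// fin_num_poweR// fin_num_measure.
pose nu' := finite_measure_of nuT.
have dom : nu' `<< m.
  apply/null_content_dominatesP => A mA mA0; apply/eqP; rewrite eq_le measure_ge0 andbT.
  apply: (le_trans (dualB _ mA)); rewrite mA0 poweR0r ?mule0//.
  by rewrite invr_neq0// gt_eqF.
have [f [f0 ffin fi fE]] := radon_nikodym_sigma_finite dom.
pose g x := fine (f x).
have gE x : (g x)%:E = f x by rewrite /g fineK.
have g0 x : 0 <= g x by rewrite -lee_fin gE.
have mg : measurable_fun setT g.
  have gf : EFin \o g = f by apply/funext => x; exact: gE.
  by apply/measurable_EFinP; rewrite gf; exact: (measurable_int _ fi).
have nuE B : measurable B -> (nu B = \int[m]_(x in B) (g x)%:E)%E.
  by move=> mB; under eq_integral do rewrite gE; exact: fE.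
have nuI h : measurable_fun setT h -> (forall x, 0 <= h x)%E ->
    (\int[nu]_x h x = \int[m]_x (h x * (g x)%:E))%E.
  move=> mh h0; rewrite -(ge0_integral_density m mg g0)//.
  by apply: eq_measure_integral => B mB _; exact: nuE.
(* The truncation makes the integral a of k^q finite a priori. The inequality a <= C a^(1/p) can
   then be divided by a^(1/p), which leaves a^(1/q) <= C. *)
pose k (n : nat) x := Num.min (g x) n%:R.
have mk n : measurable_fun setT (k n) by exact: measurable_minr.
have k0 n x : 0 <= k n x by rewrite le_min g0 ler0n.
have mkX n r : measurable_fun setT (fun x => k n x `^ r).
  exact: (measurableT_comp (measurable_powR _)).
have kC n : (\int[m]_x (k n x `^ q)%:E <= (C `^ q)%:E)%E.
  have afin : (\int[m]_x (k n x `^ q)%:E)%E \is a fin_num.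
    apply: integrable_fin_num => //.
    apply: (@bounded_integrable _ _ _ m setT _ (n%:R `^ q)) => //.
      by rewrite -ge0_fin_numE// fin_num_measure.
    move=> x; rewrite ger0_norm ?powR_ge0// ge0_ler_powR ?nnegrE ?ler0n ?(ltW q0)//.
    by rewrite ge_min lexx orbT.
  have := dual _ (mkX n (q - 1)).
  rewrite nuI; last 2 first.
  - exact/measurable_EFinP.
  - by move=> x; rewrite lee_fin powR_ge0.
  move=> -/(_ (fun x => powR_ge0 _ _)) H.
  have {H} : (\int[m]_x (k n x `^ q)%:E <= C%:E * (\int[m]_x (k n x `^ q)%:E) `^ p^-1)%E.
    apply: le_trans (le_trans (H _) _).
    - apply: ge0_le_integral => //.
      + by move=> x _; rewrite lee_fin powR_ge0.
      + exact/measurable_EFinP.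
      + by apply: emeasurable_funM; exact/measurable_EFinP.
      + move=> x _; rewrite -EFinM lee_fin -(mulr_powRB1 (k0 n x) q0).
        by rewrite mulrC ler_wpM2l ?powR_ge0// ge_min lexx.
    - exists (n%:R `^ (q - 1)) => x.
      by rewrite ge0_ler_powR ?nnegrE ?ler0n ?(ltW q10)// ge_min lexx orbT.
    - by under eq_integral do rewrite -powRrM pq.
  have : (0 <= \int[m]_x (k n x `^ q)%:E)%E.
    by apply: integral_ge0 => x _; rewrite lee_fin powR_ge0.
  move: afin; case: (\int[m]_x _)%E => //= a _.
  rewrite -EFinM !lee_fin => a0.
  have [->|aN0] := eqVneq a 0; first by move=> _; exact: powR_ge0.
  have {a0 aN0}a0 : 0 < a by rewrite lt_neqAle eq_sym aN0.
  move=> aC.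
  have {aC} : a `^ q^-1 <= C.
    have pa0 : 0 < a `^ p^-1 by exact: powR_gt0.
    rewrite -(ler_pM2r pa0) -powRD ?(addrC q^-1) ?pVqV ?powRr1 ?oner_eq0//; exact: ltW.
  move=> /(ge0_ler_powR (ltW q0)); rewrite ?nnegrE ?powR_ge0// => /(_ isT C0).
  by rewrite -powRrM mulVf ?gt_eqF// powRr1// ltW.
have gC : (\int[m]_x (`|g x| `^ q)%:E <= (C `^ q)%:E)%E.
  have cvk : (\int[m]_x (k n x `^ q)%:E)%E @[n --> \oo] --> (\int[m]_x (`|g x| `^ q)%:E)%E.
    rewrite (_ : (\int[m]_x (`|g x| `^ q)%:E)%E =
      (\int[m]_x limn (fun n => (k n x `^ q)%:E))%E); last first.
      apply: eq_integral => x _; apply/esym/cvg_lim => //.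
      rewrite ger0_norm//; apply: cvg_near_cst; near=> n.
      rewrite /k min_l//; near: n; exact: nbhs_infty_ger.
    apply: cvg_monotone_convergence => //.
    - by move=> n; exact/measurable_EFinP.
    - by move=> n x _; rewrite lee_fin powR_ge0.
    - move=> x _ n1 n2 n12; rewrite lee_fin ge0_ler_powR ?nnegrE ?(ltW q0)//.
      by rewrite le_min !ge_min lexx/= ler_nat n12 orbT.
  apply: (cvge_le _ cvk); exact: nearW.
exists g; split => //.
- apply: Lfun_of_integral => //; apply: (le_lt_trans gC); exact: ltry.
- rewrite unlock /Lnorm -[leRHS]poweRe1 ?lee_fin// -(mulfV (lt0r_neq0 q0)) poweRrM poweR_EFin.
  apply: gt0_ler_poweR => //; rewrite ?invr_ge0 ?(ltW q0)// in_itv/= leey andbT.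
  + by apply: integral_ge0 => x _; rewrite lee_fin powR_ge0.
  + by rewrite lee_fin powR_ge0.
Unshelve. all: by end_near. Qed.

Lemma integral_mul_maxr_le d (T : measurableType d) (R : realType)
    (m : {measure set T -> \bar R}) (h : T -> R) (f : T -> \bar R) (H : R) :
  measurable_fun setT h -> measurable_fun setT f -> (forall x, 0 <= f x)%E ->
  'N[m]_(+oo)[EFin \o h]%E = H%:E ->
  (\int[m]_x (f x * (Num.max (h x) 0)%:E) <= H%:E * \int[m]_x f x)%E.
Proof.
move=> mh mf f0 HE.
have H0 : 0 <= H by rewrite -lee_fin -HE Lnorm_ge0.
have fh0 x : (0 <= f x * (Num.max (h x) 0)%:E)%E.
  by rewrite mule_ge0// lee_fin le_max lexx orbT.
(* The essential supremum norm is defined by cases on whether m has positive mass, so the zero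
   measure is treated apart. *)
have [mT0|mT0] := eqVneq (m setT) 0%E.
  rewrite null_set_integral//; first by rewrite mule_ge0 ?lee_fin ?integral_ge0.
  by apply: emeasurable_funM => //; apply/measurable_EFinP; exact: measurable_maxr.
have mTpos : (0 < m setT)%E by rewrite lt0e mT0/=.
rewrite -ge0_integralZl_EFin//; apply: ge0_integral_ae_ub => //.
- by move=> x _; rewrite mule_ge0.
- exact: emeasurable_funM.
have := ess_sup_inf.ess_sup_ge m (abse \o (EFin \o h)).
move: HE; rewrite unlock /Lnorm mTpos => ->; apply: ae_mono => x /= hH _.
rewrite muleC lee_wpmul2r// lee_fin ge_max H0 andbT -lee_fin.
by apply: (le_trans _ hH); rewrite lee_fin ler_norm.
Qed.

Section energy_flow.
Context (R : realType) (X : completeMetricType R).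
Local Notation leb := (@lebesgue_measure R).
Hypothesis sX : separable_space X.

Lemma ae_fine_speed (g : curve X) : abs_cont g ->
  {ae leb, forall t, `[0%R, 1%R]%classic t -> speed g t = (fine (speed g t))%:E}.
Proof.
move=> acg; have [v [_ _]] := metric_derivative_density sX acg.
by apply: ae_mono => t H /=; rewrite in_itv => /H[_ ->].
Qed.

Variables (m : {finite_measure set (borel X) -> \bar R}) (q p : R).
Hypotheses (q1 : 1 < q) (pE : p = q / (q - 1)).

Lemma energy_flow (rho : probability (borel (curve X)) R) (h : borel X -> R) (H : R) :
  concentrated rho (@AC_curve R X) -> finite_energy q rho ->
  m.-integrable setT (EFin \o h) -> parametric_barycenter m rho h ->
  'N[m]_(+oo)[EFin \o h]%E = H%:E ->
  exists nu : {measure set (borel X) -> \bar R},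
    (forall B, measurable B -> nu B = (\int[rho]_g J_measure (g : curve X) B)%E) /\
    forall f : borel X -> R, measurable_fun setT f -> (forall x, 0 <= f x) ->
      (\int[nu]_x (f x)%:E <= (\int[rho]_g energy q (g : curve X)) `^ q^-1 *
        (H%:E) `^ p^-1 * (\int[m]_x (f x `^ p)%:E) `^ p^-1)%E.
Proof.
move=> conAC [conACq Efin] ih bar HE.
have q0 : 0 < q by exact: lt_trans q1.
have q10 : 0 < q - 1 by rewrite subr_gt0.
have p0 : 0 < p by rewrite pE divr_gt0.
have pVqV : p^-1 + q^-1 = 1 by rewrite pE invf_div mulrBl mul1r subrK mulfV// gt_eqF.
have mh : measurable_fun setT h by have /integrableP[/measurable_EFinP] := ih.
have H0 : 0 <= H by rewrite -lee_fin -HE Lnorm_ge0.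
have [base baseE] := product_unit_measure rho.
(* A real valued speed, as Hoelder's inequality is applied to real functions; along an absolutely
   continuous curve it differs from [speed] only on a null set of times. *)
pose S (z : borel (curve X) * R) : R := fine (speed (z.1 : curve X) z.2).
have mS : measurable_fun setT S.
  exact: (measurableT_comp (fine_measurable measurableT) (measurable_speed sX)).
have S0 z : 0 <= S z by exact/fine_ge0/speed_ge0.
have mSg (g : curve X) : measurable_fun setT (fun t => (S (g, t))%:E).
  apply/measurable_EFinP/(measurableT_comp (fine_measurable measurableT)).
  exact: measurable_speed_curve.
have me := measurable_eval sX.
exists (push_measure (density_measure base mS S0) me); split.
  move=> B mB; rewrite -[B]setIT -integral_indic// ge0_integral_push//; last exact/measurable_EFinP/measurable_indic.
  have mBe : measurable_fun setT (fun z : borel (curve X) * R => \1_B (cpath (z.1 : curve X) z.2 : borel X) : R).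
    exact: (measurableT_comp (measurable_indic mB) me).
  rewrite ge0_integral_density//; last exact/measurable_EFinP.
  rewrite baseE; last 2 first.
  - by apply: emeasurable_funM; exact/measurable_EFinP.
  - by move=> z; rewrite mule_ge0// lee_fin.
  apply/esym/ge0_integral_ae_eq => //.
  - move=> g _; apply: integral_ge0 => t _; rewrite lee_fin mulr_ge0//.
    exact: metric_derivative_ge0.
  - by move=> g _; apply: integral_ge0 => t _; rewrite mule_ge0// lee_fin.
  - apply: (measurable_integral_unit (f := fun z : borel (curve X) * R =>
      ((\1_B (cpath (z.1 : curve X) z.2 : borel X) : R)%:E * (S z)%:E)%E)).
      by apply: emeasurable_funM; exact/measurable_EFinP.
    by move=> z; rewrite mule_ge0// lee_fin.
  have cA : {ae rho, forall g, AC_curve (g : curve X)} := conAC.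
  apply: ae_mono cA => g acg _; rewrite setIT (J_measureE sX acg mB).
  apply: ge0_integral_ae_eq => //.
  - by move=> t _; rewrite mule_ge0 ?lee_fin// speed_ge0.
  - by move=> t _; rewrite mule_ge0 ?lee_fin.
  - apply: measurable_funTS; apply: emeasurable_funM; last exact: mSg.
    apply/measurable_EFinP; exact: (measurableT_comp (measurable_indic mB) (measurable_cpath g sX)).
  by apply: ae_mono (ae_fine_speed acg) => t /[apply] ->.
move=> f mf f0.
pose F (z : borel (curve X) * R) : R := f (cpath (z.1 : curve X) z.2 : borel X).
have mF : measurable_fun setT F by exact: (measurableT_comp mf me).
have F0 z : 0 <= F z by exact: f0.
rewrite ge0_integral_push//; last exact/measurable_EFinP.
rewrite ge0_integral_density//; last exact/measurable_EFinP.
have := hoelder base mF mS p0 q0 pVqV.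
rewrite Lnorm1; under eq_integral.
  move=> z _; rewrite /= normrM (ger0_norm (F0 z)) (ger0_norm (S0 z)) EFinM; over.
move/le_trans; apply; rewrite muleC -muleA unlock /Lnorm.
have -> : (\int[base]_z (`|(EFin \o S) z| `^ q) = \int[rho]_g energy q (g : curve X))%E.
  rewrite baseE; last 2 first.
  - apply/measurable_EFinP/(measurableT_comp (measurable_powR _)); exact: measurableT_comp.
  - by move=> z; exact: poweR_ge0.
  apply/esym/ge0_integral_ae_eq => //.
  - move=> g _; rewrite /energy; case: ifP => // _.
    by apply: integral_ge0 => t _; rewrite lee_fin powR_ge0.
  - by move=> g _; apply: integral_ge0 => t _; exact: poweR_ge0.
  - apply: (measurable_integral_unit (f := fun z : borel (curve X) * R =>
      (`|(EFin \o S) z| `^ q)%E)).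
      apply/measurable_EFinP/(measurableT_comp (measurable_powR _)); exact: measurableT_comp.
    by move=> z; exact: poweR_ge0.
  have cA : {ae rho, forall g, ACq_curve q (g : curve X)} := conACq.
  apply: ae_mono cA => g acg _.
  rewrite /energy asboolT; last by exact: acg.
  apply: (etrans (power_integralE _ sX acg.1)).
  apply: ge0_integral_ae_eq => //.
  - by move=> t _; exact: poweR_ge0.
  - by move=> t _; exact: poweR_ge0.
  - apply: measurable_funTS; apply/measurable_EFinP/(measurableT_comp (measurable_powR _)).
    by apply: measurableT_comp => //; apply/measurable_EFinP; exact: mSg.
  apply: ae_mono (ae_fine_speed acg.1) => t /[apply] ->.
  by rewrite /= ger0_norm.
apply: lee_wpmul2l; first exact: poweR_ge0.
rewrite -poweRM ?lee_fin//; last by apply: integral_ge0 => x _; rewrite lee_fin powR_ge0.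
apply: gt0_ler_poweR => //; rewrite ?invr_ge0 ?(ltW p0)// ?in_itv/= ?leey ?andbT.
- by apply: integral_ge0 => z _; rewrite lee_fin powR_ge0.
- by rewrite mule_ge0 ?lee_fin// integral_ge0// => x _; rewrite lee_fin powR_ge0.
have mfp : measurable_fun setT (fun x => (f x `^ p)%:E).
  exact/measurable_EFinP/(measurableT_comp (measurable_powR _)).
have fp0 x : (0 <= (f x `^ p)%:E)%E by rewrite lee_fin powR_ge0.
(* The p-th power of f along the curves integrates to that of f^p h^+, by the barycenter
   identity. *)
apply: (le_trans _ (integral_mul_maxr_le mh mfp fp0 HE)).
rewrite -(barycenter_ge0 sX ih bar)// baseE; last 2 first.
- apply/measurable_EFinP/(measurableT_comp (measurable_powR _)); exact: measurableT_comp.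
- by move=> z; rewrite lee_fin powR_ge0.
rewrite le_eqVlt; apply/orP; left; apply/eqP.
by apply: eq_integral => g _; apply: eq_integral => t _; rewrite /= ger0_norm.
Qed.

End energy_flow.

(** * The image plan and its barycenter *)

Section nonparam_barycenter.
Context (R : realType) (X : completeMetricType R).
Local Notation leb := (@lebesgue_measure R).
Hypothesis sX : separable_space X.

(** The Borel set serves as D in [measurable_i_map], and a point of it supplies the base class
    c0. *)
Lemma probability_supported d (T : measurableType d) (P : probability T R) (A : set T) :
  concentrated P A -> exists2 D, measurable D &
    [/\ D `<=` A, P (~` D) = 0%E & D !=set0].
Proof.
move=> [N [mN PN AN]]; exists (~` N); first exact: measurableC.
split; [|by rewrite setCK|].
  by move=> x Nx; apply: contrapT => /AN.
apply/set0P/eqP => /(congr1 setC); rewrite setCK setC0 => NT.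
by have := probability_setT P; rewrite -NT PN => /esym/eqP; rewrite onee_eq0.
Qed.

Lemma J_measure_ge0 (g : curve X) (B : set X) : (0 <= J_measure g B)%E.
Proof.
by apply: integral_ge0 => t _; rewrite lee_fin mulr_ge0//; exact: metric_derivative_ge0.
Qed.

Lemma image_barycenter (rho : probability (borel (curve X)) R) :
  concentrated rho [set g : curve X | AC_curve g /\ (0 < curve_length g)%E] ->
  exists (c0 : nonparam X) (ppi : probability (borel (pnonparam c0)) R),
    image_measure rho (i_map c0 : _ -> borel (pnonparam c0)) ppi /\
    forall B : set (borel X), measurable B ->
      (\int[ppi]_c J_measure (representative c) B = \int[rho]_g J_measure (g : curve X) B)%E.
Proof.
move=> /probability_supported[D mD [DA D0 [g0 Dg0]]].
have {}DA (g : curve X) : D g -> abs_cont g /\ 0 < vfun g (clamp 1).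
  by move=> /DA[acg]; rewrite curve_lengthE// lte_fin.
have [ac0 L0] := DA _ Dg0.
pose c0 : nonparam X := \pi_(nonparam X) (mkAC0 (ACc_AC0 sX (karc_ACc sX ac0 L0))).
have mi := measurable_i_map sX (c0 := c0) mD DA.
(* i' is Borel and equals [i_map] on D, so the preimages of a Borel set under the two maps differ
   only off D. *)
set i' := (fun g => _) in mi.
have i'E g : D g -> i' g = i_map c0 g by move=> Dg; rewrite /i' asboolT.
have [|ppi pE pI] := @measure_probability _ _ _ (push_measure rho mi).
  by rewrite /= /push_measure preimage_setT probability_setT.
exists c0, ppi; split => [B mB|B mB].
  have mA : measurable (i' @^-1` B : set (borel (curve X))) by rewrite -[X in measurable X]setTI; apply: (mi).
  exists (i' @^-1` B); split; [exact: mA| |exact: pE].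
  exists (~` D); split; [exact: measurableC|exact: D0|].
  move=> g /= H Dg; move: H; rewrite /preimage/= => -[] [].
    by rewrite i'E// => H; apply; exact: H.
  by move=> H; apply; rewrite /= i'E.
have mJ : measurable_fun setT (fun c : borel (pnonparam c0) => J_measure (j_map c : curve X) B).
  have mu : measurable_fun setT (fun g : borel (curve X) =>
      \int[leb]_(t in `[0%R, 1%R]) ((\1_B (cpath (g : curve X) t : borel X) : R)%:E * speed (g : curve X) t))%E.
    apply: (measurable_integral_unit (f := fun z : borel (curve X) * R =>
      ((\1_B (cpath (z.1 : curve X) z.2 : borel X) : R)%:E * speed (z.1 : curve X) z.2)%E)).
      apply: emeasurable_funM; last exact: measurable_speed.
      by apply/measurable_EFinP; exact: (measurableT_comp (measurable_indic mB) (measurable_eval sX)).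
    by move=> z; rewrite mule_ge0 ?lee_fin// speed_ge0.
  have mu' := measurableT_comp mu (measurable_j_map sX (c0 := c0)).
  apply: (eq_measurable_fun _ _ mu') => c _.
  by rewrite /= (J_measureE sX (ACc_AC0 sX (j_map_spec sX c).1).1).
transitivity (\int[ppi]_c J_measure (j_map c : curve X) B)%E.
  by apply: eq_integral => c _; exact: J_measure_representative.
apply: (etrans (pI _)); apply: (etrans (ge0_integral_push rho mi mJ (fun c => J_measure_ge0 _ _))).
apply/esym/ge0_integral_ae_eq => //.
- by move=> g _; exact: J_measure_ge0.
- by move=> g _; exact: J_measure_ge0.
- exact: (measurableT_comp mJ mi).
have nD : {ae rho, forall g, D g} by exists (~` D); split => //; exact: measurableC.
apply: ae_mono nD => g Dg _; have [acg Lg] := DA _ Dg.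
by rewrite (i'E _ Dg) (i_map_spec sX _ acg Lg) (J_measure_karc sX acg Lg mB).
Qed.

Lemma energy_barycenter (m : {finite_measure set (borel X) -> \bar R}) (q p : R)
    (rho : probability (borel (curve X)) R) (h : borel X -> R) :
  1 < q -> p = q / (q - 1) ->
  concentrated rho [set g : curve X | AC_curve g /\ (0 < curve_length g)%E] ->
  finite_energy q rho -> h \in Lfun m +oo%E -> parametric_barycenter m rho h ->
  exists (c0 : nonparam X) (ppi : probability (borel (pnonparam c0)) R),
    image_measure rho (i_map c0 : _ -> borel (pnonparam c0)) ppi /\
    exists g : borel X -> R,
      [/\ g \in Lfun m q%:E, barycenter m ppi g &
          ('N[m]_(q%:E)[EFin \o g] <=
           (\int[rho]_g energy q (g : curve X)) `^ q^-1 * 'N[m]_(+oo)[EFin \o h] `^ p^-1)%E].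
Proof.
move=> q1 pE conc fen hL bar.
have [c0 [ppi [im J]]] := image_barycenter conc.
exists c0, ppi; split => //.
have conAC : concentrated rho (@AC_curve R X).
  by apply: negligibleS conc => g nA [acg _]; exact: nA.
have ih : m.-integrable setT (EFin \o h).
  apply/Lfun1_integrable.
  apply: (@Lfun_subset _ _ _ m 1%E +oo%E (lexx _) (leey _) (fin_num_measure m _ measurableT) (leey _) _ hL).
have Hfin : 'N[m]_(+oo)[EFin \o h]%E \is a fin_num.
  rewrite ge0_fin_numE; last exact: Lnorm_ge0.
  by move: hL; rewrite inE => /andP[_ /[!inE]].
have HE : 'N[m]_(+oo)[EFin \o h]%E = (fine 'N[m]_(+oo)[EFin \o h]%E)%:E by rewrite fineK.
have [nu [nuE dual]] := energy_flow sX q1 pE conAC fen ih bar HE.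
have E0 : (0 <= \int[rho]_g energy q (g : curve X))%E.
  apply: integral_ge0 => g _; rewrite /energy; case: ifP => // _.
  by apply: integral_ge0 => t _; rewrite lee_fin powR_ge0.
have Efin : (\int[rho]_g energy q (g : curve X))%E \is a fin_num by rewrite ge0_fin_numE//; case: fen.
have Cfin : ((\int[rho]_g energy q (g : curve X)) `^ q^-1 * 'N[m]_(+oo)[EFin \o h] `^ p^-1)%E \is a fin_num.
  by rewrite fin_numM// fin_num_poweR.
move: dual; rewrite -HE -(fineK Cfin) => dual.
have [|g [gL gE gC]] := Lq_duality q1 pE _ (fun f mf f0 _ => dual f mf f0).
  by apply/fine_ge0/mule_ge0; exact: poweR_ge0.
by exists g; split => // B mB; rewrite J// -nuE// gE.
Qed.

End nonparam_barycenter.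

Theorem theorem8p5 (R : realType) (X : completeMetricType R)
    (sepX : separable_space X) (m : {finite_measure set (borel X) -> \bar R})
    (q p : R) (q_gt1 : 1 < q) (p_def : p = q / (q - 1)) :
  [/\ (forall (rho : probability (borel (curve X)) R) (h : borel X -> R),
        concentrated rho [set g | AC_curve g /\ (0 < curve_length g)%E] ->
        finite_energy q rho ->
        h \in Lfun m +oo%E ->
        parametric_barycenter m rho h ->
        exists (c0 : nonparam X) (ppi : probability (borel (pnonparam c0)) R),
          image_measure rho (i_map c0 : _ -> borel (pnonparam c0)) ppi /\
          exists g : borel X -> R,
            [/\ g \in Lfun m q%:E,
                barycenter m ppi g &
                ('N[m]_(q%:E)[EFin \o g] <=
                 (\int[rho]_g energy q g) `^ q^-1 *
                 'N[m]_(+oo)[EFin \o h] `^ p^-1)%E]),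
      (forall (c0 : nonparam X) (ppi : probability (borel (pnonparam c0)) R)
          (G : set (nonparam X)),
        (exists2 g : borel X -> R, g \in Lfun m q%:E & barycenter m ppi g) ->
        (exists M : R, {ae ppi, forall c, (nonparam_length c <= M%:E)%E}) ->
        souslin R G ->
        concentrated ppi G ->
        exists rho : probability (borel (curve X)) R,
          [/\ finite_energy q rho,
              (exists2 h : borel X -> R,
                h \in Lfun m +oo%E & parametric_barycenter m rho h) &
              exists S : set (curve X),
                [/\ souslin R S, S `<=` equivalent_curves (@j_map R X @` G) &
                    concentrated rho S]]) &
      (forall (sigma : probability (borel (curve X)) R) (G : set (curve X)),
        souslin R G ->
        G `<=` @ACinfty_curve R X ->
        concentrated sigma G ->
        (exists2 h : borel X -> R,
          h \in Lfun m q%:E & parametric_barycenter m sigma h) ->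
        (exists L : R, {ae sigma, forall g, has_lipschitz_constant L g}) ->
        exists rho : probability (borel (curve X)) R,
          [/\ finite_energy q rho,
              (exists2 h : borel X -> R,
                h \in Lfun m +oo%E & parametric_barycenter m rho h) &
              exists S : set (curve X),
                [/\ souslin R S, S `<=` equivalent_curves G &
                    concentrated rho S]])].
Proof.
split.
- by move=> rho h; exact: energy_barycenter.
- move=> c0 ppi G [g gL bar] [M lM] _ conG.
  have [sigma [h [conj lip hL barh]]] := nonparam_plan sepX q_gt1 gL bar lM conG.
  apply: (bounded_density_plan sepX q_gt1 _ conj lip hL barh) => _ [c _ <-].
  exact: (ACc_AC0 sepX (j_map_spec sepX c).1).1.
- move=> sigma G _ GL conG [h hL bar] [L lip].
  apply: (bounded_density_plan sepX q_gt1 _ conG lip hL bar) => g /GL.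
  exact: ACinfty_abs_cont.
Qed.
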